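(* Let $Y$ be a finite poset and let $Y_0\subseteq Y$ be a subset such that $[y,\cdot]\cap[y',\cdot]=\emptyset$ and $[\cdot,y]\cap[\cdot,y']=\emptyset$ for any $y\ne y'$ in $Y_0$, where $[y,\cdot]=\{y'\in Y: y'\ge y\}$ and $[\cdot,y]=\{y'\in Y:y'\le y\}$. Let $*$ be an additional point and let $\le_+^{Y_0}$ and $\le_-^{Y_0}$ be the partial orders on $Y\cup\{*\}$ obtained by extending the order on $Y$ according to $$*<_+^{Y_0}y\iff\exists\,y_0\in Y_0\text{ with }y_0\le y,\qquad y<_-^{Y_0}*\iff\exists\,y_0\in Y_0\text{ with }y\le y_0\qquad(y\in Y),$$ with no other relations. Then the posets $(Y\cup\{*\},\le_+^{Y_0})$ and $(Y\cup\{*\},\le_-^{Y_0})$ are universally derived equivalent.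
   Context: For a poset $P$ (viewed as a small category with a unique morphism $p\to p'$ if $p\le p'$ and none otherwise) and a category $\mathcal{A}$, $\mathcal{A}^P$ denotes the category of functors $P\to\mathcal{A}$. If $\mathcal{A}$ is abelian, so is $\mathcal{A}^P$, and $D(\mathcal{A}^P)$ denotes its (unbounded) derived category with its standard triangulated structure. Two posets $P$ and $Q$ are universally derived equivalent if for every abelian category $\mathcal{A}$ the derived categories $D(\mathcal{A}^P)$ and $D(\mathcal{A}^Q)$ are equivalent as triangulated categories. *)

(* Defs.v *)
From HB Require Import structures.
From Stdlib Require Import Setoid Morphisms.
From mathcomp Require Import all_boot all_order all_algebra.

Set Implicit Arguments.
Unset Strict Implicit.
Unset Printing Implicit Defensive.

Import Order.TTheory GRing.Theory.

#[local] Obligation Tactic := idtac.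

(** Categories are taken with hom-setoids: [f ≈ g] is equality of morphisms.
    A category in the usual sense is the case where [≈] is Leibniz equality.
    Hom-setoids make localizations available without quotient types. *)

Declare Scope cat_scope.
Delimit Scope cat_scope with cat.
Local Open Scope cat_scope.

Record category := Category {
  ob :> Type;
  hom : ob -> ob -> Type;
  heq : forall {x y : ob}, hom x y -> hom x y -> Prop;
  heq_equivalence : forall x y : ob, Equivalence (@heq x y);
  idm : forall x : ob, hom x x;
  compose : forall {x y z : ob}, hom y z -> hom x y -> hom x z;
  compose_proper : forall x y z : ob,
    Proper (@heq y z ==> @heq x y ==> @heq x z) (@compose x y z);
  compose_idl : forall (x y : ob) (f : hom x y), heq (compose (idm y) f) f;
  compose_idr : forall (x y : ob) (f : hom x y), heq (compose f (idm x)) f;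
  compose_assoc : forall (w x y z : ob) (h : hom y z) (g : hom x y)
    (f : hom w x), heq (compose h (compose g f)) (compose (compose h g) f)
}.
Arguments hom {c} x y.
Arguments heq {c x y} f g.
Arguments idm {c} x.
Arguments compose {c x y z} g f.

Notation "f ≈ g" := (heq f g) (at level 70, no associativity) : cat_scope.
Notation "g ∘ f" := (compose g f) (at level 40, left associativity) : cat_scope.

#[export] Existing Instance heq_equivalence.
#[export] Existing Instance compose_proper.
#[export] Hint Extern 0 (heq _ _) => reflexivity : core.

Record functor (C D : category) := Functor {
  fob :> C -> D;
  fmap : forall {x y : C}, hom x y -> hom (fob x) (fob y);
  fmap_proper : forall x y : C, Proper (heq ==> heq) (@fmap x y);
  fmap_id : forall x : C, fmap (idm x) ≈ idm (fob x);
  fmap_comp : forall (x y z : C) (g : hom y z) (f : hom x y),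
    fmap (g ∘ f) ≈ fmap g ∘ fmap f
}.
Arguments fmap {C D} _ {x y} _.
#[export] Existing Instance fmap_proper.

Program Definition functor_id (C : category) : functor C C :=
  {| fob := fun x => x; fmap := fun _ _ f => f |}.
Next Obligation. by move=> C x y f g. Qed.
Next Obligation. reflexivity. Qed.
Next Obligation. reflexivity. Qed.

Program Definition functor_comp (C D E : category)
    (G : functor D E) (F : functor C D) : functor C E :=
  {| fob := fun x => G (F x); fmap := fun _ _ f => fmap G (fmap F f) |}.
Next Obligation. by move=> C D E G F x y f g ->. Qed.
Next Obligation. by move=> C D E G F x /=; rewrite fmap_id fmap_id. Qed.
Next Obligation. by move=> C D E G F x y z g f /=; rewrite fmap_comp fmap_comp. Qed.

Record nat_trans (C D : category) (F G : functor C D) := NatTrans {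
  component :> forall x : C, hom (F x) (G x);
  naturality : forall (x y : C) (f : hom x y),
    component y ∘ fmap F f ≈ fmap G f ∘ component x
}.

Definition nat_eq (C D : category) (F G : functor C D) (s t : nat_trans F G) :=
  forall x : C, s x ≈ t x.

Program Definition nat_id (C D : category) (F : functor C D) : nat_trans F F :=
  {| component := fun x => idm (F x) |}.
Next Obligation.
by move=> C D F x y f /=; rewrite compose_idl compose_idr.
Qed.

Program Definition nat_comp (C D : category) (F G H : functor C D)
    (t : nat_trans G H) (s : nat_trans F G) : nat_trans F H :=
  {| component := fun x => t x ∘ s x |}.
Next Obligation.
move=> C D F G H t s x y f.
by rewrite -compose_assoc naturality !compose_assoc naturality.
Qed.

Program Definition functor_category (C D : category) : category :=
  {| ob := functor C D; hom := @nat_trans C D; heq := @nat_eq C D;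
     idm := @nat_id C D; compose := @nat_comp C D |}.
Next Obligation.
move=> C D F G; split.
- by move=> s x; reflexivity.
- by move=> s t st x; symmetry; apply: st.
- by move=> r s t rs st x; transitivity (s x); [apply: rs | apply: st].
Qed.
Next Obligation.
by move=> C D F G H s s' es t t' et x /=; rewrite (es x) (et x).
Qed.
Next Obligation. by move=> C D F G s x; apply: compose_idl. Qed.
Next Obligation. by move=> C D F G s x; apply: compose_idr. Qed.
Next Obligation. by move=> C D F G H K t s r x; apply: compose_assoc. Qed.

Definition is_iso (C : category) (x y : C) (f : hom x y) : Prop :=
  exists g : hom y x, g ∘ f ≈ idm x /\ f ∘ g ≈ idm y.

Definition nat_iso (C D : category) (F G : functor C D) (s : nat_trans F G) :=
  forall x : C, is_iso (s x).

Definition is_equivalence (C D : category) (F : functor C D) : Prop :=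
  exists G : functor D C,
    (exists s : nat_trans (functor_comp G F) (functor_id C), nat_iso s) /\
    (exists t : nat_trans (functor_comp F G) (functor_id D), nat_iso t).

Program Definition poset_category (d : Order.disp_t) (P : porderType d) :
    category :=
  {| ob := P; hom := fun p p' => (p <= p')%O; heq := fun _ _ _ _ => True;
     idm := @lexx d P; compose := fun _ _ _ g f => le_trans f g |}.
Next Obligation. by []. Qed.
Next Obligation. by []. Qed.
Next Obligation. by []. Qed.
Next Obligation. by []. Qed.
Next Obligation. by []. Qed.

Record preadditive := Preadditive {
  preadd_cat :> category;
  hadd : forall {x y : preadd_cat}, hom x y -> hom x y -> hom x y;
  hzero : forall {x y : preadd_cat}, hom x y;
  hopp : forall {x y : preadd_cat}, hom x y -> hom x y;
  hadd_proper : forall x y : preadd_cat,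
    Proper (heq ==> heq ==> heq) (@hadd x y);
  haddA : forall (x y : preadd_cat) (f g h : hom x y),
    hadd f (hadd g h) ≈ hadd (hadd f g) h;
  haddC : forall (x y : preadd_cat) (f g : hom x y), hadd f g ≈ hadd g f;
  hadd0 : forall (x y : preadd_cat) (f : hom x y), hadd hzero f ≈ f;
  haddN : forall (x y : preadd_cat) (f : hom x y), hadd (hopp f) f ≈ hzero;
  compose_addl : forall (x y z : preadd_cat) (g h : hom y z) (f : hom x y),
    hadd g h ∘ f ≈ hadd (g ∘ f) (h ∘ f);
  compose_addr : forall (x y z : preadd_cat) (h : hom y z) (f g : hom x y),
    h ∘ hadd f g ≈ hadd (h ∘ f) (h ∘ g)
}.
Arguments hadd {p x y} f g.
Arguments hzero {p x y}.
Arguments hopp {p x y} f.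
#[export] Existing Instance hadd_proper.

Notation "f ⊕ g" := (hadd f g) (at level 50, left associativity) : cat_scope.
Notation "⊖ f" := (hopp f) (at level 35, right associativity) : cat_scope.

Section PreadditiveTheory.
Variable A : preadditive.
Implicit Types x y z : A.

Lemma hadd0r x y (f : hom x y) : f ⊕ hzero ≈ f.
Proof. by rewrite haddC hadd0. Qed.

Lemma haddNr x y (f : hom x y) : f ⊕ ⊖ f ≈ hzero.
Proof. by rewrite haddC haddN. Qed.

Lemma hadd_cancel x y (f g h : hom x y) : h ⊕ f ≈ h ⊕ g -> f ≈ g.
Proof.
by move=> e; rewrite -(hadd0 f) -(hadd0 g) -(haddN h) -!haddA e.
Qed.

Lemma compose0l x y z (f : hom x y) : (hzero : hom y z) ∘ f ≈ hzero.
Proof.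
apply: (@hadd_cancel _ _ _ _ (hzero ∘ f)).
by rewrite -compose_addl hadd0 hadd0r.
Qed.

Lemma compose0r x y z (f : hom y z) : f ∘ (hzero : hom x y) ≈ hzero.
Proof.
apply: (@hadd_cancel _ _ _ _ (f ∘ hzero)).
by rewrite -compose_addr hadd0 hadd0r.
Qed.

Lemma composeNl x y z (g : hom y z) (f : hom x y) : (⊖ g) ∘ f ≈ ⊖ (g ∘ f).
Proof.
apply: (@hadd_cancel _ _ _ _ (g ∘ f)).
by rewrite -compose_addl !haddNr compose0l.
Qed.

Lemma composeNr x y z (g : hom y z) (f : hom x y) : g ∘ (⊖ f) ≈ ⊖ (g ∘ f).
Proof.
apply: (@hadd_cancel _ _ _ _ (g ∘ f)).
by rewrite -compose_addr !haddNr compose0r.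
Qed.

Lemma hoppK x y (f : hom x y) : ⊖ ⊖ f ≈ f.
Proof. by apply: (@hadd_cancel _ _ _ _ (⊖ f)); rewrite haddNr haddN. Qed.

#[export] Instance hopp_proper x y : Proper (heq ==> heq) (@hopp A x y).
Proof.
move=> f g e; apply: (@hadd_cancel _ _ _ _ f).
by rewrite haddNr e haddNr.
Qed.

Lemma hopp0 x y : ⊖ (hzero : hom x y) ≈ hzero.
Proof. by apply: (@hadd_cancel _ _ _ _ hzero); rewrite haddNr hadd0. Qed.

Lemma hsub_eq x y (f g : hom x y) : f ⊕ ⊖ g ≈ hzero -> f ≈ g.
Proof. by move=> e; apply: (@hadd_cancel _ _ _ _ (⊖ g)); rewrite haddC e haddN. Qed.

End PreadditiveTheory.

Definition monic (C : category) (x y : C) (f : hom x y) : Prop :=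
  forall (w : C) (a b : hom w x), f ∘ a ≈ f ∘ b -> a ≈ b.

Definition epic (C : category) (x y : C) (f : hom x y) : Prop :=
  forall (z : C) (a b : hom y z), a ∘ f ≈ b ∘ f -> a ≈ b.

Record is_kernel (A : preadditive) (x y k : A) (f : hom x y) (i : hom k x) :=
  IsKernel {
  ker_zero : f ∘ i ≈ hzero;
  ker_lift : forall (w : A) (g : hom w x), f ∘ g ≈ hzero -> hom w k;
  ker_liftK : forall (w : A) (g : hom w x) (fg0 : f ∘ g ≈ hzero),
    i ∘ ker_lift fg0 ≈ g;
  ker_monic : monic i
}.

Record is_cokernel (A : preadditive) (x y c : A) (f : hom x y) (p : hom y c) :=
  IsCokernel {
  coker_zero : p ∘ f ≈ hzero;
  coker_desc : forall (z : A) (g : hom y z), g ∘ f ≈ hzero -> hom c z;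
  coker_descK : forall (z : A) (g : hom y z) (gf0 : g ∘ f ≈ hzero),
    coker_desc gf0 ∘ p ≈ g;
  coker_epic : epic p
}.

Record kernel (A : preadditive) (x y : A) (f : hom x y) := Kernel {
  ker : A;
  ker_map : hom ker x;
  ker_is_kernel : is_kernel f ker_map
}.

Record cokernel (A : preadditive) (x y : A) (f : hom x y) := Cokernel {
  coker : A;
  coker_map : hom y coker;
  coker_is_cokernel : is_cokernel f coker_map
}.

Record zero_object (A : preadditive) := ZeroObject {
  zob : A;
  zob_terminal : forall (x : A) (f : hom x zob), f ≈ hzero;
  zob_initial : forall (x : A) (f : hom zob x), f ≈ hzero
}.

Record biproduct (A : preadditive) (x y : A) := Biproduct {
  bip : A;
  bip_inl : hom x bip;
  bip_inr : hom y bip;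
  bip_prl : hom bip x;
  bip_prr : hom bip y;
  bip_ll : bip_prl ∘ bip_inl ≈ idm x;
  bip_rr : bip_prr ∘ bip_inr ≈ idm y;
  bip_lr : bip_prl ∘ bip_inr ≈ hzero;
  bip_rl : bip_prr ∘ bip_inl ≈ hzero;
  bip_id : (bip_inl ∘ bip_prl) ⊕ (bip_inr ∘ bip_prr) ≈ idm bip
}.

(** Abelian categories come with chosen kernels, cokernels, zero object and
    binary biproducts. *)
Record abelian := Abelian {
  ab_preadd :> preadditive;
  ab_zero : zero_object ab_preadd;
  ab_biproduct : forall x y : ab_preadd, biproduct x y;
  ab_kernel : forall (x y : ab_preadd) (f : hom x y), kernel f;
  ab_cokernel : forall (x y : ab_preadd) (f : hom x y), cokernel f;
  monic_normal : forall (x y : ab_preadd) (f : hom x y), monic f ->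
    {z : ab_preadd & {g : hom y z & is_kernel g f}};
  epic_normal : forall (x y : ab_preadd) (f : hom x y), epic f ->
    {w : ab_preadd & {g : hom w x & is_cokernel g f}}
}.
Arguments ab_biproduct {a} x y.
Arguments ab_kernel {a x y} f.
Arguments ab_cokernel {a x y} f.

Section FunctorAbelian.
Variable C : category.

Section Preadd.
Variable A : preadditive.

Program Definition nat_add (F G : functor C A) (s t : nat_trans F G) :
    nat_trans F G := {| component := fun x => s x ⊕ t x |}.
Next Obligation.
by move=> F G s t x y f /=; rewrite compose_addl compose_addr !naturality.
Qed.

Program Definition nat_zero (F G : functor C A) : nat_trans F G :=
  {| component := fun x => hzero |}.
Next Obligation. by move=> F G x y f /=; rewrite compose0l compose0r. Qed.

Program Definition nat_opp (F G : functor C A) (s : nat_trans F G) :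
    nat_trans F G := {| component := fun x => ⊖ s x |}.
Next Obligation.
by move=> F G s x y f /=; rewrite composeNl composeNr naturality.
Qed.

Program Definition functor_preadditive : preadditive :=
  {| preadd_cat := functor_category C A;
     hadd := nat_add; hzero := nat_zero; hopp := nat_opp |}.
Next Obligation. by move=> F G s s' es t t' et x /=; rewrite (es x) (et x). Qed.
Next Obligation. by move=> F G r s t x; apply: haddA. Qed.
Next Obligation. by move=> F G r s x; apply: haddC. Qed.
Next Obligation. by move=> F G r x; apply: hadd0. Qed.
Next Obligation. by move=> F G r x; apply: haddN. Qed.
Next Obligation. by move=> F G H r s t x; apply: compose_addl. Qed.
Next Obligation. by move=> F G H r s t x; apply: compose_addr. Qed.

End Preadd.

Variable A : abelian.
Let AC : preadditive := functor_preadditive A.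

Program Definition functor_zob : functor C A :=
  {| fob := fun _ => zob (ab_zero A); fmap := fun _ _ _ => idm _ |}.
Next Obligation. by move=> x y f g _; reflexivity. Qed.
Next Obligation. by move=> x; reflexivity. Qed.
Next Obligation. by move=> x y z g f /=; rewrite compose_idl. Qed.

Program Definition functor_zero : zero_object AC := {| zob := functor_zob |}.
Next Obligation. by move=> F s x; apply: zob_terminal. Qed.
Next Obligation. by move=> F s x; apply: zob_initial. Qed.

Section Bip.
Variables F G : functor C A.
Let b x := ab_biproduct (F x) (G x).

Program Definition functor_bip : functor C A :=
  {| fob := fun x => bip (b x);
     fmap := fun x y f =>
       (bip_inl (b y) ∘ fmap F f ∘ bip_prl (b x)) ⊕
       (bip_inr (b y) ∘ fmap G f ∘ bip_prr (b x)) |}.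
Next Obligation. by move=> x y f g ->; reflexivity. Qed.
Next Obligation. by move=> x /=; rewrite !fmap_id !compose_idr bip_id. Qed.
Next Obligation.
move=> x y z g f /=; rewrite compose_addl !compose_addr.
have E (u v w t r : A) (p : hom u v) (q : hom w u) (s : hom t w) (i : hom r t)
    (j : hom r t) : p ∘ q ∘ s ∘ (i) ≈ p ∘ q ∘ (s ∘ i) by rewrite compose_assoc.
rewrite !fmap_comp.
have El : bip_inl (b z) ∘ fmap F g ∘ bip_prl (b y) ∘
    (bip_inl (b y) ∘ fmap F f ∘ bip_prl (b x)) ≈
    bip_inl (b z) ∘ (fmap F g ∘ fmap F f) ∘ bip_prl (b x).
  rewrite !compose_assoc -(compose_assoc _ (bip_prl (b y))) bip_ll.
  by rewrite compose_idr.
have Er : bip_inr (b z) ∘ fmap G g ∘ bip_prr (b y) ∘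
    (bip_inr (b y) ∘ fmap G f ∘ bip_prr (b x)) ≈
    bip_inr (b z) ∘ (fmap G g ∘ fmap G f) ∘ bip_prr (b x).
  rewrite !compose_assoc -(compose_assoc _ (bip_prr (b y))) bip_rr.
  by rewrite compose_idr.
have Elr : bip_inl (b z) ∘ fmap F g ∘ bip_prl (b y) ∘
    (bip_inr (b y) ∘ fmap G f ∘ bip_prr (b x)) ≈ hzero.
  rewrite !compose_assoc -(compose_assoc _ (bip_prl (b y))) bip_lr.
  by rewrite compose0r !compose0l.
have Erl : bip_inr (b z) ∘ fmap G g ∘ bip_prr (b y) ∘
    (bip_inl (b y) ∘ fmap F f ∘ bip_prl (b x)) ≈ hzero.
  rewrite !compose_assoc -(compose_assoc _ (bip_prr (b y))) bip_rl.
  by rewrite compose0r !compose0l.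
by rewrite El Er Elr Erl hadd0 hadd0r.
Qed.

Program Definition functor_biproduct : @biproduct AC F G :=
  {| bip := functor_bip;
     bip_inl := {| component := fun x => bip_inl (b x) |};
     bip_inr := {| component := fun x => bip_inr (b x) |};
     bip_prl := {| component := fun x => bip_prl (b x) |};
     bip_prr := {| component := fun x => bip_prr (b x) |} |}.
Next Obligation.
move=> x y f /=; rewrite compose_addl -!compose_assoc bip_ll bip_rl.
by rewrite compose_idr !compose0r hadd0r.
Qed.
Next Obligation.
move=> x y f /=; rewrite compose_addl -!compose_assoc bip_lr bip_rr.
by rewrite compose_idr !compose0r hadd0.
Qed.
Next Obligation.
move=> x y f /=; rewrite compose_addr !compose_assoc bip_ll bip_lr.
by rewrite compose_idl !compose0l hadd0r.
Qed.
Next Obligation.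
move=> x y f /=; rewrite compose_addr !compose_assoc bip_rl bip_rr.
by rewrite compose_idl !compose0l hadd0.
Qed.
Next Obligation. by move=> x /=; apply: bip_ll. Qed.
Next Obligation. by move=> x /=; apply: bip_rr. Qed.
Next Obligation. by move=> x /=; apply: bip_lr. Qed.
Next Obligation. by move=> x /=; apply: bip_rl. Qed.
Next Obligation. by move=> x /=; apply: bip_id. Qed.

End Bip.

Section Pointwise.
Variables (F G K : functor C A).

Program Definition pointwise_kernel (s : nat_trans F G) (i : nat_trans K F)
    (ki : forall x, is_kernel (s x) (i x)) : @is_kernel AC F G K s i :=
  {| ker_lift := fun W g e =>
       {| component := fun x => ker_lift (ki x) (e x) |} |}.
Next Obligation. by move=> s i ki x; apply: (ker_zero (ki x)). Qed.
Next Obligation.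
move=> s i ki W g e x y f /=; apply: (ker_monic (ki y)).
rewrite !compose_assoc (ker_liftK (ki y)) (naturality g) (naturality i).
by rewrite -compose_assoc (ker_liftK (ki x)).
Qed.
Next Obligation. by move=> s i ki W g e x; apply: ker_liftK. Qed.
Next Obligation.
by move=> s i ki W a c e x /=; apply: (ker_monic (ki x)); apply: e.
Qed.

Program Definition pointwise_cokernel (s : nat_trans F G) (p : nat_trans G K)
    (kp : forall x, is_cokernel (s x) (p x)) : @is_cokernel AC F G K s p :=
  {| coker_desc := fun W g e =>
       {| component := fun x => coker_desc (kp x) (e x) |} |}.
Next Obligation. by move=> s p kp x; apply: (coker_zero (kp x)). Qed.
Next Obligation.
move=> s p kp W g e x y f /=; apply: (coker_epic (kp x)).
rewrite -!compose_assoc (coker_descK (kp x)) -(naturality p) -(naturality g).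
by rewrite compose_assoc (coker_descK (kp y)).
Qed.
Next Obligation. by move=> s p kp W g e x; apply: coker_descK. Qed.
Next Obligation.
by move=> s p kp W a c e x /=; apply: (coker_epic (kp x)); apply: e.
Qed.

End Pointwise.

Section Ker.
Variables (F G : functor C A) (s : nat_trans F G).
Let k x := ab_kernel (s x).
Let kP x := ker_is_kernel (k x).

Lemma functor_ker_subproof (x y : C) (f : hom x y) :
  s y ∘ (fmap F f ∘ ker_map (k x)) ≈ hzero.
Proof.
by rewrite compose_assoc naturality -compose_assoc (ker_zero (kP x)) compose0r.
Qed.

Program Definition functor_ker : functor C A :=
  {| fob := fun x => ker (k x);
     fmap := fun x y f => ker_lift (kP y) (functor_ker_subproof f) |}.
Next Obligation.
by move=> x y f g e /=; apply: (ker_monic (kP y)); rewrite !ker_liftK e.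
Qed.
Next Obligation.
move=> x /=; apply: (ker_monic (kP x)).
by rewrite ker_liftK fmap_id compose_idl compose_idr.
Qed.
Next Obligation.
move=> x y z g f /=; apply: (ker_monic (kP z)).
rewrite ker_liftK compose_assoc ker_liftK -compose_assoc ker_liftK.
by rewrite fmap_comp compose_assoc.
Qed.

Program Definition functor_ker_map : nat_trans functor_ker F :=
  {| component := fun x => ker_map (k x) |}.
Next Obligation. by move=> x y f /=; rewrite ker_liftK. Qed.

Definition functor_kernel : @kernel AC F G s :=
  @Kernel AC F G s functor_ker functor_ker_map
    (@pointwise_kernel F G functor_ker s functor_ker_map kP).

Lemma pointwise_monic : @monic AC F G s -> forall x, monic (s x).
Proof.
move=> ms x.
have k0 : ker_map (k x) ≈ hzero.
  have := @ms functor_ker functor_ker_map (nat_zero _ _).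
  move=> /(_ _ x); apply=> y /=.
  by rewrite (ker_zero (kP y)) compose0r.
move=> w a c e; apply: hsub_eq.
have z : s x ∘ (a ⊕ ⊖ c) ≈ hzero by rewrite compose_addr composeNr e haddNr.
rewrite -(ker_liftK (kP x) z); move: (ker_lift _ _) => u.
by rewrite k0 compose0l.
Qed.

End Ker.

Section Coker.
Variables (F G : functor C A) (s : nat_trans F G).
Let k x := ab_cokernel (s x).
Let kP x := coker_is_cokernel (k x).

Lemma functor_coker_subproof (x y : C) (f : hom x y) :
  (coker_map (k y) ∘ fmap G f) ∘ s x ≈ hzero.
Proof.
by rewrite -compose_assoc -naturality compose_assoc (coker_zero (kP y)) compose0l.
Qed.

Program Definition functor_coker : functor C A :=
  {| fob := fun x => coker (k x);
     fmap := fun x y f => coker_desc (kP x) (functor_coker_subproof f) |}.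
Next Obligation.
by move=> x y f g e /=; apply: (coker_epic (kP x)); rewrite !coker_descK e.
Qed.
Next Obligation.
move=> x /=; apply: (coker_epic (kP x)).
by rewrite coker_descK fmap_id compose_idl compose_idr.
Qed.
Next Obligation.
move=> x y z g f /=; apply: (coker_epic (kP x)).
rewrite coker_descK -compose_assoc coker_descK compose_assoc coker_descK.
by rewrite fmap_comp compose_assoc.
Qed.

Program Definition functor_coker_map : nat_trans G functor_coker :=
  {| component := fun x => coker_map (k x) |}.
Next Obligation. by move=> x y f /=; rewrite coker_descK. Qed.

Definition functor_cokernel : @cokernel AC F G s :=
  @Cokernel AC F G s functor_coker functor_coker_map
    (@pointwise_cokernel F G functor_coker s functor_coker_map kP).

Lemma pointwise_epic : @epic AC F G s -> forall x, epic (s x).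
Proof.
move=> ms x.
have k0 : coker_map (k x) ≈ hzero.
  have := @ms functor_coker functor_coker_map (nat_zero _ _).
  move=> /(_ _ x); apply=> y /=.
  by rewrite (coker_zero (kP y)) compose0l.
move=> w a c e; apply: hsub_eq.
have z : (a ⊕ ⊖ c) ∘ s x ≈ hzero by rewrite compose_addl composeNl e haddNr.
rewrite -(coker_descK (kP x) z); move: (coker_desc _ _) => u.
by rewrite k0 compose0r.
Qed.

End Coker.

Section Normal.
Variable B : abelian.

Lemma monic_is_kernel (x y : B) (f : hom x y) : monic f ->
  is_kernel (coker_map (ab_cokernel f)) f.
Proof.
move=> mf; set cP := coker_is_cokernel (ab_cokernel f).
have [z [g kg]] := monic_normal mf.
have gf0 := ker_zero kg.
have e w (h : hom w y) : coker_map (ab_cokernel f) ∘ h ≈ hzero -> g ∘ h ≈ hzero.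
  by move=> h0; rewrite -(coker_descK cP gf0) -compose_assoc h0 compose0r.
apply: (@IsKernel B _ _ _ _ _ (coker_zero cP)
  (fun w h h0 => ker_lift kg (e w h h0))); last exact: ker_monic kg.
by move=> w h h0; apply: ker_liftK.
Defined.

Lemma epic_is_cokernel (x y : B) (f : hom x y) : epic f ->
  is_cokernel (ker_map (ab_kernel f)) f.
Proof.
move=> mf; set kP := ker_is_kernel (ab_kernel f).
have [z [g kg]] := epic_normal mf.
have fg0 := coker_zero kg.
have e w (h : hom x w) : h ∘ ker_map (ab_kernel f) ≈ hzero -> h ∘ g ≈ hzero.
  by move=> h0; rewrite -(ker_liftK kP fg0) compose_assoc h0 compose0l.
apply: (@IsCokernel B _ _ _ _ _ (ker_zero kP)
  (fun w h h0 => coker_desc kg (e w h h0))); last exact: coker_epic kg.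
by move=> w h h0; apply: coker_descK.
Defined.

End Normal.

Program Definition functor_abelian : abelian :=
  {| ab_preadd := AC;
     ab_zero := functor_zero;
     ab_biproduct := functor_biproduct;
     ab_kernel := functor_kernel;
     ab_cokernel := functor_cokernel;
     monic_normal := fun F G s ms =>
       existT _ (functor_coker s) (existT _ (functor_coker_map s)
         (@pointwise_kernel G (functor_coker s) F (functor_coker_map s) s
           (fun x => monic_is_kernel (@pointwise_monic F G s ms x))));
     epic_normal := fun F G s ms =>
       existT _ (functor_ker s) (existT _ (functor_ker_map s)
         (@pointwise_cokernel (functor_ker s) F G (functor_ker_map s) s
           (fun x => epic_is_cokernel (@pointwise_epic F G s ms x)))) |}.

End FunctorAbelian.

Section Complexes.
Local Open Scope ring_scope.
Variable A : preadditive.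

Record complex := Complex {
  cob :> int -> A;
  cdiff : forall n : int, hom (cob n) (cob (n + 1));
  cdiff2 : forall n : int, cdiff (n + 1) ∘ cdiff n ≈ hzero
}.

Record chain_map (X Y : complex) := ChainMap {
  cmap :> forall n : int, hom (X n) (Y n);
  cmap_comm : forall n : int, cmap (n + 1) ∘ cdiff X n ≈ cdiff Y n ∘ cmap n
}.

Program Definition chain_id (X : complex) : chain_map X X :=
  {| cmap := fun n => idm (X n) |}.
Next Obligation. by move=> X n /=; rewrite compose_idl compose_idr. Qed.

Program Definition chain_comp (X Y Z : complex) (g : chain_map Y Z)
    (f : chain_map X Y) : chain_map X Z := {| cmap := fun n => g n ∘ f n |}.
Next Obligation.
move=> X Y Z g f n.
by rewrite -compose_assoc cmap_comm !compose_assoc cmap_comm.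
Qed.

Program Definition complex_category : category :=
  {| ob := complex; hom := chain_map;
     heq := fun _ _ f g => forall n, f n ≈ g n;
     idm := chain_id; compose := chain_comp |}.
Next Obligation.
move=> X Y; split.
- by move=> f n; reflexivity.
- by move=> f g fg n; symmetry; apply: fg.
- by move=> f g h fg gh n; transitivity (g n); [apply: fg | apply: gh].
Qed.
Next Obligation. by move=> X Y Z g g' eg f f' ef n /=; rewrite (eg n) (ef n). Qed.
Next Obligation. by move=> X Y f n; apply: compose_idl. Qed.
Next Obligation. by move=> X Y f n; apply: compose_idr. Qed.
Next Obligation. by move=> W X Y Z h g f n; apply: compose_assoc. Qed.

Program Definition complex_shift (X : complex) : complex :=
  {| cob := fun n => X (n + 1); cdiff := fun n => ⊖ cdiff X (n + 1) |}.
Next Obligation.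
by move=> X n /=; rewrite composeNl composeNr cdiff2 !hopp0.
Qed.

Program Definition chain_shift (X Y : complex) (f : chain_map X Y) :
    chain_map (complex_shift X) (complex_shift Y) :=
  {| cmap := fun n => f (n + 1) |}.
Next Obligation.
by move=> X Y f n /=; rewrite composeNl composeNr cmap_comm.
Qed.

Program Definition shift_functor : functor complex_category complex_category :=
  {| fob := complex_shift : complex_category -> complex_category;
     fmap := chain_shift |}.
Next Obligation. by move=> X Y f g e n; apply: e. Qed.
Next Obligation. by move=> X n; reflexivity. Qed.
Next Obligation. by move=> X Y Z g f n; reflexivity. Qed.

End Complexes.

Section Cohomology.
Local Open Scope ring_scope.
Variable A : abelian.

Record short_complex := ShortComplex {
  sc1 : A; sc2 : A; sc3 : A;
  scf : hom sc1 sc2;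
  scg : hom sc2 sc3;
  sc_zero : scg ∘ scf ≈ hzero
}.

Record sc_hom (S T : short_complex) := ScHom {
  sch1 : hom (sc1 S) (sc1 T);
  sch2 : hom (sc2 S) (sc2 T);
  sch3 : hom (sc3 S) (sc3 T);
  sch12 : sch2 ∘ scf S ≈ scf T ∘ sch1;
  sch23 : sch3 ∘ scg S ≈ scg T ∘ sch2
}.

Definition cycles (S : short_complex) := ab_kernel (scg S).
Definition cyclesP (S : short_complex) := ker_is_kernel (cycles S).
Definition to_cycles (S : short_complex) : hom (sc1 S) (ker (cycles S)) :=
  ker_lift (cyclesP S) (sc_zero S).
(** Ker / Im, as the cokernel of the corestriction [sc1 S -> Ker (scg S)]. *)
Definition homology (S : short_complex) := ab_cokernel (to_cycles S).
Definition homologyP (S : short_complex) := coker_is_cokernel (homology S).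

Lemma cycles_map_subproof (S T : short_complex) (h : sc_hom S T) :
  scg T ∘ (sch2 h ∘ ker_map (cycles S)) ≈ hzero.
Proof.
by rewrite compose_assoc -sch23 -compose_assoc (ker_zero (cyclesP S)) compose0r.
Qed.

Definition cycles_map (S T : short_complex) (h : sc_hom S T) :
    hom (ker (cycles S)) (ker (cycles T)) :=
  ker_lift (cyclesP T) (cycles_map_subproof h).

Lemma homology_map_subproof (S T : short_complex) (h : sc_hom S T) :
  coker_map (homology T) ∘ cycles_map h ∘ to_cycles S ≈ hzero.
Proof.
have e : cycles_map h ∘ to_cycles S ≈ to_cycles T ∘ sch1 h.
  apply: (ker_monic (cyclesP T)).
  rewrite !compose_assoc (ker_liftK (cyclesP T)) -compose_assoc.
  by rewrite (ker_liftK (cyclesP S)) (ker_liftK (cyclesP T)) sch12.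
by rewrite -compose_assoc e compose_assoc (coker_zero (homologyP T)) compose0l.
Qed.

Definition homology_map (S T : short_complex) (h : sc_hom S T) :
    hom (coker (homology S)) (coker (homology T)) :=
  coker_desc (homologyP S) (homology_map_subproof h).

Lemma homology_map_unique (S T : short_complex) (h : sc_hom S T)
    (u : hom (ker (cycles S)) (ker (cycles T)))
    (v : hom (coker (homology S)) (coker (homology T))) :
  ker_map (cycles T) ∘ u ≈ sch2 h ∘ ker_map (cycles S) ->
  v ∘ coker_map (homology S) ≈ coker_map (homology T) ∘ u ->
  homology_map h ≈ v.
Proof.
move=> eu ev; apply: (coker_epic (homologyP S)).
rewrite coker_descK ev.
have -> : cycles_map h ≈ u; last by reflexivity.
by apply: (ker_monic (cyclesP T)); rewrite ker_liftK eu.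
Qed.

Lemma homology_map_fac (S T : short_complex) (h : sc_hom S T) :
  homology_map h ∘ coker_map (homology S) ≈
  coker_map (homology T) ∘ cycles_map h.
Proof. exact: coker_descK. Qed.

Lemma cycles_map_fac (S T : short_complex) (h : sc_hom S T) :
  ker_map (cycles T) ∘ cycles_map h ≈ sch2 h ∘ ker_map (cycles S).
Proof. exact: ker_liftK. Qed.

(** [H^(n+1)(X)] is the homology of [X n -> X (n+1) -> X (n+2)]; as [n] ranges
    over the integers this covers every degree. *)
Definition complex_at (X : complex A) (n : int) : short_complex :=
  ShortComplex (cdiff2 X n).

Definition chain_at (X Y : complex A) (f : chain_map X Y) (n : int) :
    sc_hom (complex_at X n) (complex_at Y n) :=
  @ScHom (complex_at X n) (complex_at Y n) (f n) (f (n + 1)) (f (n + 1 + 1))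
    (cmap_comm f n) (cmap_comm f (n + 1)).

Definition quasi_iso (X Y : complex_category A) (f : hom X Y) : Prop :=
  forall n : int, is_iso (homology_map (chain_at f n)).

Program Definition shift_at (X : complex A) (n : int) :
    sc_hom (complex_at (complex_shift X) n) (complex_at X (n + 1)) :=
  @ScHom (complex_at (complex_shift X) n) (complex_at X (n + 1))
    (idm _) (⊖ idm _) (idm _) _ _.
Next Obligation.
by move=> X n /=; rewrite composeNl composeNr compose_idl compose_idr hoppK.
Qed.
Next Obligation.
by move=> X n /=; rewrite !composeNr compose_idl compose_idr.
Qed.

Program Definition unshift_at (X : complex A) (n : int) :
    sc_hom (complex_at X (n + 1)) (complex_at (complex_shift X) n) :=
  @ScHom (complex_at X (n + 1)) (complex_at (complex_shift X) n)
    (idm _) (⊖ idm _) (idm _) _ _.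
Next Obligation.
by move=> X n /=; rewrite !composeNl compose_idl compose_idr.
Qed.
Next Obligation.
by move=> X n /=; rewrite composeNr composeNl hoppK compose_idl compose_idr.
Qed.

Lemma quasi_iso_shift (X Y : complex_category A) (f : hom X Y) :
  quasi_iso f -> quasi_iso (fmap (shift_functor A) f).
Proof.
move=> qf n; have [g [gf fg]] := qf (n + 1).
set sX := homology_map (shift_at X n); set uX := homology_map (unshift_at X n).
set sY := homology_map (shift_at Y n); set uY := homology_map (unshift_at Y n).
have us (Z : complex A) :
    homology_map (unshift_at Z n) ∘ homology_map (shift_at Z n) ≈ idm _.
  apply: (coker_epic (homologyP _)).
  rewrite -compose_assoc homology_map_fac compose_assoc homology_map_fac.
  rewrite compose_idl -compose_assoc.
  have -> : cycles_map (unshift_at Z n) ∘ cycles_map (shift_at Z n) ≈ idm _.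
    apply: (ker_monic (cyclesP _)).
    rewrite compose_assoc cycles_map_fac -compose_assoc cycles_map_fac.
    by rewrite /= compose_assoc composeNl composeNr hoppK !compose_idl compose_idr.
  exact: compose_idr.
have su (Z : complex A) :
    homology_map (shift_at Z n) ∘ homology_map (unshift_at Z n) ≈ idm _.
  apply: (coker_epic (homologyP _)).
  rewrite -compose_assoc homology_map_fac compose_assoc homology_map_fac.
  rewrite compose_idl -compose_assoc.
  have -> : cycles_map (shift_at Z n) ∘ cycles_map (unshift_at Z n) ≈ idm _.
    apply: (ker_monic (cyclesP _)).
    rewrite compose_assoc cycles_map_fac -compose_assoc cycles_map_fac.
    by rewrite /= compose_assoc composeNl composeNr hoppK !compose_idl compose_idr.
  exact: compose_idr.
have E : homology_map (chain_at (fmap (shift_functor A) f) n) ≈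
    uY ∘ homology_map (chain_at f (n + 1)) ∘ sX.
  apply: (@homology_map_unique _ _ _
    (cycles_map (unshift_at Y n) ∘ cycles_map (chain_at f (n + 1)) ∘
      cycles_map (shift_at X n))).
    rewrite !compose_assoc cycles_map_fac -!compose_assoc.
    rewrite (compose_assoc (ker_map _)) cycles_map_fac -!compose_assoc.
    rewrite cycles_map_fac /=.
    rewrite composeNl compose_idl composeNl compose_idl !composeNr.
    by rewrite hoppK.
  rewrite -!compose_assoc homology_map_fac.
  rewrite (compose_assoc (homology_map _)) homology_map_fac.
  by rewrite !compose_assoc homology_map_fac.
exists (uX ∘ g ∘ sY); split; rewrite E.
  rewrite !compose_assoc -(compose_assoc _ sY uY) su compose_idr.
  by rewrite -(compose_assoc uX g) gf compose_idr us.
rewrite !compose_assoc -(compose_assoc _ sX uX) su compose_idr.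
by rewrite -(compose_assoc uY _ g) fg compose_idr us.
Qed.

End Cohomology.

(** Mapping cones: [cone(f)^n = X^(n+1) (+) Y^n] with differential
    [(x, y) |-> (- d x, f x + d y)]. *)

Section Cone.
Local Open Scope ring_scope.
Variables (A : abelian) (X Y : complex A) (f : chain_map X Y).
Let b n := ab_biproduct (X (n + 1)) (Y n).

Program Definition cone : complex A :=
  {| cob := fun n => bip (b n);
     cdiff := fun n =>
       (bip_inl (b (n + 1)) ∘ (⊖ cdiff X (n + 1)) ∘ bip_prl (b n)) ⊕
       (bip_inr (b (n + 1)) ∘
         ((f (n + 1) ∘ bip_prl (b n)) ⊕ (cdiff Y n ∘ bip_prr (b n)))) |}.
Next Obligation.
move=> n /=; set l := bip_prl (b n); set r := bip_prr (b n).
set l1 := bip_prl (b (n + 1)); set r1 := bip_prr (b (n + 1)).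
set d := _ ⊕ _ ∘ (f (n + 1) ∘ l ⊕ _).
have el : l1 ∘ d ≈ (⊖ cdiff X (n + 1)) ∘ l.
  rewrite compose_addr !compose_assoc bip_ll bip_lr compose_idl compose0l.
  by rewrite hadd0r.
have er : r1 ∘ d ≈ (f (n + 1) ∘ l) ⊕ (cdiff Y n ∘ r).
  rewrite compose_addr !compose_assoc bip_rl bip_rr compose_idl !compose0l.
  by rewrite hadd0.
have ex : ⊖ cdiff X (n + 1 + 1) ∘ (⊖ cdiff X (n + 1) ∘ l) ≈ hzero.
  by rewrite compose_assoc composeNl composeNr cdiff2 !hopp0 compose0l.
have ey : f (n + 1 + 1) ∘ (⊖ cdiff X (n + 1) ∘ l) ⊕
    cdiff Y (n + 1) ∘ (f (n + 1) ∘ l ⊕ cdiff Y n ∘ r) ≈ hzero.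
  rewrite composeNl composeNr compose_assoc cmap_comm compose_addr.
  by rewrite !compose_assoc cdiff2 compose0l hadd0r haddN.
rewrite compose_addl -!compose_assoc el compose_addl -!compose_assoc el er.
by rewrite ex ey !compose0r hadd0.
Qed.

Program Definition cone_incl : chain_map Y cone :=
  {| cmap := fun n => bip_inr (b n) |}.
Next Obligation.
move=> n /=; rewrite compose_addl -!compose_assoc bip_lr !compose0r hadd0.
by rewrite compose_addl -!compose_assoc bip_lr bip_rr compose0r hadd0 compose_idr.
Qed.

Program Definition cone_proj : chain_map cone (complex_shift X) :=
  {| cmap := fun n => bip_prl (b n) |}.
Next Obligation.
move=> n /=; rewrite compose_addr !compose_assoc bip_ll bip_lr compose_idl.
by rewrite compose0l hadd0r.
Qed.

End Cone.

(** Gabriel-Zisman localization [C[W^-1]]: morphisms are formal composites of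
    morphisms of [C] and formal inverses of elements of [W], modulo the
    congruence generated by the category axioms, functoriality of [C -> C[W^-1]]
    and the inversion of [W]. *)

Section Localization.
Variables (C : category) (W : forall x y : C, hom x y -> Prop).

Inductive loc_hom : C -> C -> Type :=
| loc_map (x y : C) (f : hom x y) : loc_hom x y
| loc_inv (x y : C) (w : hom x y) (Ww : W w) : loc_hom y x
| loc_comp (x y z : C) (g : loc_hom y z) (f : loc_hom x y) : loc_hom x z.

Inductive loc_eq : forall x y : C, loc_hom x y -> loc_hom x y -> Prop :=
| loc_refl (x y : C) (f : loc_hom x y) : loc_eq f f
| loc_sym (x y : C) (f g : loc_hom x y) : loc_eq f g -> loc_eq g f
| loc_trans (x y : C) (f g h : loc_hom x y) :
    loc_eq f g -> loc_eq g h -> loc_eq f h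
| loc_comp_cong (x y z : C) (g g' : loc_hom y z) (f f' : loc_hom x y) :
    loc_eq g g' -> loc_eq f f' -> loc_eq (loc_comp g f) (loc_comp g' f')
| loc_idl (x y : C) (f : loc_hom x y) : loc_eq (loc_comp (loc_map (idm y)) f) f
| loc_idr (x y : C) (f : loc_hom x y) : loc_eq (loc_comp f (loc_map (idm x))) f
| loc_assoc (v x y z : C) (h : loc_hom y z) (g : loc_hom x y)
    (f : loc_hom v x) :
    loc_eq (loc_comp h (loc_comp g f)) (loc_comp (loc_comp h g) f)
| loc_map_cong (x y : C) (f g : hom x y) :
    f ≈ g -> loc_eq (loc_map f) (loc_map g)
| loc_map_comp (x y z : C) (g : hom y z) (f : hom x y) :
    loc_eq (loc_map (g ∘ f)) (loc_comp (loc_map g) (loc_map f))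
| loc_invl (x y : C) (w : hom x y) (Ww : W w) :
    loc_eq (loc_comp (loc_inv Ww) (loc_map w)) (loc_map (idm x))
| loc_invr (x y : C) (w : hom x y) (Ww : W w) :
    loc_eq (loc_comp (loc_map w) (loc_inv Ww)) (loc_map (idm y)).

Program Definition localization : category :=
  {| ob := C; hom := loc_hom; heq := loc_eq;
     idm := fun x => loc_map (idm x); compose := loc_comp |}.
Next Obligation.
move=> x y; split; [exact: loc_refl | exact: loc_sym | exact: loc_trans].
Qed.
Next Obligation. by move=> x y z g g' eg f f' ef; apply: loc_comp_cong. Qed.
Next Obligation. exact: loc_idl. Qed.
Next Obligation. exact: loc_idr. Qed.
Next Obligation. exact: loc_assoc. Qed.

Program Definition localize : functor C localization :=
  {| fob := fun x : C => x : localization; fmap := loc_map |}.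
Next Obligation. by move=> x y f g e; apply: loc_map_cong. Qed.
Next Obligation. by move=> x; apply: loc_refl. Qed.
Next Obligation. exact: loc_map_comp. Qed.

End Localization.

Section LocalizationFunctor.
Variables (C D : category).
Variables (W : forall x y : C, hom x y -> Prop).
Variables (V : forall x y : D, hom x y -> Prop).
Variables (F : functor C D).
Hypothesis FW : forall (x y : C) (w : hom x y), W w -> V (fmap F w).

Fixpoint loc_fmap (x y : C) (f : loc_hom W x y) : loc_hom V (F x) (F y) :=
  match f with
  | loc_map _ _ f => loc_map V (fmap F f)
  | loc_inv _ _ _ Ww => loc_inv (FW Ww)
  | loc_comp _ _ _ g f => loc_comp (loc_fmap g) (loc_fmap f)
  end.

Lemma loc_fmap_eq (x y : C) (f g : loc_hom W x y) :
  loc_eq f g -> loc_eq (loc_fmap f) (loc_fmap g).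
Proof.
have Fid z : loc_eq (loc_map V (fmap F (idm z))) (loc_map V (idm (F z))).
  by apply: loc_map_cong; apply: fmap_id.
elim=> {x y f g} /=.
- by move=> *; apply: loc_refl.
- by move=> *; apply: loc_sym.
- by move=> x y f g h _ e _ e'; apply: loc_trans e e'.
- by move=> *; apply: loc_comp_cong.
- move=> x y f; apply: loc_trans (loc_idl _).
  exact: loc_comp_cong (Fid _) (loc_refl _).
- move=> x y f; apply: loc_trans (loc_idr _).
  exact: loc_comp_cong (loc_refl _) (Fid _).
- by move=> *; apply: loc_assoc.
- by move=> x y f g e; apply: loc_map_cong; rewrite e.
- move=> x y z g f; apply: loc_trans (loc_map_comp _ _ _).
  by apply: loc_map_cong; apply: fmap_comp.
- by move=> x y w Ww; apply: loc_trans (loc_invl _) (loc_sym (Fid _)).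
- by move=> x y w Ww; apply: loc_trans (loc_invr _) (loc_sym (Fid _)).
Qed.

Program Definition loc_functor : functor (localization W) (localization V) :=
  {| fob := fun x : localization W => F x : localization V; fmap := loc_fmap |}.
Next Obligation. by move=> x y f g e; apply: loc_fmap_eq. Qed.
Next Obligation. by move=> x; apply: loc_map_cong; apply: fmap_id. Qed.
Next Obligation. by move=> *; apply: loc_refl. Qed.

End LocalizationFunctor.

(** Only the data of a triangulated category: exactness of a functor does not
    refer to the axioms TR1-TR4. *)
Record triangulated_data := TriangulatedData {
  tri_cat :> category;
  tri_shift : functor tri_cat tri_cat;
  distinguished : forall x y z : tri_cat,
    hom x y -> hom y z -> hom z (tri_shift x) -> Prop
}.
Arguments tri_shift {t}.
Arguments distinguished {t x y z} f g h.

(** A triangle of [D(A)] is distinguished when it is isomorphic to the image of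
    [X -> Y -> cone(f) -> X[1]] for some chain map [f : X -> Y]. *)

Section Derived.
Variable A : abelian.

Definition derived_category : category := localization (@quasi_iso A).

Definition derived_shift : functor derived_category derived_category :=
  loc_functor (F := shift_functor A) (@quasi_iso_shift A).

Let Q : functor (complex_category A) derived_category :=
  localize (@quasi_iso A).

Definition derived_distinguished (x y z : derived_category)
    (u : hom x y) (v : hom y z) (w : hom z (derived_shift x)) : Prop :=
  exists (X Y : complex_category A) (f : hom X Y)
    (a : hom x (Q X)) (b : hom y (Q Y)) (c : hom z (Q (cone f))),
    [/\ is_iso a, is_iso b & is_iso c] /\
    [/\ b ∘ u ≈ fmap Q f ∘ a,
        c ∘ v ≈ fmap Q (cone_incl f : hom Y (cone f : complex_category A)) ∘ b &
        fmap derived_shift a ∘ w ≈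
        fmap Q (cone_proj f :
          hom (cone f : complex_category A) (shift_functor A X)) ∘ c].

Definition derived : triangulated_data :=
  {| tri_cat := derived_category; tri_shift := derived_shift;
     distinguished := derived_distinguished |}.

End Derived.

(** An exact functor: [F (x[1])] is naturally isomorphic to [(F x)[1]] through
    [s], and [F], with [s], preserves distinguished triangles.  Additivity of
    [F] is a consequence. *)
Definition is_exact (S T : triangulated_data) (F : functor S T)
    (s : nat_trans (functor_comp F tri_shift) (functor_comp tri_shift F)) :
    Prop :=
  nat_iso s /\
  forall (x y z : S) (f : hom x y) (g : hom y z) (h : hom z (tri_shift x)),
    distinguished f g h ->
    distinguished (fmap F f) (fmap F g)
      ((s x : hom (F (tri_shift x)) (tri_shift (F x))) ∘ fmap F h).

Definition triangulated_equivalent (S T : triangulated_data) : Prop :=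
  exists F : functor S T, is_equivalence F /\ exists s, is_exact (F := F) s.

Definition universally_derived_equivalent (d d' : Order.disp_t)
    (P : porderType d) (Q : porderType d') : Prop :=
  forall A : abelian,
    triangulated_equivalent (derived (functor_abelian (poset_category P) A))
                            (derived (functor_abelian (poset_category Q) A)).

(** The point [*] is [None]; [Y0] is a phantom parameter of the carrier that
    selects the order. *)

Section AdjoinPoint.
Context {d : Order.disp_t} {Y : finPOrderType d}.
Local Open Scope order_scope.

Definition poset_plus (Y0 : {set Y}) : Type := option Y.
Definition poset_minus (Y0 : {set Y}) : Type := option Y.

Variable Y0 : {set Y}.

HB.instance Definition _ := Finite.on (poset_plus Y0).
HB.instance Definition _ := Finite.on (poset_minus Y0).

Definition le_plus (a b : poset_plus Y0) : bool :=
  match a, b with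
  | Some y, Some y' => y <= y'
  | None, Some y => [exists y0 in Y0, y0 <= y]
  | Some _, None => false
  | None, None => true
  end.

Definition le_minus (a b : poset_minus Y0) : bool :=
  match a, b with
  | Some y, Some y' => y <= y'
  | Some y, None => [exists y0 in Y0, y <= y0]
  | None, Some _ => false
  | None, None => true
  end.

Lemma le_plus_refl : reflexive le_plus.
Proof. by case=> //= y. Qed.

Lemma le_plus_anti : antisymmetric le_plus.
Proof. by move=> [x|] [y|] //=; rewrite ?andbF // => /le_anti ->. Qed.

Lemma le_plus_trans : transitive le_plus.
Proof.
move=> [y|] [x|] [z|] //=; first exact: le_trans.
move=> /existsP[y0 /andP[y0in y0y]] yz; apply/existsP; exists y0.
by rewrite y0in (le_trans y0y).
Qed.

Lemma le_minus_refl : reflexive le_minus.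
Proof. by case=> //= y. Qed.

Lemma le_minus_anti : antisymmetric le_minus.
Proof. by move=> [x|] [y|] //=; rewrite ?andbF // => /le_anti ->. Qed.

Lemma le_minus_trans : transitive le_minus.
Proof.
move=> [y|] [x|] [z|] //=; first exact: le_trans.
move=> xy /existsP[y0 /andP[y0in yy0]]; apply/existsP; exists y0.
by rewrite y0in (le_trans xy).
Qed.

HB.instance Definition _ := Order.Le_isPOrder.Build d (poset_plus Y0)
  le_plus_refl le_plus_anti le_plus_trans.
HB.instance Definition _ := Order.Le_isPOrder.Build d (poset_minus Y0)
  le_minus_refl le_minus_anti le_minus_trans.

End AdjoinPoint.

(* Main.v *)
(** Let [S X] be the direct sum of the [X(y)] for [y] in [Y0].  Because the sets of
    elements above (below) distinct members of [Y0] are disjoint, a diagram over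
    [poset_plus Y0] is a diagram [X] on [Y] with a morphism [M -> S X], and a diagram
    over [poset_minus Y0] is a diagram [X] on [Y] with a morphism [S X -> M].
    The equivalence sends a complex [M -> S X] to [S X -> cone(M -> S X)]; in the
    other direction one takes [cone(S X -> M) -> S X], and both composites are
    quasi-isomorphic to the shift.  Each of the two functors is the cone of a natural
    transformation between exact functors of diagrams; hence it preserves
    quasi-isomorphisms and distinguished triangles.  The comparison maps with
    the shift are natural maps of complexes of diagrams that are homotopy
    equivalences at every point of the poset. *)

From Stdlib Require Import Setoid Morphisms.
From mathcomp Require Import all_boot all_order all_algebra.
Require Import Defs.

Set Implicit Arguments.
Unset Strict Implicit.
Unset Printing Implicit Defensive.

Import Order.TTheory GRing.Theory.

#[local] Obligation Tactic := idtac.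
Local Open Scope cat_scope.

(** * Identities in abelian groups *)

(** Why the composites give the shift: each of them is an iterated cone with four terms. At a point
    of [Y] a single term survives, the value of the diagram, shifted by one. At the added point one
    term vanishes, two are equal to the sum over [Y0] and cancel, and the last one is the value at
    the added point, again shifted by one. The homotopy performing this cancellation is the identity
    at the added point and zero on [Y], which is not a map of diagrams; hence quasi-isomorphisms are
    tested one point at a time.

    The rest is shaped by working without choice. Isomorphism is a mere existence statement, so
    inverse natural transformations are produced where inverses are available as data, namely as
    formal inverses in the localization. Passing from an equivalence up to shift to an equivalence
    also calls for an inverse of the shift, and there equalities of degrees such as [n - 1 + 1 = n]
    have to be turned into morphisms. *)

Inductive gexp :=
| GZero
| GVar of nat
| GOpp of gexp
| GAdd of gexp & gexp.

Fixpoint gflat (s : bool) (e : gexp) : seq (bool * nat) :=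
  match e with
  | GZero => [::]
  | GVar i => [:: (s, i)]
  | GOpp e => gflat (~~ s) e
  | GAdd e f => gflat s e ++ gflat s f
  end.

(** [n] is fuel, because [rem] does not return a subterm of the list. The length of the list is
    enough, since each step deletes two entries. *)
Fixpoint gcancels (n : nat) (l : seq (bool * nat)) : bool :=
  match n, l with
  | _, [::] => true
  | n.+1, (s, i) :: l =>
      ((~~ s, i) \in l) && gcancels n (rem (~~ s, i) l)
  | _, _ => false
  end.

Section GroupReflection.
Variables (A : preadditive) (x y : A) (v : seq (hom x y)).

Fixpoint geval (e : gexp) : hom x y :=
  match e with
  | GZero => hzero
  | GVar i => nth hzero v i
  | GOpp e => ⊖ geval e
  | GAdd e f => geval e ⊕ geval f
  end.

Definition gsigned (t : bool * nat) : hom x y :=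
  if t.1 then nth hzero v t.2 else ⊖ nth hzero v t.2.

Definition gsum (l : seq (bool * nat)) : hom x y :=
  foldr (fun t u => gsigned t ⊕ u) hzero l.

Lemma hoppD (f g : hom x y) : ⊖ (f ⊕ g) ≈ ⊖ f ⊕ ⊖ g.
Proof.
apply: (@hadd_cancel _ _ _ _ _ (f ⊕ g)); rewrite haddNr.
rewrite (haddC f g) -haddA (haddA f) haddNr hadd0 haddNr; reflexivity.
Qed.

Lemma gsum_cat (l m : seq (bool * nat)) : gsum (l ++ m) ≈ gsum l ⊕ gsum m.
Proof.
elim: l => [|t l IH] /=; first by rewrite hadd0.
by rewrite IH haddA.
Qed.

Lemma gsum_flat (s : bool) (e : gexp) :
  gsum (gflat s e) ≈ if s then geval e else ⊖ geval e.
Proof.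
elim: e s => [|i|e IH|e IHe f IHf] s /=.
- by case: s; rewrite ?hopp0.
- by case: s; rewrite /gsigned /= hadd0r.
- by rewrite IH; case: s => /=; rewrite ?hoppK.
- by rewrite gsum_cat IHe IHf; case: s; rewrite ?hoppD.
Qed.

Lemma gsum_rem (t : bool * nat) (l : seq (bool * nat)) :
  t \in l -> gsum l ≈ gsigned t ⊕ gsum (rem t l).
Proof.
elim: l => [//|u l IH]; rewrite inE; have [-> _|ut tl] := eqVneq t u.
  by have -> : rem u (u :: l) = l by rewrite /rem eqxx.
have -> : rem t (u :: l) = u :: rem t l by rewrite /rem eq_sym (negbTE ut).
rewrite /= (IH tl) !haddA (haddC (gsigned u)); reflexivity.
Qed.

Lemma gcancelsP (n : nat) (l : seq (bool * nat)) :
  gcancels n l -> gsum l ≈ hzero.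
Proof.
elim: n l => [|n IH] [|[s i] l] //= /andP[il /IH e].
rewrite (gsum_rem il) e hadd0r /gsigned /=.
by case: s {il e}; rewrite /= ?haddNr ?haddN.
Qed.

(** The flattened difference of the two sides cancels in pairs. After reification the premise is a
    closed boolean, settled by computation. *)
Lemma gexp_eq (e f : gexp) :
  (let l := gflat true e ++ gflat false f in gcancels (size l) l) ->
  geval e ≈ geval f.
Proof.
move=> /= /gcancelsP; rewrite gsum_cat !gsum_flat => ef.
exact: hsub_eq.
Qed.

End GroupReflection.

(** [eqv] is a tactic run while a term is being computed; [match goal] sequences it, and its failure
    passes to the next branch. *)
Ltac gindex eqv a l :=
  match l with
  | a :: _ => constr:(Some 0%N)
  | ?b :: ?l =>
      match goal with
      | _ => let _ := match goal with _ => eqv a b end in constr:(Some 0%N)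
      | _ =>
          lazymatch gindex eqv a l with
          | Some ?i => constr:(Some i.+1)
          | None => constr:(@None nat)
          end
      end
  | nil => constr:(@None nat)
  end.
Ltac gatoms eqv e l :=
  lazymatch e with
  | hzero => l
  | ⊖ ?a => gatoms eqv a l
  | ?a ⊕ ?b => let l := gatoms eqv a l in gatoms eqv b l
  | _ =>
      lazymatch gindex eqv e l with
      | Some _ => l
      | None => constr:(e :: l)
      end
  end.
Ltac gquote eqv e l :=
  lazymatch e with
  | hzero => constr:(GZero)
  | ⊖ ?a => let a := gquote eqv a l in constr:(GOpp a)
  | ?a ⊕ ?b =>
      let a := gquote eqv a l in let b := gquote eqv b l in constr:(GAdd a b)
  | _ => lazymatch gindex eqv e l with Some ?i => constr:(GVar i) end
  end.
Ltac abel_upto eqv :=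
  match goal with
  | |- @heq _ ?x ?y ?e ?f =>
      let l := gatoms eqv e (@nil (hom x y)) in
      let l := gatoms eqv f l in
      let e := gquote eqv e l in
      let f := gquote eqv f l in
      exact (@gexp_eq _ _ _ l e f isT)
  end.
Ltac gdistinct a b := fail.
Ltac gunify a b := unify a b.
(** Decides equalities that hold in every abelian group.  Syntactic comparison of
    atoms comes first because refuting convertibility of distinct atoms is slow. *)
Ltac abel := first [abel_upto gdistinct | abel_upto gunify].

(** * Biproducts and generalized elements *)

Section Pairing.
Variables (A : preadditive) (x y : A) (b : biproduct x y).

Definition bpair (t : A) (f : hom t x) (g : hom t y) : hom t (bip b) :=
  (bip_inl b ∘ f) ⊕ (bip_inr b ∘ g).

Definition bcopair (t : A) (f : hom x t) (g : hom y t) : hom (bip b) t :=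
  (f ∘ bip_prl b) ⊕ (g ∘ bip_prr b).

#[export] Instance bpair_proper (t : A) :
  Proper (heq ==> heq ==> heq) (@bpair t).
Proof. by move=> f f' ef g g' eg; rewrite /bpair ef eg. Qed.

#[export] Instance bcopair_proper (t : A) :
  Proper (heq ==> heq ==> heq) (@bcopair t).
Proof. by move=> f f' ef g g' eg; rewrite /bcopair ef eg. Qed.

Lemma prl_bpair (t : A) (f : hom t x) (g : hom t y) :
  bip_prl b ∘ bpair f g ≈ f.
Proof.
by rewrite compose_addr !compose_assoc bip_ll bip_lr compose_idl compose0l hadd0r.
Qed.

Lemma prr_bpair (t : A) (f : hom t x) (g : hom t y) :
  bip_prr b ∘ bpair f g ≈ g.
Proof.
by rewrite compose_addr !compose_assoc bip_rl bip_rr compose_idl compose0l hadd0.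
Qed.

Lemma bcopair_bpair (s t : A) (h : hom x s) (k : hom y s)
    (f : hom t x) (g : hom t y) :
  bcopair h k ∘ bpair f g ≈ (h ∘ f) ⊕ (k ∘ g).
Proof. by rewrite compose_addl -!compose_assoc prl_bpair prr_bpair. Qed.

Lemma bcopair_inl (s : A) (h : hom x s) (k : hom y s) :
  bcopair h k ∘ bip_inl b ≈ h.
Proof.
by rewrite compose_addl -!compose_assoc bip_ll bip_rl compose_idr compose0r hadd0r.
Qed.

Lemma bpair_eta (t : A) (u : hom t (bip b)) :
  u ≈ bpair (bip_prl b ∘ u) (bip_prr b ∘ u).
Proof.
by rewrite /bpair !compose_assoc -compose_addl bip_id compose_idl.
Qed.

Lemma bpair_eq (t : A) (u v : hom t (bip b)) :
  bip_prl b ∘ u ≈ bip_prl b ∘ v -> bip_prr b ∘ u ≈ bip_prr b ∘ v -> u ≈ v.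
Proof. by move=> el er; rewrite (bpair_eta u) el er -bpair_eta. Qed.

Lemma bpair_comp (s t : A) (f : hom t x) (g : hom t y) (h : hom s t) :
  bpair f g ∘ h ≈ bpair (f ∘ h) (g ∘ h).
Proof. by rewrite /bpair compose_addl -!compose_assoc. Qed.

End Pairing.
#[global] Typeclasses Opaque bpair bcopair.
Arguments bpair {A x y} b {t} f g.
Arguments bcopair {A x y} b {t} f g.

Section Isomorphisms.
Variable C : category.

Lemma is_iso_id (x : C) : is_iso (idm x).
Proof. by exists (idm x); rewrite !compose_idl. Qed.

Lemma is_iso_comp (x y z : C) (g : hom y z) (f : hom x y) :
  is_iso g -> is_iso f -> is_iso (g ∘ f).
Proof.
move=> [g' [g'g gg']] [f' [f'f ff']]; exists (f' ∘ g'); split.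
  by rewrite compose_assoc -(compose_assoc f') g'g compose_idr.
by rewrite compose_assoc -(compose_assoc g) ff' compose_idr.
Qed.

Lemma is_iso_monic (x y : C) (f : hom x y) : is_iso f -> monic f.
Proof.
move=> [g [gf _]] w a b e.
by rewrite -(compose_idl a) -(compose_idl b) -gf -!compose_assoc e.
Qed.

Lemma is_iso_epic (x y : C) (f : hom x y) : is_iso f -> epic f.
Proof.
move=> [g [_ fg]] w a b e.
by rewrite -(compose_idr a) -(compose_idr b) -fg !compose_assoc e.
Qed.

Lemma epic_comp (x y z : C) (g : hom y z) (f : hom x y) :
  epic g -> epic f -> epic (g ∘ f).
Proof.
by move=> eg ef t a b; rewrite !compose_assoc => /ef /eg.
Qed.

End Isomorphisms.

Lemma fmap_iso (C D : category) (F : functor C D) (x y : C) (f : hom x y) :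
  is_iso f -> is_iso (fmap F f).
Proof.
by move=> [g [gf fg]]; exists (fmap F g); rewrite -!fmap_comp gf fg !fmap_id.
Qed.

Section AbelianTheory.
Variable A : abelian.
Implicit Types x y z t : A.

(** A monic is a kernel of its cokernel; if it is also epic, that cokernel map is zero and the
    identity factors through the monic. *)
Lemma monic_epic_iso x y (f : hom x y) : monic f -> epic f -> is_iso f.
Proof.
move=> mf ef; set kf := monic_is_kernel mf.
have p0 : coker_map (ab_cokernel f) ∘ idm y ≈ hzero.
  rewrite compose_idr; apply: ef.
  by rewrite (coker_zero (coker_is_cokernel _)) compose0l.
exists (ker_lift kf p0); split; last exact: ker_liftK.
by apply: (mf); rewrite compose_assoc ker_liftK compose_idl compose_idr.
Qed.

Lemma epic0 x y (f : hom x y) :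
  (forall t (u : hom y t), u ∘ f ≈ hzero -> u ≈ hzero) -> epic f.
Proof.
move=> ef t u v e; apply: hsub_eq; apply: ef.
by rewrite compose_addl composeNl e haddNr.
Qed.

Lemma monic0 x y (f : hom x y) :
  (forall t (u : hom t x), f ∘ u ≈ hzero -> u ≈ hzero) -> monic f.
Proof.
move=> ef t u v e; apply: hsub_eq; apply: ef.
by rewrite compose_addr composeNr e haddNr.
Qed.

(** A morphism [t -> x] is treated as an element of [x], and passing to a
    cover [t' ->> t] replaces choosing a preimage. *)
Lemma epic_lift x y t (p : hom x y) (c : hom t y) : epic p ->
  exists t' (e : hom t' t) (u : hom t' x), epic e /\ p ∘ u ≈ c ∘ e.
Proof.
move=> ep; set b := ab_biproduct x t; set k := bcopair b p (⊖ c).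
set i := ker_map (ab_kernel k).
have kP := ker_is_kernel (ab_kernel k); have ki0 := ker_zero kP.
exists (ker (ab_kernel k)), (bip_prr b ∘ i), (bip_prl b ∘ i); split; last first.
  apply: hsub_eq; rewrite -ki0 -/i (bpair_eta i) bcopair_bpair.
  by rewrite composeNl prl_bpair prr_bpair.
have ek : epic k.
  move=> z u v e; apply: ep.
  by rewrite -(bcopair_inl b p (⊖ c)) !compose_assoc -/k e.
have cP := epic_is_cokernel ek.
apply: epic0 => z u; rewrite compose_assoc => e.
have e' := coker_descK cP e.
have v0 : coker_desc cP e ≈ hzero.
  apply: ep; rewrite -{1}(bcopair_inl b p (⊖ c)) -/k compose_assoc e'.
  by rewrite -compose_assoc bip_rl compose0r compose0l.
rewrite -(compose_idr u) -(bip_rr b) compose_assoc -e' v0.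
by rewrite !compose0l.
Qed.

(** [c] corestricts to an epic onto the kernel of [p], so a preimage exists on a cover. *)
Lemma coker_exact x y k (c : hom x y) (p : hom y k) (pP : is_cokernel c p)
    t (z : hom t y) :
  p ∘ z ≈ hzero ->
  exists t' (e : hom t' t) (u : hom t' x), epic e /\ c ∘ u ≈ z ∘ e.
Proof.
move=> pz0; set m := ker_map (ab_kernel p); have mP := ker_is_kernel (ab_kernel p).
set q := ker_lift mP (coker_zero pP).
have mq : m ∘ q ≈ c := ker_liftK mP _.
(* If [u] kills [q], then [c] factors through [m ∘ j], which is monic and hence the kernel of its
   cokernel [r]. Since [r] kills [c], it factors through [p] and so kills [m]; thus [m] factors
   through [m ∘ j], the kernel [j] of [u] has a section, and [u] is zero. *)
have eq : epic q.
  apply: epic0 => w u uq0; set j := ker_map (ab_kernel u).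
  have kP := ker_is_kernel (ab_kernel u); have kq := ker_liftK kP uq0.
  have mk : monic (m ∘ j).
    by move=> v a b; rewrite -!compose_assoc => /(ker_monic mP) /(ker_monic kP).
  set r := coker_map (ab_cokernel (m ∘ j)).
  have rP := coker_is_cokernel (ab_cokernel (m ∘ j)).
  have rc0 : r ∘ c ≈ hzero.
    rewrite -mq -kq compose_assoc compose_assoc -(compose_assoc r).
    by rewrite (coker_zero rP) compose0l.
  have rm0 : r ∘ m ≈ hzero.
    rewrite -(coker_descK pP rc0) -compose_assoc.
    by rewrite (ker_zero mP) compose0r.
  have := ker_liftK (monic_is_kernel mk) rm0; set l := ker_lift _ _ => mkl.
  have kl : j ∘ l ≈ idm _.
    by apply: (ker_monic mP); rewrite compose_assoc mkl compose_idr.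
  by rewrite -(compose_idr u) -kl compose_assoc (ker_zero kP) compose0l.
have [t' [e [u [ee qu]]]] := epic_lift (ker_lift mP pz0) eq.
exists t', e, u; split=> //.
by rewrite -mq -compose_assoc qu compose_assoc ker_liftK.
Qed.

End AbelianTheory.

(** * Quasi-isomorphisms *)

Section ShortComplexes.
Variable A : abelian.
Variables (S T : short_complex A) (h : sc_hom S T).

(** Phrased without the homology object: cycles and boundaries are generalized elements, and
    existence is asserted on a cover only. This is the form in which diagram chases are carried
    out. *)
Definition sc_injective : Prop :=
  forall (t : A) (x : hom t (sc2 S)) (y : hom t (sc1 T)),
    scg S ∘ x ≈ hzero -> sch2 h ∘ x ≈ scf T ∘ y ->
    exists t' (e : hom t' t) (s : hom t' (sc1 S)),
      epic e /\ scf S ∘ s ≈ x ∘ e.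

Definition sc_surjective : Prop :=
  forall (t : A) (y : hom t (sc2 T)), scg T ∘ y ≈ hzero ->
    exists t' (e : hom t' t) (x : hom t' (sc2 S)) (s : hom t' (sc1 T)),
      [/\ epic e, scg S ∘ x ≈ hzero & y ∘ e ≈ (sch2 h ∘ x) ⊕ (scf T ∘ s)].

Lemma to_cyclesK (U : short_complex A) :
  ker_map (cycles U) ∘ to_cycles U ≈ scf U.
Proof. exact: ker_liftK. Qed.

Lemma homology_monicP : monic (homology_map h) <-> sc_injective.
Proof.
split=> [mh t x y x0 hxy|inj].
  set z := ker_lift (cyclesP S) x0.
  have zx : ker_map (cycles S) ∘ z ≈ x := ker_liftK _ _.
  have cz : cycles_map h ∘ z ≈ to_cycles T ∘ y.
    apply: (ker_monic (cyclesP T)).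
    by rewrite !compose_assoc cycles_map_fac to_cyclesK -compose_assoc zx.
  have pz0 : coker_map (homology S) ∘ z ≈ hzero.
    apply: mh; rewrite compose_assoc homology_map_fac -compose_assoc cz.
    by rewrite compose_assoc (coker_zero (homologyP T)) compose0l compose0r.
  have [t' [e [s [ee se]]]] := coker_exact (homologyP S) pz0.
  exists t', e, s; split=> //.
  by rewrite -to_cyclesK -compose_assoc se compose_assoc zx.
apply: monic0 => t u hu0.
have [t1 [e [z [ee ze]]]] := epic_lift u (coker_epic (homologyP S)).
have cz0 : coker_map (homology T) ∘ (cycles_map h ∘ z) ≈ hzero.
  rewrite compose_assoc -homology_map_fac -compose_assoc ze compose_assoc hu0.
  exact: compose0l.
have [t2 [e' [y [ee' ye]]]] := coker_exact (homologyP T) cz0.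
have [||t3 [e'' [s [ee'' se]]]] := inj t2 (ker_map (cycles S) ∘ (z ∘ e')) y.
- by rewrite compose_assoc (ker_zero (cyclesP S)) compose0l.
- rewrite compose_assoc -cycles_map_fac -to_cyclesK -!compose_assoc ye.
  by rewrite !compose_assoc.
apply: ee; apply: ee'; apply: ee''; rewrite !compose0l -ze.
have e1 : to_cycles S ∘ s ≈ z ∘ e' ∘ e''.
  by apply: (ker_monic (cyclesP S)); rewrite compose_assoc to_cyclesK se !compose_assoc.
rewrite -!compose_assoc (compose_assoc z) -e1 compose_assoc.
by rewrite (coker_zero (homologyP S)) compose0l.
Qed.

Lemma homology_epicP : epic (homology_map h) <-> sc_surjective.
Proof.
split=> [eh t y y0|surj].
  set z := ker_lift (cyclesP T) y0.
  have zy : ker_map (cycles T) ∘ z ≈ y := ker_liftK _ _.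
  have [t1 [e1 [u [ee1 ue]]]] := epic_lift (coker_map (homology T) ∘ z) eh.
  have [t2 [e2 [w [ee2 we]]]] := epic_lift u (coker_epic (homologyP S)).
  set v := (z ∘ e1 ∘ e2) ⊕ ⊖ (cycles_map h ∘ w).
  have v0 : coker_map (homology T) ∘ v ≈ hzero.
    rewrite compose_addr composeNr (compose_assoc _ (cycles_map h)).
    rewrite -homology_map_fac -(compose_assoc _ _ w) we !compose_assoc -ue.
    exact: haddNr.
  have [t3 [e3 [s [ee3 se]]]] := coker_exact (homologyP T) v0.
  exists t3, (e1 ∘ e2 ∘ e3), (ker_map (cycles S) ∘ w ∘ e3), s; split.
  - by apply: epic_comp => //; apply: epic_comp.
  - by rewrite !compose_assoc (ker_zero (cyclesP S)) !compose0l.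
  - rewrite -to_cyclesK -(compose_assoc _ _ s) se /v compose_addl composeNl.
    rewrite compose_addr composeNr.
    rewrite -zy !compose_assoc -cycles_map_fac; abel.
move=> z u v uv; apply: (coker_epic (homologyP T)).
have [t [e [x [s [ee x0 xs]]]]] := surj _ _ (ker_zero (cyclesP T)).
apply: ee.
have -> : e ≈ (cycles_map h ∘ ker_lift (cyclesP S) x0) ⊕ (to_cycles T ∘ s).
  apply: (ker_monic (cyclesP T)); rewrite xs compose_addr !compose_assoc.
  by rewrite cycles_map_fac to_cyclesK -(compose_assoc (sch2 h)) ker_liftK.
rewrite !compose_addr -!compose_assoc !(compose_assoc (coker_map _)).
rewrite (coker_zero (homologyP T)) -homology_map_fac !compose0l !compose0r.
by rewrite !compose_assoc uv.
Qed.

Lemma homology_isoP : is_iso (homology_map h) <-> sc_injective /\ sc_surjective.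
Proof.
split=> [ih|[/homology_monicP mh /homology_epicP eh]].
  by split; [apply/homology_monicP; apply: is_iso_monic ih |
             apply/homology_epicP; apply: is_iso_epic ih].
exact: monic_epic_iso.
Qed.

End ShortComplexes.

Section QuasiIso.
Local Open Scope ring_scope.
Variable A : abelian.

(** [f] is injective, resp. surjective, on [H^(n+1)]. *)
Definition h_injective (X Y : complex A) (f : chain_map X Y) (n : int) : Prop :=
  forall (t : A) (x : hom t (X (n + 1))) (y : hom t (Y n)),
    cdiff X (n + 1) ∘ x ≈ hzero -> f (n + 1) ∘ x ≈ cdiff Y n ∘ y ->
    exists t' (e : hom t' t) (s : hom t' (X n)),
      epic e /\ cdiff X n ∘ s ≈ x ∘ e.

Definition h_surjective (X Y : complex A) (f : chain_map X Y) (n : int) : Prop :=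
  forall (t : A) (y : hom t (Y (n + 1))), cdiff Y (n + 1) ∘ y ≈ hzero ->
    exists t' (e : hom t' t) (x : hom t' (X (n + 1))) (s : hom t' (Y n)),
      [/\ epic e, cdiff X (n + 1) ∘ x ≈ hzero &
        y ∘ e ≈ (f (n + 1) ∘ x) ⊕ (cdiff Y n ∘ s)].

Lemma quasi_isoP (X Y : complex_category A) (f : hom X Y) :
  quasi_iso f <-> forall n : int, h_injective f n /\ h_surjective f n.
Proof.
split=> qf n; first by have /homology_isoP := qf n.
by apply/homology_isoP; apply: qf.
Qed.

(** The homotopy [h n] starts in degree [n + 1], which keeps degree [n - 1], and with it any
    transport between degrees, out of the formula. *)
Lemma homotopy_quasi_iso (X Y : complex_category A) (f : hom X Y) (g : hom Y X)
    (h : forall n : int, hom (Y (n + 1)) (Y n)) :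
  g ∘ f ≈ idm X ->
  (forall n : int, idm (Y (n + 1)) ≈ (f (n + 1) ∘ g (n + 1)) ⊕
     ((cdiff Y n ∘ h n) ⊕ (h (n + 1) ∘ cdiff Y (n + 1)))) ->
  quasi_iso f.
Proof.
move=> gf fg; have gfE n : g n ∘ f n ≈ idm (X n) := gf n.
apply/quasi_isoP => n; split=> [t x y _ fx|t y y0].
  exists t, (idm t), (g n ∘ y); split; first exact: is_iso_epic (is_iso_id _).
  rewrite compose_assoc -cmap_comm -compose_assoc -fx compose_assoc.
  by rewrite gfE compose_idl compose_idr.
exists t, (idm t), (g (n + 1) ∘ y), (h n ∘ y).
split; first exact: is_iso_epic (is_iso_id _).
  by rewrite compose_assoc -cmap_comm -compose_assoc y0 compose0r.
rewrite compose_idr -{1}(compose_idl y) fg !compose_addl -!compose_assoc y0.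
by rewrite compose0r hadd0r.
Qed.

(** The same data, with the conclusion for the retraction. The unit below is the section of such a
    retract and the counit is the retraction. *)
Lemma homotopy_quasi_iso_inv (X Y : complex_category A) (f : hom X Y)
    (g : hom Y X) (h : forall n : int, hom (Y (n + 1)) (Y n)) :
  g ∘ f ≈ idm X ->
  (forall n : int, idm (Y (n + 1)) ≈ (f (n + 1) ∘ g (n + 1)) ⊕
     ((cdiff Y n ∘ h n) ⊕ (h (n + 1) ∘ cdiff Y (n + 1)))) ->
  quasi_iso g.
Proof.
move=> gf fg; have gfE n : g n ∘ f n ≈ idm (X n) := gf n.
apply/quasi_isoP => n; split=> [t y x y0 gy|t x x0].
  exists t, (idm t), ((f n ∘ x) ⊕ (h n ∘ y)).
  split; first exact: is_iso_epic (is_iso_id _).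
  rewrite compose_idr -{2}(compose_idl y) fg !compose_addl -!compose_assoc y0 gy.
  by rewrite compose0r hadd0r compose_addr !compose_assoc cmap_comm.
exists t, (idm t), (f (n + 1) ∘ x), hzero.
split; first exact: is_iso_epic (is_iso_id _).
  by rewrite compose_assoc -cmap_comm -compose_assoc x0 compose0r.
rewrite compose0r hadd0r compose_idr compose_assoc gfE.
by rewrite compose_idl.
Qed.

Lemma quasi_iso_iso (X Y : complex_category A) (f : hom X Y) :
  is_iso f -> quasi_iso f.
Proof.
move=> [g [gf fg]]; apply: (@homotopy_quasi_iso _ _ f g (fun=> hzero) gf) => n.
have fgE : f (n + 1) ∘ g (n + 1) ≈ idm (Y (n + 1)) := fg (n + 1).
by rewrite fgE compose0r compose0l hadd0 hadd0r.
Qed.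

End QuasiIso.

(** Extends a rule for a composite of two morphisms to longer composites associated to the right. *)
Lemma comp_eq (C : category) (v x y z : C) (g : hom y z) (f : hom x y)
    (k : hom x z) (h : hom v x) : g ∘ f ≈ k -> g ∘ (f ∘ h) ≈ k ∘ h.
Proof. by move=> <-; rewrite compose_assoc. Qed.

(** Degreewise inverses of a chain map automatically commute with the differentials. *)
Lemma chain_iso (A : preadditive) (X Y : complex_category A) (f : hom X Y)
    (g : forall n : int, hom (Y n) (X n)) :
  (forall n : int, g n ∘ f n ≈ idm (X n)) ->
  (forall n : int, f n ∘ g n ≈ idm (Y n)) ->
  is_iso f.
Proof.
move=> gf fg.
have gd n : (g (n + 1) ∘ cdiff Y n ≈ cdiff X n ∘ g n)%R.
  rewrite -(compose_idr (cdiff Y n)) -fg (compose_assoc (cdiff Y n)) -cmap_comm.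
  by rewrite !compose_assoc gf compose_idl.
by exists (ChainMap gd : @hom (complex_category A) _ _); split=> n;
  [apply: gf | apply: fg].
Qed.

(** * Functoriality of mapping cones and their invariance under quasi-isomorphisms *)

Section ConeMap.
Local Open Scope ring_scope.
Variable A : abelian.

Section Components.
Variables (X Y : complex A) (f : chain_map X Y).

Definition cone_fst (n : int) : hom (cone f n) (X (n + 1)) :=
  bip_prl (ab_biproduct _ _).
Definition cone_snd (n : int) : hom (cone f n) (Y n) :=
  bip_prr (ab_biproduct _ _).
Definition cone_pair (n : int) (t : A) (u : hom t (X (n + 1))) (v : hom t (Y n)) :
  hom t (cone f n) := bpair (ab_biproduct _ _) u v.

#[export] Instance cone_pair_proper (n : int) (t : A) :
  Proper (heq ==> heq ==> heq) (@cone_pair n t).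
Proof. exact: bpair_proper. Qed.

Lemma cone_fst_pair (n : int) (t : A) (u : hom t (X (n + 1))) (v : hom t (Y n)) :
  cone_fst n ∘ cone_pair u v ≈ u.
Proof. exact: prl_bpair. Qed.

Lemma cone_snd_pair (n : int) (t : A) (u : hom t (X (n + 1))) (v : hom t (Y n)) :
  cone_snd n ∘ cone_pair u v ≈ v.
Proof. exact: prr_bpair. Qed.

Lemma cone_ext (n : int) (t : A) (u v : hom t (cone f n)) :
  cone_fst n ∘ u ≈ cone_fst n ∘ v -> cone_snd n ∘ u ≈ cone_snd n ∘ v -> u ≈ v.
Proof. exact: bpair_eq. Qed.

Lemma cone_fst_d (n : int) :
  cone_fst (n + 1) ∘ cdiff (cone f) n ≈ ⊖ (cdiff X (n + 1) ∘ cone_fst n).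
Proof.
rewrite /cone_fst /= (compose_addr (bip_prl _)) !compose_assoc bip_ll bip_lr compose_idl.
by rewrite compose0l hadd0r composeNl.
Qed.

Lemma cone_snd_d (n : int) :
  cone_snd (n + 1) ∘ cdiff (cone f) n ≈
  (f (n + 1) ∘ cone_fst n) ⊕ (cdiff Y n ∘ cone_snd n).
Proof.
rewrite /cone_snd /= (compose_addr (bip_prr _)) !compose_assoc bip_rl bip_rr compose_idl.
by rewrite !compose0l hadd0.
Qed.

Lemma cone_fst_incl (n : int) : cone_fst n ∘ cone_incl f n ≈ hzero.
Proof. exact: bip_lr. Qed.

Lemma cone_snd_incl (n : int) : cone_snd n ∘ cone_incl f n ≈ idm _.
Proof. exact: bip_rr. Qed.

End Components.
#[global] Typeclasses Opaque cone_fst cone_snd cone_pair.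

Variables (X Y X' Y' : complex A) (f : chain_map X Y) (f' : chain_map X' Y').
Variables (a : chain_map X X') (b : chain_map Y Y').
Hypothesis ab : forall n : int, f' n ∘ a n ≈ b n ∘ f n.

Program Definition cone_map : chain_map (cone f) (cone f') :=
  {| cmap := fun n => cone_pair f' (a (n + 1) ∘ cone_fst f n) (b n ∘ cone_snd f n) |}.
Next Obligation.
move=> n; apply: cone_ext.
  rewrite (comp_eq _ (cone_fst_pair _ _ _)) (comp_eq _ (cone_fst_d _ _)).
  rewrite -compose_assoc cone_fst_d composeNl -compose_assoc cone_fst_pair.
  by rewrite composeNr !compose_assoc cmap_comm.
rewrite (comp_eq _ (cone_snd_pair _ _ _)) (comp_eq _ (cone_snd_d _ _)).
rewrite -compose_assoc cone_snd_d compose_addl -!compose_assoc cone_fst_pair.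
by rewrite cone_snd_pair compose_addr !compose_assoc ab cmap_comm.
Qed.

(** This is the five lemma for the long exact sequence of the cone, carried out as a chase of
    generalized elements. Each appeal to the hypotheses on [a] and [b] costs one cover, whence [e1],
    [e2] and [e3]. *)
Lemma cone_map_quasi_iso :
  quasi_iso (a : @hom (complex_category A) X X') ->
  quasi_iso (b : @hom (complex_category A) Y Y') ->
  quasi_iso (cone_map : @hom (complex_category A) (cone f) (cone f')).
Proof.
move=> /quasi_isoP qa /quasi_isoP qb; apply/quasi_isoP => n; split.
  move=> t z z' dz0 ez.
  set x := cone_fst f (n + 1) ∘ z; set y := cone_snd f (n + 1) ∘ z.
  set x' := cone_fst f' n ∘ z'; set y' := cone_snd f' n ∘ z'.
  have dx : cdiff X (n + 1 + 1) ∘ x ≈ hzero.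
    rewrite -(hoppK (_ ∘ x)) /x compose_assoc -composeNl -cone_fst_d -compose_assoc.
    by rewrite dz0 compose0r hopp0.
  have dy : (f (n + 1 + 1) ∘ x) ⊕ (cdiff Y (n + 1) ∘ y) ≈ hzero.
    rewrite /x /y !compose_assoc -compose_addl -cone_snd_d -compose_assoc.
    by rewrite dz0 compose0r.
  have ax : a (n + 1 + 1) ∘ x ≈ ⊖ (cdiff X' (n + 1) ∘ x').
    rewrite /x /x' !compose_assoc -composeNl -cone_fst_d -(compose_assoc _ _ z') -ez.
    by rewrite (comp_eq _ (cone_fst_pair _ _ _)).
  have bY : b (n + 1) ∘ y ≈ (f' (n + 1) ∘ x') ⊕ (cdiff Y' n ∘ y').
    rewrite /x' /y' !compose_assoc -compose_addl -cone_snd_d -(compose_assoc _ _ z') -ez.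
    by rewrite (comp_eq _ (cone_snd_pair _ _ _)).
  have zx : x ≈ cone_fst f (n + 1) ∘ z by [].
  have zy : y ≈ cone_snd f (n + 1) ∘ z by [].
  clearbody x y x' y'.
  have az : a (n + 1 + 1) ∘ x ≈ cdiff X' (n + 1) ∘ ⊖ x' by rewrite composeNr.
  have [t1 [e1 [x0 [ee1 dx0]]]] := (qa (n + 1)).1 _ _ _ dx az.
  have dv : cdiff X' (n + 1) ∘ ((a (n + 1) ∘ x0) ⊕ (x' ∘ e1)) ≈ hzero.
    rewrite compose_addr !compose_assoc -cmap_comm -(compose_assoc _ _ x0) dx0.
    by rewrite compose_assoc ax composeNl haddN.
  have [t2 [e2 [x2 [s [ee2 dx2 ev]]]]] := (qa n).2 _ _ dv.
  (* The element [- x0] has the right differential; the cycle [x2] corrects it so that its image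
     under [a] becomes [x'] up to the boundary of [s]. *)
  set x3 := x2 ⊕ ⊖ (x0 ∘ e2).
  have dx3 : cdiff X (n + 1) ∘ x3 ≈ ⊖ (x ∘ e1 ∘ e2).
    rewrite /x3 compose_addr composeNr compose_assoc dx0 dx2; abel.
  have ax3 : a (n + 1) ∘ x3 ≈ (x' ∘ e1 ∘ e2) ⊕ ⊖ (cdiff X' n ∘ s).
    rewrite /x3 compose_addr composeNr compose_assoc.
    move: ev; rewrite compose_addl => ev.
    have -> : a (n + 1) ∘ x2 ≈ (a (n + 1) ∘ x2 ⊕ cdiff X' n ∘ s) ⊕ ⊖ (cdiff X' n ∘ s).
      abel.
    rewrite -ev; abel.
  (* What is left of [y] once the contribution of [x3] is removed: a cycle whose image under [b] is
     a boundary. *)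
  set y3 := (y ∘ e1 ∘ e2) ⊕ ⊖ (f (n + 1) ∘ x3).
  have dy3 : cdiff Y (n + 1) ∘ y3 ≈ hzero.
    rewrite /y3 compose_addr composeNr !compose_assoc -cmap_comm.
    rewrite -(compose_assoc _ _ x3) dx3 composeNr hoppK !compose_assoc.
    by rewrite -!compose_addl haddC dy !compose0l.
  have by3 : b (n + 1) ∘ y3 ≈ cdiff Y' n ∘ ((y' ∘ e1 ∘ e2) ⊕ (f' n ∘ s)).
    rewrite /y3 compose_addr composeNr !compose_assoc -ab -(compose_assoc _ _ x3).
    rewrite ax3 bY !compose_addr composeNr !compose_addl !compose_assoc -cmap_comm.
    abel.
  have [t3 [e3 [y4 [ee3 dy4]]]] := (qb n).1 _ _ _ dy3 by3.
  exists t3, (e1 ∘ e2 ∘ e3), (cone_pair f (x3 ∘ e3) y4); split.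
    by apply: epic_comp => //; apply: epic_comp.
  apply: cone_ext.
    rewrite (comp_eq _ (cone_fst_d _ _)) composeNl -compose_assoc cone_fst_pair.
    by rewrite compose_assoc dx3 composeNl hoppK zx !compose_assoc.
  rewrite (comp_eq _ (cone_snd_d _ _)) compose_addl -!compose_assoc.
  rewrite cone_fst_pair cone_snd_pair dy4 /y3 compose_addl composeNl.
  rewrite zy !compose_assoc; abel.
move=> t z' dz'.
set x' := cone_fst f' (n + 1) ∘ z'; set y' := cone_snd f' (n + 1) ∘ z'.
have dx' : cdiff X' (n + 1 + 1) ∘ x' ≈ hzero.
  rewrite -(hoppK (_ ∘ x')) /x' compose_assoc -composeNl -cone_fst_d -compose_assoc.
  by rewrite dz' compose0r hopp0.
have dy' : (f' (n + 1 + 1) ∘ x') ⊕ (cdiff Y' (n + 1) ∘ y') ≈ hzero.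
  rewrite /x' /y' !compose_assoc -compose_addl -cone_snd_d -compose_assoc.
  by rewrite dz' compose0r.
have zx' : x' ≈ cone_fst f' (n + 1) ∘ z' by [].
have zy' : y' ≈ cone_snd f' (n + 1) ∘ z' by [].
clearbody x' y'.
have [t1 [e1 [x [x1 [ee1 dx ex]]]]] := (qa (n + 1)).2 _ _ dx'.
have dfx : cdiff Y (n + 1 + 1) ∘ (f (n + 1 + 1) ∘ x) ≈ hzero.
  by rewrite compose_assoc -cmap_comm -compose_assoc dx compose0r.
have bfx : b (n + 1 + 1) ∘ (f (n + 1 + 1) ∘ x) ≈
    cdiff Y' (n + 1) ∘ ⊖ ((y' ∘ e1) ⊕ (f' (n + 1) ∘ x1)).
  apply: hsub_eq; rewrite composeNr hoppK compose_addr !compose_assoc -ab.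
  rewrite -cmap_comm -(compose_assoc (f' _)).
  rewrite -(compose_assoc (f' _) (cdiff _ _)).
  transitivity (((f' (n + 1 + 1) ∘ x') ⊕ (cdiff Y' (n + 1) ∘ y')) ∘ e1).
    rewrite compose_addl -(compose_assoc _ x') ex compose_addr; abel.
  by rewrite dy' compose0l.
have [t2 [e2 [y0 [ee2 dy0]]]] := (qb (n + 1)).1 _ _ _ dfx bfx.
(* [(x, - y0)] is a cycle of the cone of [f]. Subtracting from [z'] its image and the boundary of
   [(- x1, 0)] leaves [(0, w)], so only [Y] and [Y'] remain to be treated. *)
set w := ((y' ∘ e1) ⊕ (f' (n + 1) ∘ x1)) ∘ e2 ⊕ (b (n + 1) ∘ y0).
have dw : cdiff Y' (n + 1) ∘ w ≈ hzero.
  rewrite /w compose_addr !compose_assoc -cmap_comm -(compose_assoc _ _ y0) dy0.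
  by rewrite compose_assoc bfx composeNr composeNl haddNr.
have [t3 [e3 [y2 [y3 [ee3 dy2 ew]]]]] := (qb n).2 _ _ dw.
exists t3, (e1 ∘ e2 ∘ e3),
  (cone_pair f (x ∘ e2 ∘ e3) (y2 ⊕ ⊖ (y0 ∘ e3))),
  (cone_pair f' (⊖ (x1 ∘ e2 ∘ e3)) y3); split.
- by apply: epic_comp => //; apply: epic_comp.
- apply: cone_ext.
    rewrite (comp_eq _ (cone_fst_d _ _)) composeNl -compose_assoc cone_fst_pair.
    by rewrite !compose_assoc dx !compose0l hopp0 compose0r.
  rewrite (comp_eq _ (cone_snd_d _ _)) compose_addl -!compose_assoc.
  rewrite cone_fst_pair cone_snd_pair compose_addr dy2 composeNr.
  rewrite !compose_assoc dy0 compose0r; abel.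
- apply: cone_ext; rewrite compose_addr.
    rewrite (comp_eq _ (cone_fst_d _ _)) (comp_eq _ (cone_fst_pair _ _ _)).
    rewrite composeNl -!compose_assoc !cone_fst_pair composeNr hoppK.
    rewrite !compose_assoc -zx' ex !compose_addl; abel.
  rewrite (comp_eq _ (cone_snd_d _ _)) (comp_eq _ (cone_snd_pair _ _ _)).
  rewrite compose_addl -!compose_assoc !cone_fst_pair !cone_snd_pair.
  rewrite composeNr !compose_assoc -zy' compose_addr composeNr.
  move: ew; rewrite /w !compose_addl !compose_assoc => ew.
  apply: (@hadd_cancel _ _ _ _ _ (f' (n + 1) ∘ x1 ∘ e2 ∘ e3 ⊕ b (n + 1) ∘ y0 ∘ e3)).
  transitivity (b (n + 1) ∘ y2 ⊕ cdiff Y' n ∘ y3); last abel.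
  rewrite -ew; abel.
Qed.

End ConeMap.

Section QuasiIsoTheory.
Local Open Scope ring_scope.
Variable A : abelian.

Lemma quasi_iso_comp (X Y Z : complex_category A) (g : hom Y Z) (f : hom X Y) :
  quasi_iso g -> quasi_iso f -> quasi_iso (g ∘ f).
Proof.
move=> /quasi_isoP qg /quasi_isoP qf; apply/quasi_isoP => n; split.
  move=> t x z x0 gfx.
  have gfx' : g (n + 1) ∘ (f (n + 1) ∘ x) ≈ cdiff Z n ∘ z.
    by rewrite -gfx compose_assoc.
  have fx0 : cdiff Y (n + 1) ∘ (f (n + 1) ∘ x) ≈ hzero.
    by rewrite compose_assoc -cmap_comm -compose_assoc x0 compose0r.
  have [t1 [e1 [y [ee1 ey]]]] := (qg n).1 _ _ _ fx0 gfx'.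
  have [||t2 [e2 [s [ee2 es]]]] := (qf n).1 _ (x ∘ e1) y.
  - by rewrite compose_assoc x0 compose0l.
  - by rewrite ey compose_assoc.
  exists t2, (e1 ∘ e2), s; split; first exact: epic_comp.
  by rewrite es compose_assoc.
move=> t z z0.
have [t1 [e1 [y [s [ee1 dy ey]]]]] := (qg n).2 _ _ z0.
have [t2 [e2 [x [r [ee2 dx ex]]]]] := (qf n).2 _ _ dy.
exists t2, (e1 ∘ e2), x, ((g n ∘ r) ⊕ (s ∘ e2)); split=> //.
  exact: epic_comp.
rewrite compose_assoc ey compose_addl -!compose_assoc ex !compose_addr.
rewrite !compose_assoc cmap_comm /=; abel.
Qed.

Lemma quasi_iso_heq (X Y : complex_category A) (f g : hom X Y) :
  f ≈ g -> quasi_iso f -> quasi_iso g.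
Proof.
move=> fg /quasi_isoP qf; apply/quasi_isoP => n; split.
  by move=> t x y x0 gx; apply: ((qf n).1 t x y x0); rewrite (fg (n + 1)).
move=> t y y0; have [t' [e [x [s [ee dx ex]]]]] := (qf n).2 t y y0.
by exists t', e, x, s; split=> //; rewrite -(fg (n + 1)).
Qed.

Lemma quasi_iso_shift_inv (X Y : complex_category A) (f : hom X Y) :
  quasi_iso (fmap (shift_functor A) f) -> quasi_iso f.
Proof.
move=> /quasi_isoP qf; apply/quasi_isoP => m.
(* Index [n] of the shift corresponds to index [n + 1] of the complex, so an arbitrary index is
   first written as a successor. *)
have -> : m = (m - 1) + 1 by rewrite subrK.
move: (m - 1) => {m} n; split=> [t x y x0 fx|t y y0].
  have [||t' [e [s [ee es]]]] := (qf n).1 t x (⊖ y).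
  - by rewrite /= composeNl x0 hopp0.
  - by rewrite /= composeNl composeNr hoppK.
  by exists t', e, (⊖ s); split=> //; rewrite composeNr -composeNl.
have [|t' [e [x [s [ee dx es]]]]] := (qf n).2 t y.
  by rewrite /= composeNl y0 hopp0.
exists t', e, x, (⊖ s); split=> //; last by rewrite composeNr -composeNl.
by rewrite -(hoppK (_ ∘ x)) -composeNl dx hopp0.
Qed.

End QuasiIsoTheory.

(** * The inverse of the shift *)

Section Desuspension.
Local Open Scope ring_scope.

Section Cast.
Variable A : preadditive.

(** Transport between equal degrees, made into a morphism. Equality proofs between integers are
    unique, so parallel transports agree. *)
Definition complex_cast (X : complex A) (m n : int) (e : m = n) :
    hom (X m) (X n) :=
  match e in _ = k return hom (X m) (X k) with erefl => idm (X m) end.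

Lemma complex_castK (X : complex A) (m n : int) (e : m = n) (e' : n = m) :
  complex_cast X e' ∘ complex_cast X e ≈ idm (X m).
Proof. by case: n / e e' => e'; rewrite (eq_axiomK e') compose_idl. Qed.

Lemma complex_cast_comp (X : complex A) (m n k : int) (e : m = n) (e' : n = k)
    (e'' : m = k) :
  complex_cast X e' ∘ complex_cast X e ≈ complex_cast X e''.
Proof.
by case: k / e' e'' => e''; case: n / e e'' => e'';
  rewrite (eq_axiomK e'') compose_idl.
Qed.

Lemma complex_cast_d (X : complex A) (m n : int) (e : m = n)
    (e' : m + 1 = n + 1) :
  cdiff X n ∘ complex_cast X e ≈ complex_cast X e' ∘ cdiff X m.
Proof. by case: n / e e' => e'; rewrite (eq_axiomK e') compose_idl compose_idr. Qed.

Lemma complex_cast_map (X Y : complex A) (f : chain_map X Y) (m n : int)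
    (e : m = n) : f n ∘ complex_cast X e ≈ complex_cast Y e ∘ f m.
Proof. by case: n / e; rewrite compose_idl compose_idr. Qed.

Lemma complex_cast_shift (X : complex A) (m n : int) (e : m = n)
    (e' : m + 1 = n + 1) :
  complex_cast (complex_shift X) e ≈ complex_cast X e'.
Proof. by case: n / e e' => e'; rewrite (eq_axiomK e'). Qed.

(** The sign cancels the one in [complex_shift], so that the comparison isomorphisms below are pure
    transports. *)
Program Definition complex_desusp (X : complex A) : complex A :=
  {| cob := fun n => X (n - 1);
     cdiff := fun n =>
       ⊖ (complex_cast X (addrAC n (-1) 1) ∘ cdiff X (n - 1)) |}.
Next Obligation.
move=> X n /=; rewrite composeNl composeNr hoppK compose_assoc.
rewrite -(compose_assoc _ (cdiff X (n + 1 - 1))).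
rewrite (complex_cast_d _ _ (f_equal (fun k => k + 1) (addrAC n (-1) 1))).
by rewrite compose_assoc -compose_assoc cdiff2 compose0r.
Qed.

Program Definition chain_desusp (X Y : complex A) (f : chain_map X Y) :
    chain_map (complex_desusp X) (complex_desusp Y) :=
  {| cmap := fun n => f (n - 1) |}.
Next Obligation.
move=> X Y f n /=; rewrite composeNl composeNr compose_assoc complex_cast_map.
by rewrite -!compose_assoc cmap_comm.
Qed.

Program Definition desusp_functor :
    functor (complex_category A) (complex_category A) :=
  {| fob := complex_desusp : complex_category A -> complex_category A;
     fmap := chain_desusp |}.
Next Obligation. by move=> X Y f g e n; apply: e. Qed.
Next Obligation. by move=> X n; reflexivity. Qed.
Next Obligation. by move=> X Y Z g f n; reflexivity. Qed.

Program Definition shift_desusp :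
    nat_trans (functor_comp (shift_functor A) desusp_functor) (functor_id _) :=
  {| component := fun X => {| cmap := fun n => complex_cast X (addrK 1 n) |} |}.
Next Obligation.
move=> X n /=; rewrite hoppK compose_assoc.
rewrite (complex_cast_comp _ _ _ (f_equal (fun k => k + 1) (addrK 1 n))).
by rewrite complex_cast_d.
Qed.
Next Obligation. by move=> X Y f n /=; rewrite complex_cast_map. Qed.

Program Definition desusp_shift :
    nat_trans (functor_comp desusp_functor (shift_functor A)) (functor_id _) :=
  {| component := fun X => {| cmap := fun n => complex_cast X (subrK 1 n) |} |}.
Next Obligation.
move=> X n /=; rewrite !composeNr hoppK.
rewrite (complex_cast_shift _ _ (f_equal (fun k => k + 1) (addrAC n (-1) 1))).
rewrite compose_assoc.
rewrite (complex_cast_comp _ _ _ (f_equal (fun k => k + 1) (subrK 1 n))).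
by rewrite complex_cast_d.
Qed.
Next Obligation. by move=> X Y f n /=; rewrite complex_cast_map. Qed.

Lemma shift_desusp_iso : nat_iso shift_desusp.
Proof.
move=> X; apply: (@chain_iso A _ _ (shift_desusp X)
  (fun n : int => complex_cast X (esym (addrK 1 n)))).
  by move=> n; apply: (complex_castK X (addrK 1 n) (esym (addrK 1 n))).
by move=> n; apply: (complex_castK X (esym (addrK 1 n)) (addrK 1 n)).
Qed.

Lemma desusp_shift_iso : nat_iso desusp_shift.
Proof.
move=> X; apply: (@chain_iso A _ _ (desusp_shift X)
  (fun n : int => complex_cast X (esym (subrK 1 n)))).
  by move=> n; apply: (complex_castK X (subrK 1 n) (esym (subrK 1 n))).
by move=> n; apply: (complex_castK X (esym (subrK 1 n)) (subrK 1 n)).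
Qed.

End Cast.

(** The shift of the desuspended map is conjugate to [f] by isomorphisms, and the shift reflects
    quasi-isomorphisms. *)
Lemma quasi_iso_desusp (A : abelian) (X Y : complex_category A) (f : hom X Y) :
  quasi_iso f -> quasi_iso (fmap (desusp_functor A) f).
Proof.
move=> qf; apply: quasi_iso_shift_inv.
have nat := naturality (shift_desusp A) f.
have [g [gs sg]] := shift_desusp_iso Y.
apply: (@quasi_iso_heq _ _ _ (g ∘ (f ∘ shift_desusp A X))).
  by rewrite -[f ∘ _]nat compose_assoc gs compose_idl.
apply: quasi_iso_comp.
  by apply: quasi_iso_iso; exists (shift_desusp A Y).
apply: quasi_iso_comp qf _; apply: quasi_iso_iso; exact: shift_desusp_iso.
Qed.

End Desuspension.

Lemma is_iso_heq (C : category) (x y : C) (f g : hom x y) :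
  f ≈ g -> is_iso f -> is_iso g.
Proof. by move=> fg [h [hf fh]]; exists h; rewrite -fg. Qed.

(** * Quasi-isomorphisms of diagrams *)

Section Pointwise.
Local Open Scope ring_scope.
Variables (C : category) (A : abelian).
Let AC := functor_abelian C A.

(** The existentials in the hypothesis do not yield a family of inverses. Being monic and being epic
    are checked pointwise instead, and [monic_epic_iso] builds a global inverse. *)
Lemma pointwise_iso (F G : AC) (s : hom F G) :
  (forall p : C, is_iso ((s : nat_trans F G) p)) -> is_iso s.
Proof.
move=> si; apply: monic_epic_iso.
  by move=> H a b e; exact (fun p => is_iso_monic (si p) (e p)).
by move=> H a b e; exact (fun p => is_iso_epic (si p) (e p)).
Qed.

Variable p : C.

Definition complex_eval (X : complex AC) : complex A :=
  @Complex A (fun n => (X n : functor C A) p)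
    (fun n => (cdiff X n : nat_trans _ _) p) (fun n => cdiff2 X n p).

Definition chain_eval (X Y : complex AC) (f : chain_map X Y) :
    chain_map (complex_eval X) (complex_eval Y) :=
  @ChainMap A (complex_eval X) (complex_eval Y)
    (fun n => (f n : nat_trans _ _) p) (fun n => cmap_comm f n p).

(** Kernels and cokernels of diagrams are the chosen pointwise ones, and [complex_eval] evaluates
    the proof of [cdiff2] too; hence both sides have the same source and target by conversion. *)
Lemma homology_map_eval (X Y : complex AC) (f : chain_map X Y) (n : int) :
  homology_map (chain_at (chain_eval f) n) ≈
  (homology_map (chain_at f n) : nat_trans _ _) p.
Proof.
exact (@homology_map_unique A _ _ (chain_at (chain_eval f) n)
  ((cycles_map (chain_at f n) : nat_trans _ _) p)
  ((homology_map (chain_at f n) : nat_trans _ _) p)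
  (cycles_map_fac (chain_at f n) p) (homology_map_fac (chain_at f n) p)).
Qed.

End Pointwise.

(** Reduces the question to one point at a time, where maps and homotopies that are not natural in
    the point may be used. *)
Lemma pointwise_quasi_iso (C : category) (A : abelian)
    (X Y : complex_category (functor_abelian C A)) (f : hom X Y) :
  quasi_iso f <->
  forall p : C, quasi_iso (chain_eval p f :
    @hom (complex_category A) (complex_eval p X) (complex_eval p Y)).
Proof.
split=> [qf p n|qf n].
  have [g [gf fg]] := qf n.
  apply: is_iso_heq (symmetry (homology_map_eval p f n)) _.
  by exists ((g : nat_trans _ _) p); split; [exact (gf p) | exact (fg p)].
apply: pointwise_iso => p; apply: is_iso_heq (homology_map_eval p f n) _.
exact: qf.
Qed.

(** * Functors between localizations *)

(** The inverse is part of the data: [nat_iso] asserts its existence pointwise,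
    which does not provide a transformation without choice. *)
Definition functor_iso (C D : category) (F G : functor C D) : Prop :=
  exists (s : nat_trans F G) (t : nat_trans G F),
    forall x : C, t x ∘ s x ≈ idm (F x) /\ s x ∘ t x ≈ idm (G x).

Lemma functor_iso_nat (C D : category) (F G : functor C D) :
  functor_iso F G -> exists s : nat_trans F G, nat_iso s.
Proof. by move=> [s [t st]]; exists s => x; exists (t x). Qed.

Lemma functor_iso_sym (C D : category) (F G : functor C D) :
  functor_iso F G -> functor_iso G F.
Proof. by move=> [s [t st]]; exists t, s => x; have [] := st x. Qed.

Lemma functor_iso_trans (C D : category) (G F H : functor C D) :
  functor_iso F G -> functor_iso G H -> functor_iso F H.
Proof.
move=> [s [s' ss]] [t [t' tt]]; exists (nat_comp t s), (nat_comp s' t') => x /=.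
have [e1 e2] := ss x; have [e3 e4] := tt x; split.
  by rewrite compose_assoc -(compose_assoc (s' x)) e3 compose_idr.
by rewrite compose_assoc -(compose_assoc (t x)) e2 compose_idr.
Qed.

Program Definition whisker_left (C D E : category) (K : functor D E)
    (F G : functor C D) (s : nat_trans F G) :
    nat_trans (functor_comp K F) (functor_comp K G) :=
  {| component := fun x => fmap K (s x) |}.
Next Obligation.
by move=> C D E K F G s x y f /=; rewrite -!fmap_comp naturality.
Qed.

Program Definition whisker_right (B C D : category) (F G : functor C D)
    (s : nat_trans F G) (H : functor B C) :
    nat_trans (functor_comp F H) (functor_comp G H) :=
  {| component := fun x => s (H x) |}.
Next Obligation. by move=> B C D F G s H x y f /=; rewrite naturality. Qed.

Lemma functor_iso_left (C D E : category) (K : functor D E)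
    (F G : functor C D) :
  functor_iso F G -> functor_iso (functor_comp K F) (functor_comp K G).
Proof.
move=> [s [t st]]; exists (whisker_left K s), (whisker_left K t) => x /=.
by have [e e'] := st x; rewrite -!fmap_comp e e' !fmap_id.
Qed.

Lemma functor_iso_right (B C D : category) (F G : functor C D)
    (H : functor B C) :
  functor_iso F G -> functor_iso (functor_comp F H) (functor_comp G H).
Proof.
move=> [s [t st]]; exists (whisker_right s H), (whisker_right t H) => x /=.
exact: st.
Qed.

(** Associativity and unit laws of [functor_comp] are instances: both sides
    have the same action and differ in the proofs of the functor laws. *)
Lemma functor_iso_refl (C D : category) (f : C -> D)
    (m : forall x y : C, hom x y -> hom (f x) (f y)) p1 p2 p3 q1 q2 q3 :
  functor_iso (@Functor C D f m p1 p2 p3) (@Functor C D f m q1 q2 q3).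
Proof.
have n1 x y (u : hom x y) : idm (f y) ∘ m _ _ u ≈ m _ _ u ∘ idm (f x).
  by rewrite compose_idl compose_idr.
by exists (@NatTrans C D (@Functor C D f m p1 p2 p3)
     (@Functor C D f m q1 q2 q3) (fun x => idm (f x)) n1),
  (@NatTrans C D (@Functor C D f m q1 q2 q3)
     (@Functor C D f m p1 p2 p3) (fun x => idm (f x)) n1) => x /=;
  rewrite compose_idl.
Qed.

Lemma functor_comp_idl (C D : category) (F : functor C D) :
  functor_iso (functor_comp (functor_id D) F) F.
Proof. by case: F => *; apply: functor_iso_refl. Qed.

Lemma functor_comp_idr (C D : category) (F : functor C D) :
  functor_iso (functor_comp F (functor_id C)) F.
Proof. by case: F => *; apply: functor_iso_refl. Qed.

Lemma functor_compA (B C D E : category) (H : functor D E) (G : functor C D)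
    (F : functor B C) :
  functor_iso (functor_comp H (functor_comp G F))
    (functor_comp (functor_comp H G) F).
Proof. exact: functor_iso_refl. Qed.

(** A left inverse and a right inverse agree up to isomorphism: [L ≅ L F R ≅ R]. *)
Lemma equivalence_of_inverses (C D : category) (F : functor C D)
    (L R : functor D C) :
  functor_iso (functor_comp L F) (functor_id C) ->
  functor_iso (functor_comp F R) (functor_id D) -> is_equivalence F.
Proof.
move=> LF FR.
have LR : functor_iso L R.
  apply: functor_iso_trans (functor_iso_sym (functor_comp_idr L)) _.
  apply: functor_iso_trans (functor_iso_left L (functor_iso_sym FR)) _.
  apply: functor_iso_trans (functor_compA L F R) _.
  apply: functor_iso_trans (functor_iso_right R LF) _.
  exact: functor_comp_idl.
exists L; split; apply: functor_iso_nat => //.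
exact: functor_iso_trans (functor_iso_left F LR) FR.
Qed.

(** [functor_comp S' G] is a left inverse of [F] and [functor_comp G T'] a right inverse. In the
    application [S] and [T] are the shifts, [S'] and [T'] the desuspensions. *)
Lemma equivalence_up_to_autoequivalence (C D : category)
    (F : functor C D) (G : functor D C)
    (S S' : functor C C) (T T' : functor D D) :
  functor_iso (functor_comp G F) S -> functor_iso (functor_comp F G) T ->
  functor_iso (functor_comp S' S) (functor_id C) ->
  functor_iso (functor_comp T T') (functor_id D) -> is_equivalence F.
Proof.
move=> GF FG SS TT.
apply: (@equivalence_of_inverses _ _ F (functor_comp S' G) (functor_comp G T')).
  apply: functor_iso_trans (functor_iso_sym (functor_compA S' G F)) _.
  exact: functor_iso_trans (functor_iso_left S' GF) SS.
apply: functor_iso_trans (functor_compA F G T') _.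
exact: functor_iso_trans (functor_iso_right T' FG) TT.
Qed.

Section LocalizationTheory.
Variables (C : category) (W : forall x y : C, hom x y -> Prop).

(** Induction on the formal composite: the square of a formal inverse is the square of the inverted
    morphism read backwards. *)
Lemma localization_naturality (D : category) (H K : functor (localization W) D)
    (c : forall x : C, hom (H x) (K x)) :
  (forall (x y : C) (f : hom x y),
    c y ∘ fmap H (loc_map W f) ≈ fmap K (loc_map W f) ∘ c x) ->
  forall (x y : localization W) (f : hom x y),
    c y ∘ fmap H f ≈ fmap K f ∘ c x.
Proof.
move=> nc x y; elim=> {x y} [x y f|x y w Ww|x y z g IHg f IHf]; first exact: nc.
  have invr : fmap H (loc_map W w) ∘ fmap H (loc_inv Ww) ≈ idm _.
    rewrite -fmap_comp -(fmap_id H); apply: fmap_proper; exact: loc_invr.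
  have invl : fmap K (loc_inv Ww) ∘ fmap K (loc_map W w) ≈ idm _.
    rewrite -fmap_comp -(fmap_id K); apply: fmap_proper; exact: loc_invl.
  rewrite -(compose_idl (c x ∘ _)) -invl -!compose_assoc (compose_assoc _ (c x)).
  by rewrite -nc -compose_assoc invr compose_idr.
have Hc : fmap H (loc_comp g f) ≈ fmap H g ∘ fmap H f := fmap_comp H _ _.
have Kc : fmap K (loc_comp g f) ≈ fmap K g ∘ fmap K f := fmap_comp K _ _.
by rewrite Hc Kc compose_assoc IHg -compose_assoc IHf compose_assoc.
Qed.

(** Components in [V] come with formal inverses as data, so the inverse transformation exists
    without choice. *)
Lemma localization_iso (D : category) (V : forall x y : D, hom x y -> Prop)
    (H K : functor (localization W) (localization V))
    (s : forall x : C, @hom D (H x) (K x)) :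
  (forall x : C, V _ _ (s x)) ->
  (forall (x y : C) (f : hom x y),
    (loc_map V (s y) : @hom (localization V) (H y) (K y)) ∘
      fmap H (loc_map W f) ≈
    fmap K (loc_map W f) ∘ loc_map V (s x)) ->
  functor_iso H K.
Proof.
move=> Vs ns.
pose S x : @hom (localization V) (H x) (K x) := loc_map V (s x).
pose T x : @hom (localization V) (K x) (H x) := loc_inv (Vs x).
have TS x : T x ∘ S x ≈ idm _ by apply: loc_invl.
have ST x : S x ∘ T x ≈ idm _ by apply: loc_invr.
have nT (x y : C) (f : hom x y) :
    T y ∘ fmap K (loc_map W f) ≈ fmap H (loc_map W f) ∘ T x.
  rewrite -(compose_idr (T y ∘ _)) -ST -compose_assoc (compose_assoc (fmap K _)).
  by rewrite -ns !compose_assoc TS compose_idl.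
exists (NatTrans (localization_naturality ns)).
by exists (NatTrans (localization_naturality nT)) => x.
Qed.

End LocalizationTheory.

Section LocalizedFunctorIso.
Variables (C D : category).
Variables (W : forall x y : C, hom x y -> Prop).
Variables (V : forall x y : D, hom x y -> Prop).

Variables (F : functor C D) (G : functor D C) (H : functor C C).
Hypothesis FW : forall (x y : C) (w : hom x y), W w -> V (fmap F w).
Hypothesis GV : forall (x y : D) (v : hom x y), V v -> W (fmap G v).
Hypothesis HW : forall (x y : C) (w : hom x y), W w -> W (fmap H w).

Lemma loc_functor_iso_id (s : nat_trans (functor_comp G F) (functor_id C)) :
  (forall x : C, W (s x)) ->
  functor_iso (functor_comp (loc_functor GV) (loc_functor FW))
    (functor_id (localization W)).
Proof.
move=> Ws; apply: (@localization_iso _ W _ W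
  (functor_comp (loc_functor GV) (loc_functor FW)) (functor_id _) s) => // x y f.
apply: loc_trans (loc_sym (loc_map_comp _ _ _)) _.
apply: loc_trans (loc_map_comp _ _ _); apply: loc_map_cong.
exact (naturality s f).
Qed.

Lemma loc_functor_iso_comp (s : nat_trans (functor_comp G F) H) :
  (forall x : C, W (s x)) ->
  functor_iso (functor_comp (loc_functor GV) (loc_functor FW)) (loc_functor HW).
Proof.
move=> Ws; apply: (@localization_iso _ W _ W
  (functor_comp (loc_functor GV) (loc_functor FW)) (loc_functor HW) s) => // x y f.
apply: loc_trans (loc_sym (loc_map_comp _ _ _)) _.
apply: loc_trans (loc_map_comp _ _ _); apply: loc_map_cong.
exact (naturality s f).
Qed.

Lemma loc_functor_comp_iso (s : nat_trans H (functor_comp G F)) :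
  (forall x : C, W (s x)) ->
  functor_iso (functor_comp (loc_functor GV) (loc_functor FW)) (loc_functor HW).
Proof.
move=> Ws; apply: functor_iso_sym; apply: (@localization_iso _ W _ W
  (loc_functor HW) (functor_comp (loc_functor GV) (loc_functor FW)) s) => // x y f.
apply: loc_trans (loc_sym (loc_map_comp _ _ _)) _.
apply: loc_trans (loc_map_comp _ _ _); apply: loc_map_cong.
exact (naturality s f).
Qed.

End LocalizedFunctorIso.

(** * Exactness of functors induced on derived categories *)

Section DerivedFunctor.
Variables (A B : abelian).
Variable F : functor (complex_category A) (complex_category B).
Hypothesis Fq : forall (X Y : complex_category A) (f : hom X Y),
  quasi_iso f -> quasi_iso (fmap F f).

Let QB := localize (@quasi_iso B).

(** Distinguished triangles are those isomorphic to a cone triangle, so it is enough that [F]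
    commutes with cones of chain maps, compatibly with inclusion and projection. *)
Lemma derived_exact
    (s : nat_trans (functor_comp F (shift_functor A))
      (functor_comp (shift_functor B) F))
    (t : forall (X Y : complex_category A) (f : hom X Y),
      @hom (complex_category B) (F (cone f)) (cone (fmap F f))) :
  nat_iso s -> (forall X Y (f : hom X Y), is_iso (t X Y f)) ->
  (forall X Y (f : hom X Y), t X Y f ∘ fmap F
     (cone_incl f : @hom (complex_category A) Y (cone f)) ≈ cone_incl (fmap F f)) ->
  (forall X Y (f : hom X Y),
    (cone_proj (fmap F f) : @hom (complex_category B) _ (shift_functor B (F X)))
       ∘ t X Y f ≈
    s X ∘ fmap F (cone_proj f : @hom (complex_category A) _ (shift_functor A X))) ->
  exists s', @is_exact (derived A) (derived B) (loc_functor Fq) s'.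
Proof.
move=> si ti tincl tproj.
have ns (X Y : complex_category A) (f : hom X Y) :
    fmap QB (s Y) ∘ fmap QB (fmap F (fmap (shift_functor A) f)) ≈
    fmap QB (fmap (shift_functor B) (fmap F f)) ∘ fmap QB (s X).
  by rewrite -!fmap_comp; apply: fmap_proper; exact (naturality s f).
exists (NatTrans (@localization_naturality _ _ _
  (functor_comp (loc_functor Fq) (derived_shift A))
  (functor_comp (derived_shift B) (loc_functor Fq))
  (fun X => fmap QB (s X)) ns)).
split=> [X|x y z u v w [X [Y [f [a [b [c [[ai bi ci] [eu ev ew]]]]]]]]].
  exact (fmap_iso QB (si X)).
exists (F X), (F Y), (fmap F f).
pose D := loc_functor Fq.
exists (fmap D a), (fmap D b), (fmap QB (t X Y f) ∘ fmap D c).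
split; first by split; [exact: fmap_iso | exact: fmap_iso |
  apply: is_iso_comp; apply: fmap_iso].
split.
- have := fmap_proper D eu; rewrite !fmap_comp; exact: id.
- rewrite -compose_assoc -fmap_comp ev fmap_comp compose_assoc.
  apply: compose_proper => //.
  change (fmap QB (t X Y f) ∘ fmap QB (fmap F
     (cone_incl f : @hom (complex_category A) Y (cone f))) ≈
    fmap QB (cone_incl (fmap F f) : @hom (complex_category B) _ (cone (fmap F f)))).
  by rewrite -fmap_comp; apply: fmap_proper.
(* [a] is a morphism of the derived category, so naturality of the shift comparison is called for
   along formal composites and not along chain maps alone. *)
- have nat := @localization_naturality _ _ _
    (functor_comp (loc_functor Fq) (derived_shift A))
    (functor_comp (derived_shift B) (loc_functor Fq)) _ ns _ _ a.
  rewrite compose_assoc -[X in X ∘ _]nat -compose_assoc -fmap_comp.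
  change (fmap QB (s X) ∘ fmap D (fmap (derived_shift A) a ∘ w) ≈
    fmap QB (cone_proj (fmap F f) :
      @hom (complex_category B) _ (shift_functor B (F X))) ∘
    (fmap QB (t X Y f) ∘ fmap D c)).
  rewrite ew fmap_comp !compose_assoc; apply: compose_proper => //.
  change (fmap QB (s X) ∘ fmap QB (fmap F
      (cone_proj f : @hom (complex_category A) _ (shift_functor A X))) ≈
    fmap QB (cone_proj (fmap F f) :
      @hom (complex_category B) _ (shift_functor B (F X))) ∘ fmap QB (t X Y f)).
  by rewrite -!fmap_comp; apply: fmap_proper; rewrite tproj.
Qed.

End DerivedFunctor.

(** * Cones of natural transformations *)

(** The additivity rules are selected by syntactic matching because unification
    would unfold [cdiff (cone f) n] into the sum that defines it. *)
Ltac cone_simp :=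
  repeat first
    [ match goal with
      | |- context [(?h ∘ ?g) ∘ ?f] => rewrite -(compose_assoc h g f)
      | |- context [?h ∘ (?f ⊕ ?g)] => rewrite (compose_addr h f g)
      | |- context [(?f ⊕ ?g) ∘ ?h] => rewrite (compose_addl f g h)
      | |- context [?h ∘ ⊖ ?f] => rewrite (composeNr h f)
      | |- context [(⊖ ?f) ∘ ?h] => rewrite (composeNl f h)
      end
    | rewrite cone_fst_pair | rewrite (comp_eq _ (cone_fst_pair _ _ _))
    | rewrite cone_snd_pair | rewrite (comp_eq _ (cone_snd_pair _ _ _))
    | rewrite cone_fst_d | rewrite (comp_eq _ (cone_fst_d _ _))
    | rewrite cone_snd_d | rewrite (comp_eq _ (cone_snd_d _ _)) ].

Section Additive.
Local Open Scope ring_scope.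

Definition is_additive (A B : preadditive) (F : functor A B) : Prop :=
  forall (x y : A) (f g : hom x y), fmap F (f ⊕ g) ≈ fmap F f ⊕ fmap F g.

Section AdditiveTheory.
Variables (A B : preadditive) (F : functor A B).
Hypothesis Fadd : is_additive F.

Lemma additive0 (x y : A) : fmap F (hzero : hom x y) ≈ hzero.
Proof.
apply: (@hadd_cancel _ _ _ _ _ (fmap F hzero)).
by rewrite -Fadd hadd0 hadd0r.
Qed.

Lemma additiveN (x y : A) (f : hom x y) : fmap F (⊖ f) ≈ ⊖ fmap F f.
Proof.
apply: (@hadd_cancel _ _ _ _ _ (fmap F f)).
by rewrite -Fadd !haddNr additive0.
Qed.

Program Definition map_complex (X : complex A) : complex B :=
  {| cob := fun n => F (X n); cdiff := fun n => fmap F (cdiff X n) |}.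
Next Obligation. by move=> X n /=; rewrite -fmap_comp cdiff2 additive0. Qed.

Program Definition map_chain (X Y : complex A) (f : chain_map X Y) :
    chain_map (map_complex X) (map_complex Y) :=
  {| cmap := fun n => fmap F (f n) |}.
Next Obligation. by move=> X Y f n /=; rewrite -!fmap_comp cmap_comm. Qed.

End AdditiveTheory.

(** Unlike [/=], leaves the objects folded: [cone f n] is not replaced by the
    biproduct that it reduces to. *)
Ltac chain_cbn :=
  cbn [cmap cdiff fmap idm compose component complex_category chain_id
       chain_comp map_chain map_complex cone_map functor_comp functor_id
       shift_functor chain_shift complex_shift].

Section AdditiveCone.
Variables (A B : abelian) (F : functor A B).
Hypothesis Fadd : is_additive F.
Variables (X Y : complex A) (f : chain_map X Y).

Lemma map_cone_fst_d (n : int) :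
  fmap F (cone_fst f (n + 1)) ∘ cdiff (map_complex Fadd (cone f)) n ≈
  ⊖ (cdiff (map_complex Fadd X) (n + 1) ∘ fmap F (cone_fst f n)).
Proof.
chain_cbn; rewrite -fmap_comp cone_fst_d -fmap_comp.
exact: additiveN.
Qed.

Lemma map_cone_snd_d (n : int) :
  fmap F (cone_snd f (n + 1)) ∘ cdiff (map_complex Fadd (cone f)) n ≈
  (map_chain Fadd f (n + 1) ∘ fmap F (cone_fst f n)) ⊕
  (cdiff (map_complex Fadd Y) n ∘ fmap F (cone_snd f n)).
Proof. chain_cbn; rewrite -!fmap_comp cone_snd_d; exact: Fadd. Qed.

(** Together with the two projections, the images of [cone_inl] and [cone_inr] exhibit the value of
    an additive functor on a cone as a biproduct again. *)
Definition cone_inl (n : int) : hom (X (n + 1)) (cone f n) :=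
  cone_pair f (idm _) hzero.
Definition cone_inr (n : int) : hom (Y n) (cone f n) :=
  cone_pair f hzero (idm _).

Lemma map_cone_fst_inl (n : int) :
  fmap F (cone_fst f n) ∘ fmap F (cone_inl n) ≈ idm _.
Proof. by rewrite -fmap_comp cone_fst_pair fmap_id. Qed.

Lemma map_cone_fst_inr (n : int) :
  fmap F (cone_fst f n) ∘ fmap F (cone_inr n) ≈ hzero.
Proof. by rewrite -fmap_comp cone_fst_pair additive0. Qed.

Lemma map_cone_snd_inl (n : int) :
  fmap F (cone_snd f n) ∘ fmap F (cone_inl n) ≈ hzero.
Proof. by rewrite -fmap_comp cone_snd_pair additive0. Qed.

Lemma map_cone_snd_inr (n : int) :
  fmap F (cone_snd f n) ∘ fmap F (cone_inr n) ≈ idm _.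
Proof. by rewrite -fmap_comp cone_snd_pair fmap_id. Qed.

Lemma map_cone_id (n : int) :
  (fmap F (cone_inl n) ∘ fmap F (cone_fst f n)) ⊕
  (fmap F (cone_inr n) ∘ fmap F (cone_snd f n)) ≈ idm _.
Proof.
rewrite -!fmap_comp -Fadd -fmap_id; apply: fmap_proper.
apply: cone_ext; cone_simp; rewrite compose0l compose_idl compose_idr.
  exact: hadd0r.
exact: hadd0.
Qed.

End AdditiveCone.

Section ConeFunctor.
Variables (A B : abelian) (S T : functor A B).
Hypotheses (Sadd : is_additive S) (Tadd : is_additive T).
Variable u : nat_trans S T.

Program Definition nat_chain (X : complex A) :
    chain_map (map_complex Sadd X) (map_complex Tadd X) :=
  {| cmap := fun n => u (X n) |}.
Next Obligation. by move=> X n /=; rewrite naturality. Qed.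

Lemma nat_chain_comm (X Y : complex A) (f : chain_map X Y) (n : int) :
  nat_chain Y n ∘ map_chain Sadd f n ≈ map_chain Tadd f n ∘ nat_chain X n.
Proof. exact: naturality. Qed.

Program Definition cone_functor :
    functor (complex_category A) (complex_category B) :=
  {| fob := fun X => cone (nat_chain X) : complex_category B;
     fmap := fun X Y f => cone_map (nat_chain_comm f) |}.
Next Obligation. by move=> X Y f g e n /=; rewrite (e n) (e (n + 1)). Qed.
Next Obligation.
move=> X n; apply: cone_ext; chain_cbn; cone_simp;
  by rewrite fmap_id compose_idl compose_idr.
Qed.
Next Obligation.
move=> X Y Z g f n; apply: cone_ext; chain_cbn; cone_simp;
  by rewrite fmap_comp compose_assoc.
Qed.

Lemma cone_functor_quasi_iso :
  (forall (X Y : complex_category A) (f : hom X Y), quasi_iso f ->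
    quasi_iso (map_chain Sadd f : @hom (complex_category B) _ _)) ->
  (forall (X Y : complex_category A) (f : hom X Y), quasi_iso f ->
    quasi_iso (map_chain Tadd f : @hom (complex_category B) _ _)) ->
  forall (X Y : complex_category A) (f : hom X Y),
    quasi_iso f -> quasi_iso (fmap cone_functor f).
Proof.
by move=> Sq Tq X Y f qf; apply: cone_map_quasi_iso; [apply: Sq | apply: Tq].
Qed.

(** Shifting the cone negates its whole differential, including the term [u] from the first summand
    to the second; the sign on the first component makes up for it. *)
Program Definition cone_shift_chain (X : complex A) :
    chain_map (cone (nat_chain (complex_shift X)))
      (complex_shift (cone (nat_chain X))) :=
  {| cmap := fun n => @cone_pair _ _ _ (nat_chain X) (n + 1) _
       (⊖ cone_fst (nat_chain (complex_shift X)) n)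
       (cone_snd (nat_chain (complex_shift X)) n) |}.
Next Obligation.
move=> X n; apply: (@cone_ext _ _ _ (nat_chain X)); chain_cbn; cone_simp; chain_cbn.
  rewrite (additiveN Sadd); cone_simp; abel.
rewrite (additiveN Tadd); cone_simp; abel.
Qed.

Program Definition cone_functor_shift :
    nat_trans (functor_comp cone_functor (shift_functor A))
      (functor_comp (shift_functor B) cone_functor) :=
  {| component := cone_shift_chain |}.
Next Obligation.
move=> X Y f n; apply: (@cone_ext _ _ _ (nat_chain Y)).
  chain_cbn; cbn [cone_functor cone_shift_chain fmap]. by cone_simp.
chain_cbn; cbn [cone_functor cone_shift_chain fmap]. by cone_simp.
Qed.

Lemma cone_functor_shift_iso : nat_iso cone_functor_shift.
Proof.
move=> X; apply: (@chain_iso B _ _ (cone_functor_shift X) (fun n : int =>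
  cone_pair (nat_chain (complex_shift X))
         (⊖ @cone_fst _ _ _ (nat_chain X) (n + 1))
         (@cone_snd _ _ _ (nat_chain X) (n + 1)))) => n.
  apply: cone_ext; chain_cbn; cbn [cone_functor_shift cone_shift_chain];
    cone_simp; rewrite ?hoppK; exact: symmetry (compose_idr _).
apply: (@cone_ext _ _ _ (nat_chain X)); chain_cbn;
  cbn [cone_functor_shift cone_shift_chain];
  cone_simp; rewrite ?hoppK; exact: symmetry (compose_idr _).
Qed.

Section ConeOfCone.
Variables (X Y : complex_category A) (f : hom X Y).
Let Ff : chain_map (cone (nat_chain X)) (cone (nat_chain Y)) :=
  fmap cone_functor f.

Lemma nat_cone_fst (n : int) :
  fmap T (cone_fst f n) ∘ nat_chain (cone f) n ≈
  nat_chain X (n + 1) ∘ fmap S (cone_fst f n).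
Proof. exact: (symmetry (naturality u (cone_fst f n))). Qed.

Lemma nat_cone_snd (n : int) :
  fmap T (cone_snd f n) ∘ nat_chain (cone f) n ≈
  nat_chain Y n ∘ fmap S (cone_snd f n).
Proof. exact: (symmetry (naturality u (cone_snd f n))). Qed.

(** Interchange of the two cone directions. The summand [S (X (n + 1 + 1))] is shifted by both
    cones, and exchanging the two shifts produces its sign. *)
Program Definition cone_functor_cone :
    chain_map (cone (nat_chain (cone f))) (cone Ff) :=
  {| cmap := fun n => cone_pair Ff
       (@cone_pair _ _ _ (nat_chain X) (n + 1) _
         (⊖ (fmap S (cone_fst f (n + 1)) ∘ cone_fst (nat_chain (cone f)) n))
         (fmap T (cone_fst f n) ∘ cone_snd (nat_chain (cone f)) n))
       (cone_pair (nat_chain Y)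
         (fmap S (cone_snd f (n + 1)) ∘ cone_fst (nat_chain (cone f)) n)
         (fmap T (cone_snd f n) ∘ cone_snd (nat_chain (cone f)) n)) |}.
Next Obligation.
move=> n; apply: cone_ext; chain_cbn; cone_simp;
  [apply: (@cone_ext _ _ _ (nat_chain X)) | apply: cone_ext]; cone_simp.
- rewrite (comp_eq _ (map_cone_fst_d _ _ _)); cone_simp; abel.
- rewrite (comp_eq _ (nat_cone_fst _)) (comp_eq _ (map_cone_fst_d _ _ _)).
  cone_simp; abel.
- rewrite (comp_eq _ (map_cone_snd_d _ _ _)); cone_simp; abel.
- rewrite (comp_eq _ (nat_cone_snd _)) (comp_eq _ (map_cone_snd_d _ _ _)).
  cone_simp; abel.
Qed.

Lemma cone_functor_cone_iso : is_iso (cone_functor_cone :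
  @hom (complex_category B) (cone (nat_chain (cone f))) (cone Ff)).
Proof.
apply: (@chain_iso B _ _ (cone_functor_cone : @hom (complex_category B) _ _)
  (fun n : int => cone_pair (nat_chain (cone f))
    ((fmap S (cone_inl f (n + 1)) ∘
        (⊖ (cone_fst (nat_chain X) (n + 1) ∘ cone_fst Ff n))) ⊕
     (fmap S (cone_inr f (n + 1)) ∘ (cone_fst (nat_chain Y) n ∘ cone_snd Ff n)))
    ((fmap T (cone_inl f n) ∘
        (cone_snd (nat_chain X) (n + 1) ∘ cone_fst Ff n)) ⊕
     (fmap T (cone_inr f n) ∘ (cone_snd (nat_chain Y) n ∘ cone_snd Ff n))))) => n.
  apply: cone_ext; cbn [cone_functor_cone cmap]; cone_simp; rewrite ?hoppK;
    rewrite !compose_assoc -compose_addl compose_idr.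
    rewrite (map_cone_id Sadd); exact: compose_idl.
  rewrite (map_cone_id Tadd); exact: compose_idl.
apply: cone_ext; cbn [cone_functor_cone cmap]; cone_simp;
  [apply: (@cone_ext _ _ _ (nat_chain X)) | apply: cone_ext]; cone_simp;
  rewrite ?(comp_eq _ (map_cone_fst_inl _ _ _))
    ?(comp_eq _ (map_cone_fst_inr Sadd _ _))
    ?(comp_eq _ (map_cone_fst_inr Tadd _ _))
    ?(comp_eq _ (map_cone_snd_inl Sadd _ _))
    ?(comp_eq _ (map_cone_snd_inl Tadd _ _))
    ?(comp_eq _ (map_cone_snd_inr _ _ _)) compose_idl compose0l compose_idr;
  abel.
Qed.

Lemma cone_functor_cone_incl :
  (cone_functor_cone : @hom (complex_category B) (cone_functor (cone f)) (cone Ff))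
    ∘ fmap cone_functor (cone_incl f : @hom (complex_category A) Y (cone f)) ≈
  cone_incl Ff.
Proof.
move=> n; apply: cone_ext; chain_cbn; cbn [cone_functor_cone fmap cone_functor cmap];
  chain_cbn; cone_simp; rewrite ?cone_fst_incl ?cone_snd_incl.
  by apply: (@cone_ext _ _ _ (nat_chain X)); cone_simp;
    rewrite compose_assoc -fmap_comp cone_fst_incl ?(additive0 Sadd)
      ?(additive0 Tadd) compose0l compose0r ?hopp0.
apply: cone_ext; cone_simp;
  rewrite compose_assoc -fmap_comp cone_snd_incl fmap_id compose_idl;
  exact: symmetry (compose_idr _).
Qed.

Lemma cone_functor_cone_proj :
  (cone_proj Ff : @hom (complex_category B) (cone Ff) (shift_functor B (cone_functor X)))
    ∘ cone_functor_cone ≈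
  cone_functor_shift X ∘
    fmap cone_functor (cone_proj f : @hom (complex_category A) _ (shift_functor A X)).
Proof.
move=> n.
change (cone_fst Ff n ∘ cone_functor_cone n ≈
  cone_shift_chain X n ∘ cone_pair (nat_chain (complex_shift X))
    (fmap S (cone_fst f (n + 1)) ∘ cone_fst (nat_chain (cone f)) n)
    (fmap T (cone_fst f n) ∘ cone_snd (nat_chain (cone f)) n)).
cbn [cone_functor_cone cmap cone_shift_chain]; cone_simp.
by apply: (@cone_ext _ _ _ (nat_chain X)); cone_simp.
Qed.

End ConeOfCone.

Hypothesis Sq : forall (X Y : complex_category A) (f : hom X Y), quasi_iso f ->
  quasi_iso (map_chain Sadd f : @hom (complex_category B) _ _).
Hypothesis Tq : forall (X Y : complex_category A) (f : hom X Y), quasi_iso f ->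
  quasi_iso (map_chain Tadd f : @hom (complex_category B) _ _).

Lemma cone_functor_exact :
  exists s, @is_exact (derived A) (derived B)
    (loc_functor (cone_functor_quasi_iso Sq Tq)) s.
Proof.
apply: (@derived_exact A B cone_functor (cone_functor_quasi_iso Sq Tq)
  cone_functor_shift cone_functor_cone).
- exact: cone_functor_shift_iso.
- exact: cone_functor_cone_iso.
- exact: cone_functor_cone_incl.
- exact: cone_functor_cone_proj.
Qed.

End ConeFunctor.
End Additive.

(** * Iterated cones *)

Section DoubleCone.
Local Open Scope ring_scope.
Variables A B C : abelian.
Variables (S T : functor A B) (Sadd : is_additive S) (Tadd : is_additive T).
Variables (U V : functor B C) (Uadd : is_additive U) (Vadd : is_additive V).
Variables (u : nat_trans S T) (v : nat_trans U V).

Definition dcone (X : complex A) : complex C :=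
  cone (nat_chain Uadd Vadd v (cone (nat_chain Sadd Tadd u X))).

Section Components.
Variable X : complex A.
Let c := nat_chain Sadd Tadd u X.
Let d := nat_chain Uadd Vadd v (cone c).

(** The suffix names first the outer functor, [U] or [V], then the inner one, [S] or [T].
    Calculations below refer to these four coordinates and to the effect of the differential on
    them. *)
Definition dcone_us (n : int) : hom (dcone X n) (U (S (X (n + 1 + 1)))) :=
  fmap U (cone_fst c (n + 1)) ∘ cone_fst d n.
Definition dcone_ut (n : int) : hom (dcone X n) (U (T (X (n + 1)))) :=
  fmap U (cone_snd c (n + 1)) ∘ cone_fst d n.
Definition dcone_vs (n : int) : hom (dcone X n) (V (S (X (n + 1)))) :=
  fmap V (cone_fst c n) ∘ cone_snd d n.
Definition dcone_vt (n : int) : hom (dcone X n) (V (T (X n))) :=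
  fmap V (cone_snd c n) ∘ cone_snd d n.

Definition dcone_tuple (n : int) (t : C) (a : hom t (U (S (X (n + 1 + 1)))))
    (b : hom t (U (T (X (n + 1))))) (a' : hom t (V (S (X (n + 1)))))
    (b' : hom t (V (T (X n)))) : hom t (dcone X n) :=
  cone_pair d ((fmap U (cone_inl c (n + 1)) ∘ a) ⊕ (fmap U (cone_inr c (n + 1)) ∘ b))
    ((fmap V (cone_inl c n) ∘ a') ⊕ (fmap V (cone_inr c n) ∘ b')).

Section Tuple.
Variables (n : int) (t : C).
Variables (a : hom t (U (S (X (n + 1 + 1))))) (b : hom t (U (T (X (n + 1))))).
Variables (a' : hom t (V (S (X (n + 1))))) (b' : hom t (V (T (X n)))).

Lemma dcone_us_tuple : dcone_us n ∘ dcone_tuple a b a' b' ≈ a.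
Proof.
rewrite -compose_assoc cone_fst_pair compose_addr !compose_assoc.
rewrite map_cone_fst_inl (map_cone_fst_inr Uadd).
by rewrite compose_idl compose0l hadd0r.
Qed.

Lemma dcone_ut_tuple : dcone_ut n ∘ dcone_tuple a b a' b' ≈ b.
Proof.
rewrite -compose_assoc cone_fst_pair compose_addr !compose_assoc.
rewrite (map_cone_snd_inl Uadd) map_cone_snd_inr.
by rewrite compose_idl compose0l hadd0.
Qed.

Lemma dcone_vs_tuple : dcone_vs n ∘ dcone_tuple a b a' b' ≈ a'.
Proof.
rewrite -compose_assoc cone_snd_pair compose_addr !compose_assoc.
rewrite map_cone_fst_inl (map_cone_fst_inr Vadd).
by rewrite compose_idl compose0l hadd0r.
Qed.

Lemma dcone_vt_tuple : dcone_vt n ∘ dcone_tuple a b a' b' ≈ b'.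
Proof.
rewrite -compose_assoc cone_snd_pair compose_addr !compose_assoc.
rewrite (map_cone_snd_inl Vadd) map_cone_snd_inr.
by rewrite compose_idl compose0l hadd0.
Qed.

End Tuple.

Lemma dcone_eta (n : int) :
  dcone_tuple (dcone_us n) (dcone_ut n) (dcone_vs n) (dcone_vt n) ≈ idm _.
Proof.
rewrite /dcone_tuple /dcone_us /dcone_ut /dcone_vs /dcone_vt !compose_assoc.
rewrite -!compose_addl (map_cone_id Uadd) (map_cone_id Vadd).
by apply: cone_ext; cone_simp; rewrite compose_idl compose_idr.
Qed.

Lemma dcone_tuple_comp (n : int) (t t' : C) a b a' b' (f : hom t' t) :
  @dcone_tuple n t a b a' b' ∘ f ≈
  dcone_tuple (a ∘ f) (b ∘ f) (a' ∘ f) (b' ∘ f).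
Proof.
apply: cone_ext; rewrite compose_assoc ?cone_fst_pair ?cone_snd_pair.
  by rewrite compose_addl -!compose_assoc.
by rewrite compose_addl -!compose_assoc.
Qed.

#[export] Instance dcone_tuple_proper (n : int) (t : C) :
  Proper (heq ==> heq ==> heq ==> heq ==> heq) (@dcone_tuple n t).
Proof.
move=> a1 a2 ea b1 b2 eb a1' a2' ea' b1' b2' eb'.
by rewrite /dcone_tuple ea eb ea' eb'.
Qed.

Lemma dcone_ext (n : int) (t : C) (f g : hom t (dcone X n)) :
  dcone_us n ∘ f ≈ dcone_us n ∘ g -> dcone_ut n ∘ f ≈ dcone_ut n ∘ g ->
  dcone_vs n ∘ f ≈ dcone_vs n ∘ g -> dcone_vt n ∘ f ≈ dcone_vt n ∘ g ->
  f ≈ g.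
Proof.
move=> e1 e2 e3 e4; rewrite -(compose_idl f) -(compose_idl g) -dcone_eta.
by rewrite !dcone_tuple_comp e1 e2 e3 e4.
Qed.

(** Each of the two cones contributes a sign on this summand, and the signs cancel. *)
Lemma dcone_us_d (n : int) :
  dcone_us (n + 1) ∘ cdiff (dcone X) n ≈
  fmap U (fmap S (cdiff X (n + 1 + 1))) ∘ dcone_us n.
Proof.
rewrite -compose_assoc cone_fst_d composeNr compose_assoc.
rewrite (map_cone_fst_d Uadd) composeNl hoppK -!compose_assoc; reflexivity.
Qed.

Lemma dcone_ut_d (n : int) :
  dcone_ut (n + 1) ∘ cdiff (dcone X) n ≈
  ⊖ ((fmap U (u (X (n + 1 + 1))) ∘ dcone_us n) ⊕
     (fmap U (fmap T (cdiff X (n + 1))) ∘ dcone_ut n)).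
Proof.
rewrite -compose_assoc cone_fst_d composeNr compose_assoc.
rewrite (map_cone_snd_d Uadd) compose_addl -!compose_assoc; reflexivity.
Qed.

Lemma dcone_vs_d (n : int) :
  dcone_vs (n + 1) ∘ cdiff (dcone X) n ≈
  (v (S (X (n + 1 + 1))) ∘ dcone_us n) ⊕
  ⊖ (fmap V (fmap S (cdiff X (n + 1))) ∘ dcone_vs n).
Proof.
rewrite -compose_assoc cone_snd_d compose_addr !compose_assoc.
rewrite (map_cone_fst_d Vadd) composeNl -naturality -!compose_assoc; reflexivity.
Qed.

Lemma dcone_vt_d (n : int) :
  dcone_vt (n + 1) ∘ cdiff (dcone X) n ≈
  (v (T (X (n + 1))) ∘ dcone_ut n) ⊕
  ((fmap V (u (X (n + 1))) ∘ dcone_vs n) ⊕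
   (fmap V (fmap T (cdiff X n)) ∘ dcone_vt n)).
Proof.
rewrite -compose_assoc cone_snd_d compose_addr !compose_assoc.
rewrite (map_cone_snd_d Vadd) compose_addl -naturality -!compose_assoc; reflexivity.
Qed.

End Components.
#[global] Typeclasses Opaque dcone_us dcone_ut dcone_vs dcone_vt dcone_tuple.

Section Functoriality.
Variables (X Y : complex A) (f : chain_map X Y) (n : int).
Let Ff : chain_map (dcone X) (dcone Y) :=
  fmap (functor_comp (cone_functor Uadd Vadd v) (cone_functor Sadd Tadd u))
    (f : @hom (complex_category A) X Y).

Lemma dcone_us_map :
  dcone_us Y n ∘ Ff n ≈ fmap U (fmap S (f (n + 1 + 1))) ∘ dcone_us X n.
Proof.
rewrite -compose_assoc cone_fst_pair !compose_assoc -!fmap_comp.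
by rewrite [X in fmap U X]cone_fst_pair.
Qed.

Lemma dcone_ut_map :
  dcone_ut Y n ∘ Ff n ≈ fmap U (fmap T (f (n + 1))) ∘ dcone_ut X n.
Proof.
rewrite -compose_assoc cone_fst_pair !compose_assoc -!fmap_comp.
by rewrite [X in fmap U X]cone_snd_pair.
Qed.

Lemma dcone_vs_map :
  dcone_vs Y n ∘ Ff n ≈ fmap V (fmap S (f (n + 1))) ∘ dcone_vs X n.
Proof.
rewrite -compose_assoc cone_snd_pair !compose_assoc -!fmap_comp.
by rewrite [X in fmap V X]cone_fst_pair.
Qed.

Lemma dcone_vt_map :
  dcone_vt Y n ∘ Ff n ≈ fmap V (fmap T (f n)) ∘ dcone_vt X n.
Proof.
rewrite -compose_assoc cone_snd_pair !compose_assoc -!fmap_comp.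
by rewrite [X in fmap V X]cone_snd_pair.
Qed.

End Functoriality.

End DoubleCone.

(** Explicit congruence: setoid rewriting is slow when the goal involves objects
    of several degrees of a complex. *)
Ltac congruence_at l e t :=
  lazymatch t with
  | l => e
  | ?f ⊕ ?g =>
      let p := congruence_at l e f in let q := congruence_at l e g in
      constr:(hadd_proper p q)
  | ⊖ ?f => let p := congruence_at l e f in constr:(hopp_proper p)
  | ?g ∘ ?f =>
      let p := congruence_at l e g in let q := congruence_at l e f in
      constr:(compose_proper p q)
  | _ => constr:(reflexivity t : t ≈ t)
  end.

Ltac rewrite_subterm l e :=
  let E := fresh "E" in pose proof (e : l ≈ _) as E;
  match goal with |- ?a ≈ ?b =>
    let p := congruence_at l E a in let q := congruence_at l E b in
    refine (transitivity p (transitivity _ (symmetry q)))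
  end; clear E.

Ltac dcone_simp :=
  repeat match goal with |- context [?l] =>
    match l with
    | (?h ∘ ?g) ∘ ?f => rewrite_subterm l (symmetry (compose_assoc h g f))
    | dcone_us ?a ?b ?c ?d ?e ?f ?X ?n ∘ dcone_tuple _ _ _ _ _ _ ?p ?q ?r ?s =>
        rewrite_subterm l (dcone_us_tuple a b c d e f p q r s)
    | dcone_us ?a ?b ?c ?d ?e ?f ?X ?n ∘ (dcone_tuple _ _ _ _ _ _ ?p ?q ?r ?s ∘ ?h) =>
        rewrite_subterm l (comp_eq h (dcone_us_tuple a b c d e f p q r s))
    | dcone_us ?a ?b ?c ?d ?e ?f ?X _ ∘ (cdiff _ ?n ∘ ?h) =>
        rewrite_subterm l (comp_eq h (dcone_us_d a b c d e f X n))
    | dcone_us ?a ?b ?c ?d ?e ?f ?X _ ∘ cdiff _ ?n =>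
        rewrite_subterm l (dcone_us_d a b c d e f X n)
    | dcone_ut ?a ?b ?c ?d ?e ?f ?X ?n ∘ dcone_tuple _ _ _ _ _ _ ?p ?q ?r ?s =>
        rewrite_subterm l (dcone_ut_tuple a b c d e f p q r s)
    | dcone_ut ?a ?b ?c ?d ?e ?f ?X ?n ∘ (dcone_tuple _ _ _ _ _ _ ?p ?q ?r ?s ∘ ?h) =>
        rewrite_subterm l (comp_eq h (dcone_ut_tuple a b c d e f p q r s))
    | dcone_ut ?a ?b ?c ?d ?e ?f ?X _ ∘ (cdiff _ ?n ∘ ?h) =>
        rewrite_subterm l (comp_eq h (dcone_ut_d a b c d e f X n))
    | dcone_ut ?a ?b ?c ?d ?e ?f ?X _ ∘ cdiff _ ?n =>
        rewrite_subterm l (dcone_ut_d a b c d e f X n)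
    | dcone_vs ?a ?b ?c ?d ?e ?f ?X ?n ∘ dcone_tuple _ _ _ _ _ _ ?p ?q ?r ?s =>
        rewrite_subterm l (dcone_vs_tuple a b c d e f p q r s)
    | dcone_vs ?a ?b ?c ?d ?e ?f ?X ?n ∘ (dcone_tuple _ _ _ _ _ _ ?p ?q ?r ?s ∘ ?h) =>
        rewrite_subterm l (comp_eq h (dcone_vs_tuple a b c d e f p q r s))
    | dcone_vs ?a ?b ?c ?d ?e ?f ?X _ ∘ (cdiff _ ?n ∘ ?h) =>
        rewrite_subterm l (comp_eq h (dcone_vs_d a b c d e f X n))
    | dcone_vs ?a ?b ?c ?d ?e ?f ?X _ ∘ cdiff _ ?n =>
        rewrite_subterm l (dcone_vs_d a b c d e f X n)
    | dcone_vt ?a ?b ?c ?d ?e ?f ?X ?n ∘ dcone_tuple _ _ _ _ _ _ ?p ?q ?r ?s =>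
        rewrite_subterm l (dcone_vt_tuple a b c d e f p q r s)
    | dcone_vt ?a ?b ?c ?d ?e ?f ?X ?n ∘ (dcone_tuple _ _ _ _ _ _ ?p ?q ?r ?s ∘ ?h) =>
        rewrite_subterm l (comp_eq h (dcone_vt_tuple a b c d e f p q r s))
    | dcone_vt ?a ?b ?c ?d ?e ?f ?X _ ∘ (cdiff _ ?n ∘ ?h) =>
        rewrite_subterm l (comp_eq h (dcone_vt_d a b c d e f X n))
    | dcone_vt ?a ?b ?c ?d ?e ?f ?X _ ∘ cdiff _ ?n =>
        rewrite_subterm l (dcone_vt_d a b c d e f X n)
    | ?h ∘ (?f ⊕ ?g) => rewrite_subterm l (compose_addr h f g)
    | (?f ⊕ ?g) ∘ ?h => rewrite_subterm l (compose_addl f g h)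
    | ?h ∘ ⊖ ?f => rewrite_subterm l (composeNr h f)
    | (⊖ ?f) ∘ ?h => rewrite_subterm l (composeNl f h)
    | ?h ∘ @hzero _ ?x ?y => rewrite_subterm l (@compose0r _ x y _ h)
    | @hzero _ ?x ?y ∘ ?h => rewrite_subterm l (@compose0l _ _ x y h)
    end end.

Ltac cat_rewrite e :=
  lazymatch type of e with ?l ≈ _ => rewrite_subterm l e end.

Section Decomposition.
Local Open Scope ring_scope.
Variables A B C : abelian.
Variables (S T : functor A B) (Sadd : is_additive S) (Tadd : is_additive T).
Variables (U V : functor B C) (Uadd : is_additive U) (Vadd : is_additive V).
Variables (u : nat_trans S T) (v : nat_trans U V).
Variables (X : complex A) (n : int).

Local Notation tuple := (dcone_tuple Sadd Tadd Uadd Vadd u v (X := X) (n := n)).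

Definition dcone_in_us := tuple (idm (U (S (X (n + 1 + 1))))) hzero hzero hzero.
Definition dcone_in_ut := tuple hzero (idm (U (T (X (n + 1))))) hzero hzero.
Definition dcone_in_vs := tuple hzero hzero (idm (V (S (X (n + 1))))) hzero.
Definition dcone_in_vt := tuple hzero hzero hzero (idm (V (T (X n)))).

Lemma dcone_tuple_split (t : C) a b a' b' :
  tuple (t := t) a b a' b' ≈
  (tuple a hzero hzero hzero ⊕ tuple hzero b hzero hzero) ⊕
  (tuple hzero hzero a' hzero ⊕ tuple hzero hzero hzero b').
Proof. by apply: dcone_ext; dcone_simp; abel. Qed.

Lemma dcone_decomposition :
  idm (dcone Sadd Tadd Uadd Vadd u v X n) ≈
  ((dcone_in_us ∘ dcone_us Sadd Tadd Uadd Vadd u v X n) ⊕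
   (dcone_in_ut ∘ dcone_ut Sadd Tadd Uadd Vadd u v X n)) ⊕
  ((dcone_in_vs ∘ dcone_vs Sadd Tadd Uadd Vadd u v X n) ⊕
   (dcone_in_vt ∘ dcone_vt Sadd Tadd Uadd Vadd u v X n)).
Proof.
by rewrite !dcone_tuple_comp !compose_idl !compose0l -dcone_tuple_split dcone_eta.
Qed.

End Decomposition.

Lemma fmap_comp_eq (C D : category) (F : functor C D) (x y z : C)
    (g : hom y z) (f : hom x y) (h : hom x z) :
  g ∘ f ≈ h -> fmap F g ∘ fmap F f ≈ fmap F h.
Proof. by move=> <-; rewrite fmap_comp. Qed.

(** Once one of the four terms of an iterated cone vanishes, equalities can be tested on the other
    three coordinates. *)
Lemma jointly_monic3 (A : preadditive) (x y1 y2 y3 : A)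
    (i1 : hom y1 x) (p1 : hom x y1) (i2 : hom y2 x) (p2 : hom x y2)
    (i3 : hom y3 x) (p3 : hom x y3) :
  (i1 ∘ p1) ⊕ ((i2 ∘ p2) ⊕ (i3 ∘ p3)) ≈ idm x ->
  forall (t : A) (f g : hom t x),
    p1 ∘ f ≈ p1 ∘ g -> p2 ∘ f ≈ p2 ∘ g -> p3 ∘ f ≈ p3 ∘ g -> f ≈ g.
Proof.
move=> e t f g e1 e2 e3; rewrite -(compose_idl f) -(compose_idl g) -e.
by rewrite !compose_addl -!compose_assoc e1 e2 e3.
Qed.

(** * A comparison map from the shift to an iterated cone *)

Section Unit.
Local Open Scope ring_scope.
Variables A B : abelian.
Variables (S T : functor A B) (Sadd : is_additive S) (Tadd : is_additive T).
Variables (U V : functor B A) (Uadd : is_additive U) (Vadd : is_additive V).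
Variables (u : nat_trans S T) (v : nat_trans U V).
Variables (eta : forall X : A, hom X (U (T X))).
Variables (eps : forall X : A, hom X (V (S X))).
Hypothesis eta_nat : forall (X Y : A) (f : hom X Y),
  eta Y ∘ f ≈ fmap U (fmap T f) ∘ eta X.
Hypothesis eps_nat : forall (X Y : A) (f : hom X Y),
  eps Y ∘ f ≈ fmap V (fmap S f) ∘ eps X.
Hypothesis eta_eps : forall X : A, v (T X) ∘ eta X ≈ fmap V (u X) ∘ eps X.

Notation DC X := (dcone Sadd Tadd Uadd Vadd u v X).
Notation us X := (dcone_us Sadd Tadd Uadd Vadd u v X).
Notation ut X := (dcone_ut Sadd Tadd Uadd Vadd u v X).
Notation vs X := (dcone_vs Sadd Tadd Uadd Vadd u v X).
Notation vt X := (dcone_vt Sadd Tadd Uadd Vadd u v X).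

(** With the sign on [eps], the [V (T _)] coordinate of the differential becomes the difference of
    the two sides of [eta_eps], hence zero. *)
Definition dcone_unit_at (X : complex A) (n : int) : hom (X (n + 1)) (DC X n) :=
  dcone_tuple Sadd Tadd Uadd Vadd u v
    hzero (eta (X (n + 1))) (⊖ eps (X (n + 1))) hzero.

Lemma dcone_unit_comm (X : complex A) (n : int) :
  dcone_unit_at X (n + 1) ∘ (⊖ cdiff X (n + 1)) ≈
  cdiff (DC X) n ∘ dcone_unit_at X n.
Proof.
rewrite /dcone_unit_at; apply: dcone_ext; dcone_simp.
- exact: hopp0.
- rewrite eta_nat; abel.
- rewrite eps_nat; abel.
- cat_rewrite (eta_eps (X (n + 1))); abel.
Qed.

Definition dcone_unit_chain (X : complex A) : chain_map (complex_shift X) (DC X) :=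
  @ChainMap A (complex_shift X) (DC X) (dcone_unit_at X) (dcone_unit_comm X).

Program Definition dcone_unit :
    nat_trans (shift_functor A)
      (functor_comp (cone_functor Uadd Vadd v) (cone_functor Sadd Tadd u)) :=
  {| component := dcone_unit_chain |}.
Next Obligation.
move=> X Y f n.
change (dcone_unit_at Y n ∘ f (n + 1) ≈
  (fmap (functor_comp (cone_functor Uadd Vadd v) (cone_functor Sadd Tadd u)) f
   : chain_map (DC X) (DC Y)) n ∘ dcone_unit_at X n).
rewrite /dcone_unit_at; apply: dcone_ext.
- rewrite (comp_eq _ (dcone_us_map _ _ _ _ _ _ _ _)); dcone_simp. reflexivity.
- rewrite (comp_eq _ (dcone_ut_map _ _ _ _ _ _ _ _)); dcone_simp; exact: eta_nat.
- rewrite (comp_eq _ (dcone_vs_map _ _ _ _ _ _ _ _)); dcone_simp.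
  apply: hopp_proper; exact: eps_nat.
- rewrite (comp_eq _ (dcone_vt_map _ _ _ _ _ _ _ _)); dcone_simp; reflexivity.
Qed.

(** After applying [E], the summand [U (S X)] vanishes, and [lam] provides the
    homotopy that cancels [V (T X)] against a summand of [U (T X)]. *)
Section UnitQuasiIso.
Variables (A' : abelian) (E : functor A A') (Eadd : is_additive E).
Variables (kappa : forall X : A, hom (E (U (T X))) (E X)).
Variables (mu : forall X : A, hom (E (V (S X))) (E X)).
Variables (lam : forall X : A, hom (E (V (T X))) (E (U (T X)))).
Hypothesis kappa_nat : forall (X Y : A) (f : hom X Y),
  kappa Y ∘ fmap E (fmap U (fmap T f)) ≈ fmap E f ∘ kappa X.
Hypothesis mu_nat : forall (X Y : A) (f : hom X Y),
  mu Y ∘ fmap E (fmap V (fmap S f)) ≈ fmap E f ∘ mu X.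
Hypothesis lam_nat : forall (X Y : A) (f : hom X Y),
  lam Y ∘ fmap E (fmap V (fmap T f)) ≈ fmap E (fmap U (fmap T f)) ∘ lam X.
Hypothesis us0 : forall X : A, idm (E (U (S X))) ≈ hzero.
Hypothesis retract : forall X : A,
  (kappa X ∘ fmap E (eta X)) ⊕ (mu X ∘ fmap E (eps X)) ≈ idm (E X).
Hypothesis eta_kappa : forall X : A,
  (fmap E (eta X) ∘ kappa X) ⊕ (lam X ∘ fmap E (v (T X))) ≈ idm _.
Hypothesis eta_mu : forall X : A,
  fmap E (eta X) ∘ mu X ≈ lam X ∘ fmap E (fmap V (u X)).
Hypothesis eps_kappa : forall X : A, fmap E (eps X) ∘ kappa X ≈ hzero.
Hypothesis eps_mu : forall X : A, fmap E (eps X) ∘ mu X ≈ idm _.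
Hypothesis v_lam : forall X : A, fmap E (v (T X)) ∘ lam X ≈ idm _.

Variable X : complex A.

Let unit_ut (n : int) := fmap E (ut X n).
Let unit_vs (n : int) := fmap E (vs X n).
Let unit_vt (n : int) := fmap E (vt X n).
Let unit_d (n : int) := fmap E (cdiff (DC X) n).
Let unit_in (n : int) : hom (E (U (T (X (n + 1))))) (E (DC X n)) :=
  fmap E (dcone_in_ut Sadd Tadd Uadd Vadd u v X n).

Lemma unit_us0 (x y : A) (Z : A) (f : hom (U (S Z)) y) (g : hom x (U (S Z))) :
  fmap E (f ∘ g) ≈ hzero.
Proof.
by rewrite fmap_comp -(compose_idr (fmap E f)) us0 compose0r compose0l.
Qed.

Lemma unit_ut_d (n : int) :
  unit_ut (n + 1) ∘ unit_d n ≈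
  ⊖ (fmap E (fmap U (fmap T (cdiff X (n + 1)))) ∘ unit_ut n).
Proof.
rewrite /unit_ut /unit_d -!fmap_comp dcone_ut_d (additiveN Eadd) Eadd unit_us0.
by rewrite hadd0.
Qed.

Lemma unit_vs_d (n : int) :
  unit_vs (n + 1) ∘ unit_d n ≈
  ⊖ (fmap E (fmap V (fmap S (cdiff X (n + 1)))) ∘ unit_vs n).
Proof.
rewrite /unit_vs /unit_d -!fmap_comp dcone_vs_d Eadd unit_us0 (additiveN Eadd).
by rewrite hadd0.
Qed.

Lemma unit_vt_d (n : int) :
  unit_vt (n + 1) ∘ unit_d n ≈
  (fmap E (v (T (X (n + 1)))) ∘ unit_ut n) ⊕
  ((fmap E (fmap V (u (X (n + 1)))) ∘ unit_vs n) ⊕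
   (fmap E (fmap V (fmap T (cdiff X n))) ∘ unit_vt n)).
Proof. by rewrite -!fmap_comp -!Eadd; apply: fmap_proper; exact: dcone_vt_d. Qed.

Lemma unit_ext (n : int) (t : A') (f g : hom t (E (DC X n))) :
  unit_ut n ∘ f ≈ unit_ut n ∘ g -> unit_vs n ∘ f ≈ unit_vs n ∘ g ->
  unit_vt n ∘ f ≈ unit_vt n ∘ g -> f ≈ g.
Proof.
apply: (@jointly_monic3 A' _ _ _ _ (fmap E (dcone_in_ut Sadd Tadd Uadd Vadd u v X n))
  _ (fmap E (dcone_in_vs Sadd Tadd Uadd Vadd u v X n)) _
  (fmap E (dcone_in_vt Sadd Tadd Uadd Vadd u v X n))).
rewrite -!fmap_comp -fmap_id dcone_decomposition !Eadd unit_us0 hadd0.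
reflexivity.
Qed.

Lemma unit_ut_in (n : int) : unit_ut n ∘ unit_in n ≈ idm _.
Proof.
apply: transitivity (fmap_comp_eq E (dcone_ut_tuple _ _ _ _ _ _ _ _ _ _)) _.
exact: fmap_id.
Qed.
Lemma unit_vs_in (n : int) : unit_vs n ∘ unit_in n ≈ hzero.
Proof.
apply: transitivity (fmap_comp_eq E (dcone_vs_tuple _ _ _ _ _ _ _ _ _ _)) _.
exact: additive0.
Qed.
Lemma unit_vt_in (n : int) : unit_vt n ∘ unit_in n ≈ hzero.
Proof.
apply: transitivity (fmap_comp_eq E (dcone_vt_tuple _ _ _ _ _ _ _ _ _ _)) _.
exact: additive0.
Qed.

Let unit_f (n : int) := fmap E (dcone_unit_at X n).

Lemma unit_ut_f (n : int) : unit_ut n ∘ unit_f n ≈ fmap E (eta (X (n + 1))).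
Proof. exact: fmap_comp_eq (dcone_ut_tuple _ _ _ _ _ _ _ _ _ _). Qed.
Lemma unit_vs_f (n : int) : unit_vs n ∘ unit_f n ≈ ⊖ fmap E (eps (X (n + 1))).
Proof.
apply: transitivity (fmap_comp_eq E (dcone_vs_tuple _ _ _ _ _ _ _ _ _ _)) _.
exact: additiveN.
Qed.
Lemma unit_vt_f (n : int) : unit_vt n ∘ unit_f n ≈ hzero.
Proof.
apply: transitivity (fmap_comp_eq E (dcone_vt_tuple _ _ _ _ _ _ _ _ _ _)) _.
exact: additive0.
Qed.

Let unit_g (n : int) : hom (E (DC X n)) (E (X (n + 1))) :=
  (kappa (X (n + 1)) ∘ unit_ut n) ⊕ ⊖ (mu (X (n + 1)) ∘ unit_vs n).

Lemma unit_g_comm (n : int) :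
  unit_g (n + 1) ∘ unit_d n ≈ fmap E (⊖ cdiff X (n + 1)) ∘ unit_g n.
Proof.
rewrite /unit_g compose_addl composeNl -!compose_assoc unit_ut_d unit_vs_d.
rewrite (additiveN Eadd) !composeNr !compose_assoc kappa_nat mu_nat.
rewrite compose_addr composeNr !composeNl !compose_assoc; abel.
Qed.

(** The term [V (T _)] of degree [n + 1] and the term [U (T _)] of degree [n] both involve
    [X (n + 1)], so [lam] between them has the degree of a homotopy. *)
Let unit_h (n : int) : hom (E (DC X (n + 1))) (E (DC X n)) :=
  unit_in n ∘ (lam (X (n + 1)) ∘ unit_vt (n + 1)).

Lemma unit_gf (n : int) : unit_g n ∘ unit_f n ≈ idm _.
Proof.
rewrite /unit_g compose_addl composeNl -!compose_assoc unit_ut_f unit_vs_f.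
by rewrite composeNr hoppK retract.
Qed.

Lemma unit_homotopy (n : int) :
  idm (E (DC X (n + 1))) ≈ (unit_f (n + 1) ∘ unit_g (n + 1)) ⊕
    ((unit_d n ∘ unit_h n) ⊕ (unit_h (n + 1) ∘ unit_d (n + 1))).
Proof.
apply: unit_ext; rewrite compose_idr (compose_addr _ (unit_f _ ∘ unit_g _))
  (compose_addr _ (unit_d n ∘ unit_h n)).
- rewrite (comp_eq _ (unit_ut_f _)) (comp_eq _ (unit_ut_d _)) /unit_h.
  rewrite -!compose_assoc (comp_eq _ (unit_ut_in _)) unit_vt_d.
  rewrite composeNl -!compose_assoc (comp_eq _ (unit_ut_in _)) !compose_idl.
  rewrite /unit_g !compose_addr !composeNr !compose_assoc lam_nat -eta_mu.
  (* [eta_kappa] splits the coordinate [unit_ut] into the part recovered by [unit_f ∘ unit_g] and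
     the part contracted by [unit_h]. *)
  have ek := compose_addl (fmap E (eta (X (n + 1 + 1))) ∘ kappa (X (n + 1 + 1)))
    (lam (X (n + 1 + 1)) ∘ fmap E (v (T (X (n + 1 + 1))))) (unit_ut (n + 1)).
  move: ek; rewrite eta_kappa compose_idl => ek.
  rewrite {1}ek; abel.
- rewrite (comp_eq _ (unit_vs_f _)) (comp_eq _ (unit_vs_d _)) /unit_h.
  rewrite !composeNl -!compose_assoc !(comp_eq _ (unit_vs_in _)).
  rewrite !compose0l compose0r hopp0 /unit_g compose_addr composeNr.
  rewrite !compose_assoc eps_kappa eps_mu compose0l compose_idl; abel.
rewrite (comp_eq _ (unit_vt_f _)) (comp_eq _ (unit_vt_d _)) /unit_h.
rewrite !compose_addl -!compose_assoc (comp_eq _ (unit_ut_in _)).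
rewrite (comp_eq _ (unit_vs_in _)) !(comp_eq _ (unit_vt_in _)).
rewrite !compose0l !compose0r compose_idl compose_assoc v_lam compose_idl; abel.
Qed.

Lemma dcone_unit_quasi_iso :
  quasi_iso (map_chain Eadd (dcone_unit_chain X) :
    @hom (complex_category A') (map_complex Eadd (complex_shift X))
      (map_complex Eadd (DC X))).
Proof.
apply: (@homotopy_quasi_iso A' (map_complex Eadd (complex_shift X))
  (map_complex Eadd (DC X)) _
  (@ChainMap A' (map_complex Eadd (DC X)) (map_complex Eadd (complex_shift X))
    unit_g unit_g_comm) unit_h); [exact: unit_gf | exact: unit_homotopy].
Qed.

End UnitQuasiIso.

End Unit.

(** * A comparison map from an iterated cone to the shift *)

Section Counit.
Local Open Scope ring_scope.
Variables A B : abelian.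
Variables (S T : functor A B) (Sadd : is_additive S) (Tadd : is_additive T).
Variables (U V : functor B A) (Uadd : is_additive U) (Vadd : is_additive V).
Variables (u : nat_trans S T) (v : nat_trans U V).
Variables (kappa : forall X : A, hom (U (T X)) X).
Variables (mu : forall X : A, hom (V (S X)) X).
Hypothesis kappa_nat : forall (X Y : A) (f : hom X Y),
  kappa Y ∘ fmap U (fmap T f) ≈ f ∘ kappa X.
Hypothesis mu_nat : forall (X Y : A) (f : hom X Y),
  mu Y ∘ fmap V (fmap S f) ≈ f ∘ mu X.
Hypothesis kappa_mu : forall X : A, kappa X ∘ fmap U (u X) ≈ mu X ∘ v (S X).

Notation DC X := (dcone Sadd Tadd Uadd Vadd u v X).
Notation us X := (dcone_us Sadd Tadd Uadd Vadd u v X).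
Notation ut X := (dcone_ut Sadd Tadd Uadd Vadd u v X).
Notation vs X := (dcone_vs Sadd Tadd Uadd Vadd u v X).
Notation vt X := (dcone_vt Sadd Tadd Uadd Vadd u v X).

(** No sign on [mu] this time: the differential sends the term [U (S _)] into the other two
    coordinates with opposite signs already, and the contributions cancel by [kappa_mu]. *)
Definition dcone_counit_at (X : complex A) (n : int) : hom (DC X n) (X (n + 1)) :=
  (kappa (X (n + 1)) ∘ ut X n) ⊕ (mu (X (n + 1)) ∘ vs X n).

Lemma dcone_counit_comm (X : complex A) (n : int) :
  dcone_counit_at X (n + 1) ∘ cdiff (DC X) n ≈
  (⊖ cdiff X (n + 1)) ∘ dcone_counit_at X n.
Proof.
rewrite /dcone_counit_at; dcone_simp; rewrite !compose_assoc.
rewrite kappa_nat mu_nat kappa_mu; abel.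
Qed.

Definition dcone_counit_chain (X : complex A) : chain_map (DC X) (complex_shift X) :=
  @ChainMap A (DC X) (complex_shift X) (dcone_counit_at X) (dcone_counit_comm X).

Program Definition dcone_counit :
    nat_trans
      (functor_comp (cone_functor Uadd Vadd v) (cone_functor Sadd Tadd u))
      (shift_functor A) :=
  {| component := dcone_counit_chain |}.
Next Obligation.
move=> X Y f n.
change (dcone_counit_at Y n ∘
  (fmap (functor_comp (cone_functor Uadd Vadd v) (cone_functor Sadd Tadd u)) f
   : chain_map (DC X) (DC Y)) n ≈ f (n + 1) ∘ dcone_counit_at X n).
rewrite /dcone_counit_at compose_addl -(compose_assoc (kappa _)) -(compose_assoc (mu _)).
cat_rewrite (dcone_ut_map Sadd Tadd Uadd Vadd u v f n).
cat_rewrite (dcone_vs_map Sadd Tadd Uadd Vadd u v f n).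
by rewrite compose_addr !compose_assoc kappa_nat mu_nat.
Qed.

(** After applying [E], the summand [V (T X)] vanishes, and [lam] provides the
    homotopy that cancels [U (S X)] against a summand of [V (S X)]. *)
Section CounitQuasiIso.
Variables (A' : abelian) (E : functor A A') (Eadd : is_additive E).
Variables (eta : forall X : A, hom (E X) (E (U (T X)))).
Variables (eps : forall X : A, hom (E X) (E (V (S X)))).
Variables (lam : forall X : A, hom (E (V (S X))) (E (U (S X)))).
Hypothesis eta_nat : forall (X Y : A) (f : hom X Y),
  eta Y ∘ fmap E f ≈ fmap E (fmap U (fmap T f)) ∘ eta X.
Hypothesis eps_nat : forall (X Y : A) (f : hom X Y),
  eps Y ∘ fmap E f ≈ fmap E (fmap V (fmap S f)) ∘ eps X.
Hypothesis lam_nat : forall (X Y : A) (f : hom X Y),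
  lam Y ∘ fmap E (fmap V (fmap S f)) ≈ fmap E (fmap U (fmap S f)) ∘ lam X.
Hypothesis vt0 : forall X : A, idm (E (V (T X))) ≈ hzero.
Hypothesis retract : forall X : A,
  (fmap E (kappa X) ∘ eta X) ⊕ (fmap E (mu X) ∘ eps X) ≈ idm (E X).
Hypothesis lam_v : forall X : A, lam X ∘ fmap E (v (S X)) ≈ idm _.
Hypothesis eta_kappa : forall X : A, eta X ∘ fmap E (kappa X) ≈ idm _.
Hypothesis eta_mu : forall X : A,
  eta X ∘ fmap E (mu X) ≈ fmap E (fmap U (u X)) ∘ lam X.
Hypothesis eps_kappa : forall X : A, eps X ∘ fmap E (kappa X) ≈ hzero.
Hypothesis eps_mu : forall X : A,
  (eps X ∘ fmap E (mu X)) ⊕ (fmap E (v (S X)) ∘ lam X) ≈ idm _.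

Variable X : complex A.

Let c_us (n : int) := fmap E (us X n).
Let c_ut (n : int) := fmap E (ut X n).
Let c_vs (n : int) := fmap E (vs X n).
Let c_d (n : int) := fmap E (cdiff (DC X) n).
Let in_us (n : int) : hom (E (U (S (X (n + 1 + 1))))) (E (DC X n)) :=
  fmap E (dcone_in_us Sadd Tadd Uadd Vadd u v X n).
Let in_ut (n : int) : hom (E (U (T (X (n + 1))))) (E (DC X n)) :=
  fmap E (dcone_in_ut Sadd Tadd Uadd Vadd u v X n).
Let in_vs (n : int) : hom (E (V (S (X (n + 1))))) (E (DC X n)) :=
  fmap E (dcone_in_vs Sadd Tadd Uadd Vadd u v X n).

Lemma counit_vt0 (x y Z : A) (f : hom (V (T Z)) y) (g : hom x (V (T Z))) :
  fmap E (f ∘ g) ≈ hzero.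
Proof.
by rewrite fmap_comp -(compose_idr (fmap E f)) vt0 compose0r compose0l.
Qed.

Lemma counit_us_d (n : int) :
  c_us (n + 1) ∘ c_d n ≈
  fmap E (fmap U (fmap S (cdiff X (n + 1 + 1)))) ∘ c_us n.
Proof.
apply: transitivity (fmap_comp_eq E (dcone_us_d _ _ _ _ _ _ _ _)) _.
exact: fmap_comp.
Qed.

Lemma counit_ut_d (n : int) :
  c_ut (n + 1) ∘ c_d n ≈
  ⊖ ((fmap E (fmap U (u (X (n + 1 + 1)))) ∘ c_us n) ⊕
     (fmap E (fmap U (fmap T (cdiff X (n + 1)))) ∘ c_ut n)).
Proof.
apply: transitivity (fmap_comp_eq E (dcone_ut_d _ _ _ _ _ _ _ _)) _.
by rewrite (additiveN Eadd) Eadd -!fmap_comp.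
Qed.

Lemma counit_vs_d (n : int) :
  c_vs (n + 1) ∘ c_d n ≈
  (fmap E (v (S (X (n + 1 + 1)))) ∘ c_us n) ⊕
  ⊖ (fmap E (fmap V (fmap S (cdiff X (n + 1)))) ∘ c_vs n).
Proof.
apply: transitivity (fmap_comp_eq E (dcone_vs_d _ _ _ _ _ _ _ _)) _.
by rewrite Eadd (additiveN Eadd) -!fmap_comp.
Qed.

Lemma counit_ext (n : int) (t : A') (f g : hom t (E (DC X n))) :
  c_us n ∘ f ≈ c_us n ∘ g -> c_ut n ∘ f ≈ c_ut n ∘ g ->
  c_vs n ∘ f ≈ c_vs n ∘ g -> f ≈ g.
Proof.
apply: (@jointly_monic3 A' _ _ _ _ (fmap E (dcone_in_us Sadd Tadd Uadd Vadd u v X n))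
  _ (fmap E (dcone_in_ut Sadd Tadd Uadd Vadd u v X n)) _
  (fmap E (dcone_in_vs Sadd Tadd Uadd Vadd u v X n))).
rewrite -!fmap_comp haddA -fmap_id dcone_decomposition !Eadd counit_vt0 hadd0r.
reflexivity.
Qed.

Lemma counit_us_us (n : int) : c_us n ∘ in_us n ≈ idm _.
Proof.
apply: transitivity (fmap_comp_eq E (dcone_us_tuple _ _ _ _ _ _ _ _ _ _)) _.
exact: fmap_id.
Qed.
Lemma counit_ut_us (n : int) : c_ut n ∘ in_us n ≈ hzero.
Proof.
apply: transitivity (fmap_comp_eq E (dcone_ut_tuple _ _ _ _ _ _ _ _ _ _)) _.
exact: additive0.
Qed.
Lemma counit_vs_us (n : int) : c_vs n ∘ in_us n ≈ hzero.
Proof.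
apply: transitivity (fmap_comp_eq E (dcone_vs_tuple _ _ _ _ _ _ _ _ _ _)) _.
exact: additive0.
Qed.
Lemma counit_us_ut (n : int) : c_us n ∘ in_ut n ≈ hzero.
Proof.
apply: transitivity (fmap_comp_eq E (dcone_us_tuple _ _ _ _ _ _ _ _ _ _)) _.
exact: additive0.
Qed.
Lemma counit_ut_ut (n : int) : c_ut n ∘ in_ut n ≈ idm _.
Proof.
apply: transitivity (fmap_comp_eq E (dcone_ut_tuple _ _ _ _ _ _ _ _ _ _)) _.
exact: fmap_id.
Qed.
Lemma counit_vs_ut (n : int) : c_vs n ∘ in_ut n ≈ hzero.
Proof.
apply: transitivity (fmap_comp_eq E (dcone_vs_tuple _ _ _ _ _ _ _ _ _ _)) _.
exact: additive0.
Qed.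
Lemma counit_us_vs (n : int) : c_us n ∘ in_vs n ≈ hzero.
Proof.
apply: transitivity (fmap_comp_eq E (dcone_us_tuple _ _ _ _ _ _ _ _ _ _)) _.
exact: additive0.
Qed.
Lemma counit_ut_vs (n : int) : c_ut n ∘ in_vs n ≈ hzero.
Proof.
apply: transitivity (fmap_comp_eq E (dcone_ut_tuple _ _ _ _ _ _ _ _ _ _)) _.
exact: additive0.
Qed.
Lemma counit_vs_vs (n : int) : c_vs n ∘ in_vs n ≈ idm _.
Proof.
apply: transitivity (fmap_comp_eq E (dcone_vs_tuple _ _ _ _ _ _ _ _ _ _)) _.
exact: fmap_id.
Qed.

Let c_g (n : int) := fmap E (dcone_counit_at X n).
Let c_f (n : int) : hom (E (X (n + 1))) (E (DC X n)) :=
  (in_ut n ∘ eta (X (n + 1))) ⊕ (in_vs n ∘ eps (X (n + 1))).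
(** Here the matching terms are [V (S _)] in degree [n + 1] and [U (S _)] in degree [n], both
    involving [X (n + 1 + 1)]. *)
Let c_h (n : int) : hom (E (DC X (n + 1))) (E (DC X n)) :=
  in_us n ∘ (lam (X (n + 1 + 1)) ∘ c_vs (n + 1)).

Lemma counit_us_f (n : int) : c_us n ∘ c_f n ≈ hzero.
Proof.
by rewrite compose_addr !compose_assoc counit_us_ut counit_us_vs !compose0l hadd0.
Qed.
Lemma counit_ut_f (n : int) : c_ut n ∘ c_f n ≈ eta (X (n + 1)).
Proof.
rewrite compose_addr !compose_assoc counit_ut_ut counit_ut_vs compose0l.
by rewrite compose_idl hadd0r.
Qed.
Lemma counit_vs_f (n : int) : c_vs n ∘ c_f n ≈ eps (X (n + 1)).
Proof.
rewrite compose_addr !compose_assoc counit_vs_ut counit_vs_vs compose0l.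
by rewrite compose_idl hadd0.
Qed.
Lemma counit_gE (n : int) :
  c_g n ≈ (fmap E (kappa (X (n + 1))) ∘ c_ut n) ⊕
          (fmap E (mu (X (n + 1))) ∘ c_vs n).
Proof. by rewrite -!fmap_comp -Eadd. Qed.

Lemma counit_f_comm (n : int) :
  c_f (n + 1) ∘ fmap E (⊖ cdiff X (n + 1)) ≈ c_d n ∘ c_f n.
Proof.
apply: counit_ext; rewrite (additiveN Eadd) composeNr composeNr.
- rewrite (comp_eq _ (counit_us_f _)) (comp_eq _ (counit_us_d _)).
  by rewrite -compose_assoc counit_us_f compose0l compose0r hopp0.
- rewrite (comp_eq _ (counit_ut_f _)) (comp_eq _ (counit_ut_d _)).
  rewrite composeNl compose_addl -!compose_assoc counit_us_f counit_ut_f.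
  by rewrite compose0r hadd0 eta_nat.
- rewrite (comp_eq _ (counit_vs_f _)) (comp_eq _ (counit_vs_d _)).
  rewrite compose_addl composeNl -!compose_assoc counit_us_f counit_vs_f.
  by rewrite compose0r hadd0 eps_nat.
Qed.

Lemma counit_gf (n : int) : c_g n ∘ c_f n ≈ idm _.
Proof.
rewrite counit_gE compose_addl -!compose_assoc counit_ut_f counit_vs_f.
exact: retract.
Qed.

Lemma counit_homotopy (n : int) :
  idm (E (DC X (n + 1))) ≈ (c_f (n + 1) ∘ c_g (n + 1)) ⊕
    ((c_d n ∘ c_h n) ⊕ (c_h (n + 1) ∘ c_d (n + 1))).
Proof.
apply: counit_ext; rewrite compose_idr (compose_addr _ (c_f _ ∘ c_g _))
  (compose_addr _ (c_d n ∘ c_h n)).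
- rewrite (comp_eq _ (counit_us_f _)) (comp_eq _ (counit_us_d _)) /c_h.
  rewrite -!compose_assoc !(comp_eq _ (counit_us_us _)) counit_vs_d.
  rewrite !compose_idl compose0l compose_addr composeNr !compose_assoc.
  by rewrite lam_v lam_nat compose_idl; abel.
- rewrite (comp_eq _ (counit_ut_f _)) (comp_eq _ (counit_ut_d _)) /c_h.
  rewrite composeNl !compose_addl -!compose_assoc (comp_eq _ (counit_us_us _)).
  rewrite !(comp_eq _ (counit_ut_us _)) !compose0l compose0r compose_idl counit_gE.
  by rewrite compose_addr !compose_assoc eta_kappa eta_mu compose_idl; abel.
rewrite (comp_eq _ (counit_vs_f _)) (comp_eq _ (counit_vs_d _)) /c_h.
rewrite !compose_addl composeNl -!compose_assoc (comp_eq _ (counit_us_us _)).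
rewrite !(comp_eq _ (counit_vs_us _)) !compose0l compose0r compose_idl counit_gE.
rewrite compose_addr !compose_assoc eps_kappa compose0l.
have em := compose_addl (eps (X (n + 1 + 1)) ∘ fmap E (mu (X (n + 1 + 1))))
  (fmap E (v (S (X (n + 1 + 1)))) ∘ lam (X (n + 1 + 1))) (c_vs (n + 1)).
move: em; rewrite eps_mu compose_idl => em.
by rewrite {1}em; abel.
Qed.

Lemma dcone_counit_quasi_iso :
  quasi_iso (map_chain Eadd (dcone_counit_chain X) :
    @hom (complex_category A') (map_complex Eadd (DC X))
      (map_complex Eadd (complex_shift X))).
Proof.
apply: (@homotopy_quasi_iso_inv A' (map_complex Eadd (complex_shift X))
  (map_complex Eadd (DC X))
  (@ChainMap A' (map_complex Eadd (complex_shift X)) (map_complex Eadd (DC X))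
    c_f counit_f_comm) _ c_h); [exact: counit_gf | exact: counit_homotopy].
Qed.

End CounitQuasiIso.

End Counit.

(** * Finite biproducts *)

Section FiniteBiproducts.
Variables (A : abelian) (I : eqType).
Implicit Types (s : seq I) (N : I -> A).

(** Families live on all of [I] and the list [s] is only the range of summation, so that no subtype
    of members of [Y0] is formed. *)
Fixpoint bigbip s N : A :=
  match s with
  | [::] => zob (ab_zero A)
  | i :: s => bip (ab_biproduct (N i) (bigbip s N))
  end.

Fixpoint bigpair s N (t : A) (f : forall i, hom t (N i)) : hom t (bigbip s N) :=
  match s with
  | [::] => hzero
  | i :: s => bpair (ab_biproduct _ _) (f i) (bigpair s f)
  end.

Fixpoint bigcopair s N (t : A) (f : forall i, hom (N i) t) : hom (bigbip s N) t :=
  match s with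
  | [::] => hzero
  | i :: s => bcopair (ab_biproduct _ _) (f i) (bigcopair s f)
  end.

Fixpoint bigmap s N N' (f : forall i, hom (N i) (N' i)) :
    hom (bigbip s N) (bigbip s N') :=
  match s with
  | [::] => hzero
  | i :: s => bpair (ab_biproduct _ _) (f i ∘ bip_prl _) (bigmap s f ∘ bip_prr _)
  end.

Lemma bigpair_eq s N t (f g : forall i, hom t (N i)) :
  (forall i, i \in s -> f i ≈ g i) -> bigpair s f ≈ bigpair s g.
Proof.
elim: s => [|i s IH] fg //=; rewrite fg ?inE ?eqxx // IH // => j js.
by rewrite fg // inE js orbT.
Qed.

Lemma bigcopair_eq s N t (f g : forall i, hom (N i) t) :
  (forall i, i \in s -> f i ≈ g i) -> bigcopair s f ≈ bigcopair s g.
Proof.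
elim: s => [|i s IH] fg //=; rewrite fg ?inE ?eqxx // IH // => j js.
by rewrite fg // inE js orbT.
Qed.

Lemma bigmap_eq s N N' (f g : forall i, hom (N i) (N' i)) :
  (forall i, f i ≈ g i) -> bigmap s f ≈ bigmap s g.
Proof. by move=> fg; elim: s => [|i s IH] //=; rewrite fg IH. Qed.

Lemma bigpair_comp s N t t' (f : forall i, hom t (N i)) (h : hom t' t) :
  bigpair s f ∘ h ≈ bigpair s (fun i => f i ∘ h).
Proof.
elim: s => [|i s IH] /=; first exact: compose0l.
by rewrite bpair_comp IH.
Qed.

Lemma comp_bigcopair s N t t' (f : forall i, hom (N i) t) (h : hom t t') :
  h ∘ bigcopair s f ≈ bigcopair s (fun i => h ∘ f i).
Proof.
elim: s => [|i s IH] /=; first exact: compose0r.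
by rewrite /bcopair compose_addr !compose_assoc IH.
Qed.

Lemma bigmap_bigpair s N N' t (g : forall i, hom (N i) (N' i))
    (f : forall i, hom t (N i)) :
  bigmap s g ∘ bigpair s f ≈ bigpair s (fun i => g i ∘ f i).
Proof.
elim: s => [|i s IH] /=; first exact: compose0l.
by rewrite bpair_comp -!compose_assoc prl_bpair prr_bpair IH.
Qed.

Lemma bigcopair_bigmap s N N' t (g : forall i, hom (N' i) t)
    (f : forall i, hom (N i) (N' i)) :
  bigcopair s g ∘ bigmap s f ≈ bigcopair s (fun i => g i ∘ f i).
Proof.
elim: s => [|i s IH] /=; first exact: compose0l.
by rewrite bcopair_bpair !compose_assoc IH.
Qed.

Lemma prl_bigmap s (i : I) N N' (f : forall i, hom (N i) (N' i)) t
    (x : hom t (bigbip (i :: s) N)) :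
  bip_prl (ab_biproduct _ _) ∘ (bigmap (i :: s) f ∘ x) ≈
  f i ∘ (bip_prl (ab_biproduct _ _) ∘ x).
Proof. by rewrite /= (comp_eq _ (prl_bpair _ _ _)) compose_assoc. Qed.

Lemma prr_bigmap s (i : I) N N' (f : forall i, hom (N i) (N' i)) t
    (x : hom t (bigbip (i :: s) N)) :
  bip_prr (ab_biproduct _ _) ∘ (bigmap (i :: s) f ∘ x) ≈
  bigmap s f ∘ (bip_prr (ab_biproduct _ _) ∘ x).
Proof. by rewrite /= (comp_eq _ (prr_bpair _ _ _)) compose_assoc. Qed.

Lemma bigmap_comp s N N' N'' (g : forall i, hom (N' i) (N'' i))
    (f : forall i, hom (N i) (N' i)) :
  bigmap s g ∘ bigmap s f ≈ bigmap s (fun i => g i ∘ f i).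
Proof.
elim: s => [|i s IH] /=; first exact: compose0l.
by rewrite bpair_comp -!compose_assoc prl_bpair prr_bpair !compose_assoc IH.
Qed.

Lemma bigmap_id s N : bigmap s (fun i => idm (N i)) ≈ idm (bigbip s N).
Proof.
elim: s => [|i s IH] /=; first by rewrite (zob_terminal (idm _)).
by apply: bpair_eq; rewrite ?prl_bpair ?prr_bpair ?IH compose_idl compose_idr.
Qed.

Lemma bigmap_add s N N' (f g : forall i, hom (N i) (N' i)) :
  bigmap s (fun i => f i ⊕ g i) ≈ bigmap s f ⊕ bigmap s g.
Proof.
elim: s => [|i s IH] /=; first by rewrite hadd0.
by apply: bpair_eq; rewrite compose_addr ?prl_bpair ?prr_bpair ?IH compose_addl.
Qed.

Lemma bigbip0 s N : (forall i, idm (N i) ≈ hzero) -> idm (bigbip s N) ≈ hzero.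
Proof.
move=> N0; elim: s => [|i s IH] /=; first exact: zob_terminal.
by rewrite -bip_id -(compose_idl (bip_prl _)) -(compose_idl (bip_prr _)) N0 IH
  !compose0l !compose0r hadd0.
Qed.

Lemma bigpair0 s N t (f : forall i, hom t (N i)) :
  (forall i, i \in s -> f i ≈ hzero) -> bigpair s f ≈ hzero.
Proof.
move=> f0; rewrite (@bigpair_eq _ _ _ f (fun i => hzero ∘ (hzero : hom t t))).
  by rewrite -bigpair_comp compose0r.
by move=> i /f0 ->; rewrite compose0l.
Qed.

Lemma bigcopair0 s N t (f : forall i, hom (N i) t) :
  (forall i, i \in s -> f i ≈ hzero) -> bigcopair s f ≈ hzero.
Proof.
move=> f0; rewrite (@bigcopair_eq _ _ _ f (fun i => (hzero : hom t t) ∘ hzero)).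
  by rewrite -comp_bigcopair compose0l.
by move=> i /f0 ->; rewrite compose0l.
Qed.

(** The composite is the sum of the [g i ∘ f i] over [s]. *)
Lemma bigcopair_bigpair0 s N t t' (g : forall i, hom (N i) t')
    (f : forall i, hom t (N i)) :
  (forall i, i \in s -> g i ∘ f i ≈ hzero) ->
  bigcopair s g ∘ bigpair s f ≈ hzero.
Proof.
elim: s => [|i s IH] gf /=; first exact: compose0l.
rewrite bcopair_bpair gf ?inE ?eqxx // IH ?hadd0 // => j js.
by rewrite gf // inE js orbT.
Qed.

Lemma bigcopair_bigpair1 s N t t' (g : forall i, hom (N i) t')
    (f : forall i, hom t (N i)) (i : I) :
  uniq s -> i \in s ->
  (forall j, j \in s -> j != i -> g j ∘ f j ≈ hzero) ->
  bigcopair s g ∘ bigpair s f ≈ g i ∘ f i.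
Proof.
elim: s => [//|k s IH] /= /andP[ks us]; rewrite inE bcopair_bpair => iks gf.
have [ki|ki] := eqVneq i k.
  rewrite -{k}ki in ks iks gf *; rewrite bigcopair_bigpair0 ?hadd0r // => j js.
  by apply: gf; rewrite ?inE ?js ?orbT //; apply: contraNneq ks => <-.
rewrite gf ?inE ?eqxx // 1?eq_sym // hadd0; apply: IH => //.
  by rewrite (negbTE ki) in iks.
by move=> j js; apply: gf; rewrite inE js orbT.
Qed.

Section Delta.
Variables (N : I -> A) (e : forall i j, hom (N i) (N j)).

(** [e] is the identity matrix, assembled here from its columns and in the next lemma from its rows;
    the two forms arise from [glue_minus] and [glue_plus] respectively. *)
Lemma bigcopair_bigpair_delta s : uniq s ->
  (forall i, i \in s -> e i i ≈ idm _) ->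
  (forall i j, i \in s -> j \in s -> i != j -> e i j ≈ hzero) ->
  bigcopair s (fun i => bigpair s (e i)) ≈ idm (bigbip s N).
Proof.
elim: s => [|k s IH] /=; first by move=> _ _ _; rewrite (zob_terminal (idm _)).
move=> /andP[ks us] e1 e0.
have nk j : j \in s -> j != k by move=> js; apply: contraNneq ks => <-.
rewrite (@bigpair0 s N _ (e k)); last first.
  move=> j js; apply: e0; rewrite ?inE ?eqxx ?js ?orbT //.
  by rewrite eq_sym nk.
rewrite (@bigcopair_eq _ _ _ _
  (fun i => bip_inr (ab_biproduct (N k) (bigbip s N)) ∘ bigpair s (e i))).
  rewrite -comp_bigcopair IH //; last 2 first.
  - by move=> i si; apply: e1; rewrite inE si orbT.
  - by move=> i j si sj; apply: e0; rewrite inE ?si ?sj orbT.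
  rewrite e1 ?inE ?eqxx // /bcopair /bpair compose0r !compose_idr hadd0r.
  exact: bip_id.
move=> i si; rewrite /bpair e0 ?inE ?eqxx ?si ?orbT ?nk //.
by rewrite compose0r hadd0.
Qed.

Lemma bigpair_bigcopair_delta s : uniq s ->
  (forall i, i \in s -> e i i ≈ idm _) ->
  (forall i j, i \in s -> j \in s -> i != j -> e i j ≈ hzero) ->
  bigpair s (fun j => bigcopair s (fun i => e i j)) ≈ idm (bigbip s N).
Proof.
elim: s => [|k s IH] /=; first by move=> _ _ _; rewrite (zob_terminal (idm _)).
move=> /andP[ks us] e1 e0.
have nk j : j \in s -> j != k by move=> js; apply: contraNneq ks => <-.
rewrite (@bigcopair0 s N _ (fun i => e i k)); last first.
  by move=> j js; apply: e0; rewrite ?inE ?eqxx ?js ?orbT ?nk.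
rewrite (@bigpair_eq _ _ _ _
  (fun j => bigcopair s (fun i => e i j) ∘ bip_prr (ab_biproduct (N k) (bigbip s N)))).
  rewrite -bigpair_comp IH //; last 2 first.
  - by move=> i si; apply: e1; rewrite inE si orbT.
  - by move=> i j si sj; apply: e0; rewrite inE ?si ?sj orbT.
  rewrite e1 ?inE ?eqxx // /bcopair compose0l !compose_idl hadd0r.
  by apply: bpair_eq; rewrite ?prl_bpair ?prr_bpair compose_idr.
move=> j sj; rewrite /bcopair e0 ?inE ?eqxx ?sj ?orbT // 1?eq_sym ?nk //.
by rewrite compose0l hadd0.
Qed.

End Delta.

Section Complexes.
Local Open Scope ring_scope.

Program Definition bigbip_complex s (N : I -> complex A) : complex A :=
  {| cob := fun n => bigbip s (fun i => N i n);
     cdiff := fun n => bigmap s (fun i => cdiff (N i) n) |}.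
Next Obligation.
move=> s N n; rewrite bigmap_comp (bigmap_eq s (fun i => cdiff2 (N i) n)).
elim: s => [|i s IH] //=; rewrite IH.
by apply: bpair_eq; rewrite ?prl_bpair ?prr_bpair compose0l compose0r.
Qed.

Program Definition bigbip_chain s (N N' : I -> complex A)
    (f : forall i, chain_map (N i) (N' i)) :
    chain_map (bigbip_complex s N) (bigbip_complex s N') :=
  {| cmap := fun n => bigmap s (fun i => f i n) |}.
Next Obligation.
by move=> s N N' f n; rewrite !bigmap_comp; apply: bigmap_eq => i; rewrite cmap_comm.
Qed.

Lemma zero_quasi_iso (X Y : complex_category A) (f : hom X Y) :
  (forall n : int, idm (X n) ≈ hzero) -> (forall n : int, idm (Y n) ≈ hzero) ->
  quasi_iso f.
Proof.
move=> X0 Y0; apply/quasi_isoP => n; split.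
  move=> t x y _ _; exists t, (idm t), hzero.
  split; first exact: is_iso_epic (is_iso_id _).
  by rewrite compose_idr compose0r -(compose_idl x) X0 compose0l.
move=> t y _; exists t, (idm t), hzero, hzero; split.
- exact: is_iso_epic (is_iso_id _).
- exact: compose0r.
- by rewrite !compose0r hadd0 compose_idr -(compose_idl y) Y0 compose0l.
Qed.

(** Finite sums are exact. The head and the tail of the list are treated one after the other, the
    second on a further cover. *)
Lemma bigbip_quasi_iso s (N N' : I -> complex A)
    (f : forall i, chain_map (N i) (N' i)) :
  (forall i, quasi_iso (f i : @hom (complex_category A) (N i) (N' i))) ->
  quasi_iso (bigbip_chain s f : @hom (complex_category A) _ _).
Proof.
move=> qf; elim: s => [|i s /quasi_isoP IH].
  by apply: zero_quasi_iso => n; apply: zob_terminal.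
have /quasi_isoP qi := qf i; apply/quasi_isoP => n; split.
  move=> t x y dx fx.
  have [||t1 [e1 [s1 [ee1 es1]]]] := (qi n).1 _ (bip_prl _ ∘ x) (bip_prl _ ∘ y).
  - apply: transitivity (symmetry (prl_bigmap (fun i => cdiff (N i) (n + 1)) x)) _.
    by rewrite [X in _ ∘ X]dx compose0r.
  - apply: transitivity (symmetry (prl_bigmap (fun i => f i (n + 1)) x)) _.
    by rewrite [X in _ ∘ X]fx; exact: prl_bigmap.
  have [||t2 [e2 [s2 [ee2 es2]]]] :=
    (IH n).1 _ (bip_prr _ ∘ x ∘ e1) (bip_prr _ ∘ y ∘ e1).
  - apply: transitivity (compose_assoc _ _ _) _.
    apply: transitivity (compose_proper
      (symmetry (prr_bigmap (fun i => cdiff (N i) (n + 1)) x)) (reflexivity e1)) _.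
    by rewrite [X in _ ∘ X ∘ _]dx compose0r compose0l.
  - apply: transitivity (compose_assoc _ _ _) _.
    apply: transitivity _ (symmetry (compose_assoc _ _ _)).
    apply: compose_proper => //.
    apply: transitivity (symmetry (prr_bigmap (fun i => f i (n + 1)) x)) _.
    by rewrite [X in _ ∘ X]fx; exact: prr_bigmap.
  exists t2, (e1 ∘ e2), (bpair (ab_biproduct _ _) (s1 ∘ e2) s2).
  split; first exact: epic_comp.
  apply: bpair_eq.
    apply: transitivity (prl_bigmap (fun i => cdiff (N i) n) _) _.
    by rewrite prl_bpair !compose_assoc es1.
  apply: transitivity (prr_bigmap (fun i => cdiff (N i) n) _) _.
  by rewrite prr_bpair [X in X ≈ _]es2 !compose_assoc.
move=> t y dy.
have [|t1 [e1 [x1 [s1 [ee1 dx1 ey1]]]]] := (qi n).2 _ (bip_prl _ ∘ y).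
  apply: transitivity (symmetry (prl_bigmap (fun i => cdiff (N' i) (n + 1)) y)) _.
  by rewrite [X in _ ∘ X]dy compose0r.
have [|t2 [e2 [x2 [s2 [ee2 dx2 ey2]]]]] := (IH n).2 _ (bip_prr _ ∘ y ∘ e1).
  apply: transitivity (compose_assoc _ _ _) _.
  apply: transitivity (compose_proper
    (symmetry (prr_bigmap (fun i => cdiff (N' i) (n + 1)) y)) (reflexivity e1)) _.
  by rewrite [X in _ ∘ X ∘ _]dy compose0r compose0l.
exists t2, (e1 ∘ e2), (bpair (ab_biproduct _ _) (x1 ∘ e2) x2),
  (bpair (ab_biproduct _ _) (s1 ∘ e2) s2); split.
- exact: epic_comp.
- apply: bpair_eq; rewrite compose0r.
    apply: transitivity (prl_bigmap (fun i => cdiff (N i) (n + 1)) _) _.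
    by rewrite prl_bpair compose_assoc dx1 compose0l.
  apply: transitivity (prr_bigmap (fun i => cdiff (N i) (n + 1)) _) _.
  by rewrite prr_bpair; exact: dx2.
- apply: bpair_eq; rewrite compose_addr.
    rewrite [X in _ ≈ X ⊕ _](prl_bigmap (fun i => f i (n + 1))).
    rewrite [X in _ ≈ _ ⊕ X](prl_bigmap (fun i => cdiff (N' i) n)).
    by rewrite !prl_bpair !compose_assoc ey1 compose_addl.
  rewrite [X in _ ≈ X ⊕ _](prr_bigmap (fun i => f i (n + 1))).
  rewrite [X in _ ≈ _ ⊕ X](prr_bigmap (fun i => cdiff (N' i) n)).
  by rewrite !prr_bpair !compose_assoc [X in X ≈ _]ey2.
Qed.

End Complexes.
End FiniteBiproducts.

(** * Diagrams over the two posets *)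

Section Arrow.
Variables (d : Order.disp_t) (P : porderType d) (A : preadditive).
Notation PC := (poset_category P).

(** Extension by zero lets matrices of structure maps range over all pairs of points, comparable or
    not. *)
Definition arrow (X : functor PC A) (p q : P) : hom (X p) (X q) :=
  match (p <= q)%O as b return (p <= q)%O = b -> hom (X p) (X q) with
  | true => fun e => fmap X (e : @hom PC p q)
  | false => fun _ => hzero
  end erefl.

Lemma arrowE (X : functor PC A) (p q : P) (e : @hom PC p q) :
  arrow X p q ≈ fmap X e.
Proof.
rewrite /arrow; move: (erefl _); case: {2 3}(p <= q)%O => e'.
  exact: fmap_proper.
by exfalso; move: (e : (p <= q)%O); rewrite e'.
Qed.

Lemma arrow0 (X : functor PC A) (p q : P) :
  (p <= q)%O = false -> arrow X p q ≈ hzero.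
Proof. by move=> e; rewrite /arrow; move: (erefl _); rewrite {2 3}e. Qed.

Lemma arrow_id (X : functor PC A) (p : P) : arrow X p p ≈ idm _.
Proof. by rewrite (arrowE X (idm (p : PC))) fmap_id. Qed.

(** Extension by zero respects composition unless [p <= r] holds while [p <= q] fails; the second
    premise excludes exactly this. *)
Lemma arrow_compl (X : functor PC A) (p q r : P) :
  (q <= r)%O -> (p <= q)%O = (p <= r)%O ->
  arrow X q r ∘ arrow X p q ≈ arrow X p r.
Proof.
move=> qr; case pq: (p <= q)%O => pr.
  rewrite (arrowE X (qr : @hom PC q r)) (arrowE X (pq : @hom PC p q)).
  by rewrite -fmap_comp -arrowE.
by rewrite (arrow0 _ pq) (arrow0 _ (esym pr)) compose0r.
Qed.

Lemma arrow_compr (X : functor PC A) (p q r : P) :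
  (p <= q)%O -> (q <= r)%O = (p <= r)%O ->
  arrow X q r ∘ arrow X p q ≈ arrow X p r.
Proof.
move=> pq; case qr: (q <= r)%O => pr.
  rewrite (arrowE X (qr : @hom PC q r)) (arrowE X (pq : @hom PC p q)).
  by rewrite -fmap_comp -arrowE.
by rewrite (arrow0 _ qr) (arrow0 _ (esym pr)) compose0l.
Qed.

Lemma arrow_nat (X X' : functor PC A) (f : nat_trans X X') (p q : P) :
  f q ∘ arrow X p q ≈ arrow X' p q ∘ f p.
Proof.
case pq: (p <= q)%O; last by rewrite !arrow0 // compose0l compose0r.
by rewrite !(arrowE _ (pq : @hom PC p q)) naturality.
Qed.

End Arrow.

Section Evaluation.
Variables (C : category) (A : abelian).

Lemma pointwise_heq (F G : functor_abelian C A) (s t : hom F G) :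
  (forall p : C, (s : nat_trans F G) p ≈ (t : nat_trans F G) p) -> s ≈ t.
Proof. by []. Qed.

Program Definition eval_functor (p : C) : functor (functor_abelian C A) A :=
  {| fob := fun X : functor_abelian C A => (X : functor C A) p;
     fmap := fun X Y f => (f : nat_trans X Y) p |}.
Next Obligation. by move=> p X Y f g e; apply: e. Qed.
Next Obligation. by move=> p X; reflexivity. Qed.
Next Obligation. by move=> p X Y Z g f; reflexivity. Qed.

Lemma eval_additive (p : C) : is_additive (eval_functor p).
Proof. by move=> X Y f g; reflexivity. Qed.

Lemma eval_quasi_iso (X Y : complex_category (functor_abelian C A)) (f : hom X Y) :
  quasi_iso f <->
  forall p : C, quasi_iso (map_chain (eval_additive p) f :
    @hom (complex_category A) (map_complex (eval_additive p) X)
      (map_complex (eval_additive p) Y)).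
Proof.
apply: iff_trans (pointwise_quasi_iso f) _.
(* [complex_eval] and [map_complex] differ in the proof of [cdiff2], which enters the homology
   objects but not [h_injective] and [h_surjective]; hence the detour through [quasi_isoP]. *)
split=> qf p; apply/quasi_isoP => n; exact (proj1 (quasi_isoP _) (qf p) n).
Qed.

End Evaluation.

(** * Skyscraper diagrams *)

Section Skyscraper.
Variables (d : Order.disp_t) (P : porderType d) (Y : Type) (i : P -> option Y).
Hypothesis convex : forall x y z : P,
  (x <= y)%O -> (y <= z)%O -> i x = None -> i z = None -> i y = None.
Variable A : abelian.
Notation PC := (poset_category P).

Definition sky_ob (M : A) (a : option Y) : A :=
  if a is None then M else zob (ab_zero A).

Definition sky_arrow (M : A) (a b : option Y) : hom (sky_ob M a) (sky_ob M b) :=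
  match a, b with
  | None, None => idm M
  | _, _ => hzero
  end.

Lemma sky_arrow_id (M : A) (a : option Y) : sky_arrow M a a ≈ idm (sky_ob M a).
Proof. by case: a => [y|] //=; rewrite [idm _]zob_terminal. Qed.

(** A chain leaving the support and coming back would have composite zero where the identity is
    required; convexity rules it out. *)
Program Definition sky_diagram (M : A) : functor PC A :=
  {| fob := fun p : PC => sky_ob M (i p);
     fmap := fun p q _ => sky_arrow M (i p) (i q) |}.
Next Obligation. by move=> M p q e e' _; reflexivity. Qed.
Next Obligation.
by move=> M p; apply: sky_arrow_id.
Qed.
Next Obligation.
move=> M p q r qr pq /=; have := convex pq qr.
case: (i p) (i q) (i r) => [y|] [y'|] [y''|] //= c; rewrite ?compose0l ?compose0r //.
  by have := c erefl erefl.
by rewrite compose_idl.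
Qed.

Definition sky_map (M M' : A) (f : hom M M') (a : option Y) :
    hom (sky_ob M a) (sky_ob M' a) :=
  if a is None then f else hzero.

Program Definition sky : functor A (functor_abelian PC A) :=
  {| fob := sky_diagram : A -> functor_abelian PC A;
     fmap := fun M M' f => @NatTrans PC A (sky_diagram M) (sky_diagram M')
       (fun p => sky_map f (i p)) _ |}.
Next Obligation.
move=> M M' f p q pq /=; case: (i p) (i q) => [y|] [y'|] /=;
  by rewrite ?compose0l ?compose0r // compose_idl compose_idr.
Qed.
Next Obligation.
by move=> M M' f g e; apply: pointwise_heq => p /=; case: (i p).
Qed.
Next Obligation.
move=> M; apply: pointwise_heq => p /=; case: (i p) => [y|] //=.
by rewrite [idm _]zob_terminal.
Qed.
Next Obligation.
move=> M M' M'' g f; apply: pointwise_heq => p /=.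
by case: (i p) => [y|] //=; rewrite compose0l.
Qed.

Lemma sky_additive : is_additive sky.
Proof.
move=> M M' f g; apply: pointwise_heq => p /=.
by case: (i p) => [y|] //=; rewrite hadd0.
Qed.

End Skyscraper.

(** * Consequences of disjointness for the two orders *)

Section Orders.
Variables (d : Order.disp_t) (Y : finPOrderType d) (Y0 : {set Y}).
Hypothesis hY0 : forall y y' : Y, y \in Y0 -> y' \in Y0 -> y != y' ->
  [set z : Y | (y <= z)%O] :&: [set z : Y | (y' <= z)%O] = set0 /\
  [set z : Y | (z <= y)%O] :&: [set z : Y | (z <= y')%O] = set0.

Lemma upper_disjoint (y y' z : Y) : y \in Y0 -> y' \in Y0 ->
  (y <= z)%O -> (y' <= z)%O -> y = y'.
Proof.
move=> yin yin' yz yz'; apply/eqP/negPn/negP => yy'.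
have [/setP/(_ z) e _] := hY0 yin yin' yy'.
by move: e; rewrite !inE yz yz'.
Qed.

Lemma lower_disjoint (y y' z : Y) : y \in Y0 -> y' \in Y0 ->
  (z <= y)%O -> (z <= y')%O -> y = y'.
Proof.
move=> yin yin' yz yz'; apply/eqP/negPn/negP => yy'.
have [_ /setP/(_ z) e] := hY0 yin yin' yy'.
by move: e; rewrite !inE yz yz'.
Qed.

Lemma plus_point_le (y : Y) :
  ((None : poset_plus Y0) <= (Some y : poset_plus Y0))%O ->
  exists2 y0, y0 \in Y0 & (y0 <= y)%O.
Proof. by move=> /existsP[y0 /andP[? ?]]; exists y0. Qed.

Lemma minus_le_point (y : Y) :
  ((Some y : poset_minus Y0) <= (None : poset_minus Y0))%O ->
  exists2 y0, y0 \in Y0 & (y <= y0)%O.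
Proof. by move=> /existsP[y0 /andP[? ?]]; exists y0. Qed.

Lemma plus_point_le_in (y : Y) : y \in Y0 ->
  ((None : poset_plus Y0) <= (Some y : poset_plus Y0))%O.
Proof. by move=> yin; apply/existsP; exists y; rewrite yin lexx. Qed.

Lemma minus_le_point_in (y : Y) : y \in Y0 ->
  ((Some y : poset_minus Y0) <= (None : poset_minus Y0))%O.
Proof. by move=> yin; apply/existsP; exists y; rewrite yin lexx. Qed.

(** The member of [Y0] below [y] is also the only one below [y']. *)
Lemma plus_le_eq (y y' a : Y) :
  ((None : poset_plus Y0) <= (Some y : poset_plus Y0))%O -> (y <= y')%O ->
  a \in Y0 -> (a <= y)%O = (a <= y')%O.
Proof.
move=> /plus_point_le[y0 y0in y0y] yy' ain; apply/idP/idP => [ay|ay'].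
  exact: le_trans yy'.
by rewrite (upper_disjoint ain y0in ay' (le_trans y0y yy')).
Qed.

(** The member of [Y0] above [y'] is also the only one above [y]. *)
Lemma minus_le_eq (y y' b : Y) :
  ((Some y' : poset_minus Y0) <= (None : poset_minus Y0))%O -> (y <= y')%O ->
  b \in Y0 -> (y' <= b)%O = (y <= b)%O.
Proof.
move=> /minus_le_point[y0 y0in y'y0] yy' bin; apply/idP/idP => [|yb].
  exact: le_trans.
by rewrite (lower_disjoint bin y0in yb (le_trans yy' y'y0)).
Qed.

Lemma antichain (a b : Y) : a \in Y0 -> b \in Y0 -> (a <= b)%O = (a == b).
Proof.
move=> ain bin; apply/idP/eqP => [ab|->]; last exact: lexx.
exact: lower_disjoint ain bin (lexx a) ab.
Qed.

End Orders.

(** * Gluing functors between the two categories of diagrams *)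

Section Gluing.
Variables (d : Order.disp_t) (Y : finPOrderType d) (Y0 : {set Y}).
Hypothesis hY0 : forall y y' : Y, y \in Y0 -> y' \in Y0 -> y != y' ->
  [set z : Y | (y <= z)%O] :&: [set z : Y | (y' <= z)%O] = set0 /\
  [set z : Y | (z <= y)%O] :&: [set z : Y | (z <= y')%O] = set0.
Variable A : abelian.

Notation PP := (poset_category (poset_plus Y0)).
Notation PM := (poset_category (poset_minus Y0)).
Notation AP := (functor_abelian PP A).
Notation AM := (functor_abelian PM A).
Notation plus a := (a : poset_plus Y0).
Notation minus a := (a : poset_minus Y0).
Notation s := (enum Y0).

Lemma plus_convex (x y z : poset_plus Y0) :
  (x <= y)%O -> (y <= z)%O -> x = None -> z = None -> y = None.
Proof. by move=> _ yz _ ez; move: yz; rewrite ez; case: y. Qed.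

Lemma minus_convex (x y z : poset_minus Y0) :
  (x <= y)%O -> (y <= z)%O -> x = None -> z = None -> y = None.
Proof. by move=> xy _ ex _; move: xy; rewrite ex; case: y. Qed.

(** Both carriers are [option Y] by conversion, so one description of the objects serves the two
    orders. *)
Definition glue_ob (N : Y -> A) (a : option Y) : A :=
  if a is Some y then N y else bigbip s N.

Definition glue_map (N N' : Y -> A) (f : forall y, hom (N y) (N' y))
    (a : option Y) : hom (glue_ob N a) (glue_ob N' a) :=
  match a with
  | Some y => f y
  | None => bigmap s f
  end.

(** [glue_minus X] is [X] on [Y] with [S X] at the added point, while
    [point_minus X] is [X None] at the added point and zero on [Y]; the cone of
    [point_minus X -> glue_minus X] is the equivalence. *)
Section GlueMinus.

Definition glue_minus_arrow (X : functor PP A) (a b : option Y) :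
    hom (glue_ob (fun y => X (plus (Some y))) a)
        (glue_ob (fun y => X (plus (Some y))) b) :=
  match a, b with
  | Some y, Some y' => arrow X (plus (Some y)) (plus (Some y'))
  | Some y, None =>
      bigpair s (fun y' => arrow X (plus (Some y)) (plus (Some y')))
  | None, None => idm _
  | None, Some _ => hzero
  end.

Lemma glue_minus_arrow_id (X : functor PP A) (a : option Y) :
  glue_minus_arrow X a a ≈ idm _.
Proof. by case: a => [y|] //=; apply: arrow_id. Qed.

(** For [y <= y'] with [y'] below the added point, a member of [Y0] above [y] is above [y'] as well,
    so extension by zero composes correctly. This is where disjointness of the sets below members of
    [Y0] enters. *)
Lemma glue_minus_arrow_comp (X : functor PP A) (a b c : option Y) :
  (minus a <= minus b)%O -> (minus b <= minus c)%O ->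
  glue_minus_arrow X b c ∘ glue_minus_arrow X a b ≈ glue_minus_arrow X a c.
Proof.
case: a b c => [y|] [y'|] [y''|] //= ab bc; rewrite ?compose_idl //.
- apply: arrow_compl => //; transitivity true; first exact: ab.
  by symmetry; apply: (le_trans (ab : (y <= y')%O)).
- rewrite bigpair_comp; apply: bigpair_eq => b; rewrite mem_enum => bin.
  apply: arrow_compr => //.
  exact: (minus_le_eq hY0 bc (ab : (y <= y')%O) bin).
Qed.

Program Definition glue_minus_diagram (X : functor PP A) : functor PM A :=
  {| fob := fun p : PM => glue_ob (fun y => X (plus (Some y))) p;
     fmap := fun p q _ => glue_minus_arrow X p q |}.
Next Obligation. by move=> X p q e e' _; reflexivity. Qed.
Next Obligation. by move=> X p; apply: glue_minus_arrow_id. Qed.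
Next Obligation.
by move=> X p q r qr pq; rewrite glue_minus_arrow_comp.
Qed.

Lemma glue_minus_natural (X X' : functor PP A) (f : nat_trans X X')
    (a b : option Y) :
  glue_map (fun y => f (plus (Some y))) b ∘ glue_minus_arrow X a b ≈
  glue_minus_arrow X' a b ∘ glue_map (fun y => f (plus (Some y))) a.
Proof.
case: a b => [y|] [y'|] //=;
  rewrite ?compose_idl ?compose_idr ?compose0l ?compose0r //.
  exact: arrow_nat.
by rewrite bigmap_bigpair bigpair_comp; apply: bigpair_eq => b _; apply: arrow_nat.
Qed.

Program Definition glue_minus : functor AP AM :=
  {| fob := glue_minus_diagram : AP -> AM;
     fmap := fun X X' f =>
       @NatTrans PM A (glue_minus_diagram X) (glue_minus_diagram X')
         (fun p => glue_map (fun y => (f : nat_trans X X') (plus (Some y))) p)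
         (fun p q _ => glue_minus_natural f p q) |}.
Next Obligation.
move=> X X' f g e; apply: pointwise_heq => p /=.
case: (p : option Y) => [y|] /=; first exact: (e _).
by apply: bigmap_eq => y; exact: (e _).
Qed.
Next Obligation.
move=> X; apply: pointwise_heq => p /=.
by case: (p : option Y) => [y|] //=; apply: bigmap_id.
Qed.
Next Obligation.
move=> X X' X'' g f; apply: pointwise_heq => p /=.
by case: (p : option Y) => [y|] //=; rewrite bigmap_comp.
Qed.

Lemma glue_minus_additive : is_additive glue_minus.
Proof.
move=> X X' f g; apply: pointwise_heq => p /=.
by case: (p : option Y) => [y|] //=; apply: bigmap_add.
Qed.

End GlueMinus.

Section GluePlus.

Definition glue_plus_arrow (Z : functor PM A) (a b : option Y) :
    hom (glue_ob (fun y => Z (minus (Some y))) a)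
        (glue_ob (fun y => Z (minus (Some y))) b) :=
  match a, b with
  | Some y, Some y' => arrow Z (minus (Some y)) (minus (Some y'))
  | None, Some y' =>
      bigcopair s (fun y => arrow Z (minus (Some y)) (minus (Some y')))
  | None, None => idm _
  | Some _, None => hzero
  end.

Lemma glue_plus_arrow_id (Z : functor PM A) (a : option Y) :
  glue_plus_arrow Z a a ≈ idm _.
Proof. by case: a => [y|] //=; apply: arrow_id. Qed.

(** Dually, the case starting at the added point relies on disjointness of the sets above members of
    [Y0]. *)
Lemma glue_plus_arrow_comp (Z : functor PM A) (a b c : option Y) :
  (plus a <= plus b)%O -> (plus b <= plus c)%O ->
  glue_plus_arrow Z b c ∘ glue_plus_arrow Z a b ≈ glue_plus_arrow Z a c.
Proof.
case: a b c => [y|] [y'|] [y''|] //= ab bc; rewrite ?compose_idr //.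
- apply: arrow_compl => //; transitivity true; first exact: ab.
  by symmetry; apply: (le_trans (ab : (y <= y')%O)).
- rewrite comp_bigcopair; apply: bigcopair_eq => a; rewrite mem_enum => ain.
  apply: arrow_compl => //.
  exact: (plus_le_eq hY0 ab (bc : (y' <= y'')%O) ain).
Qed.

Program Definition glue_plus_diagram (Z : functor PM A) : functor PP A :=
  {| fob := fun p : PP => glue_ob (fun y => Z (minus (Some y))) p;
     fmap := fun p q _ => glue_plus_arrow Z p q |}.
Next Obligation. by move=> Z p q e e' _; reflexivity. Qed.
Next Obligation. by move=> Z p; apply: glue_plus_arrow_id. Qed.
Next Obligation.
by move=> Z p q r qr pq; rewrite glue_plus_arrow_comp.
Qed.

Lemma glue_plus_natural (Z Z' : functor PM A) (f : nat_trans Z Z')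
    (a b : option Y) :
  glue_map (fun y => f (minus (Some y))) b ∘ glue_plus_arrow Z a b ≈
  glue_plus_arrow Z' a b ∘ glue_map (fun y => f (minus (Some y))) a.
Proof.
case: a b => [y|] [y'|] //=;
  rewrite ?compose_idl ?compose_idr ?compose0l ?compose0r //.
  exact: arrow_nat.
rewrite bigcopair_bigmap comp_bigcopair; apply: bigcopair_eq => b _.
exact: arrow_nat.
Qed.

Program Definition glue_plus : functor AM AP :=
  {| fob := glue_plus_diagram : AM -> AP;
     fmap := fun Z Z' f =>
       @NatTrans PP A (glue_plus_diagram Z) (glue_plus_diagram Z')
         (fun p => glue_map (fun y => (f : nat_trans Z Z') (minus (Some y))) p)
         (fun p q _ => glue_plus_natural f p q) |}.
Next Obligation.
move=> X X' f g e; apply: pointwise_heq => p /=.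
case: (p : option Y) => [y|] /=; first exact: (e _).
by apply: bigmap_eq => y; exact: (e _).
Qed.
Next Obligation.
move=> X; apply: pointwise_heq => p /=.
by case: (p : option Y) => [y|] //=; apply: bigmap_id.
Qed.
Next Obligation.
move=> X X' X'' g f; apply: pointwise_heq => p /=.
by case: (p : option Y) => [y|] //=; rewrite bigmap_comp.
Qed.

Lemma glue_plus_additive : is_additive glue_plus.
Proof.
move=> X X' f g; apply: pointwise_heq => p /=.
by case: (p : option Y) => [y|] //=; apply: bigmap_add.
Qed.

End GluePlus.

Section Points.

Definition point_minus : functor AP AM :=
  functor_comp (@sky _ (poset_minus Y0) Y (fun p => p) minus_convex A)
    (eval_functor A (plus None : PP)).
Definition point_plus : functor AM AP :=
  functor_comp (@sky _ (poset_plus Y0) Y (fun p => p) plus_convex A)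
    (eval_functor A (minus None : PM)).

Lemma point_minus_additive : is_additive point_minus.
Proof.
move=> X X' f g.
exact: (@sky_additive _ (poset_minus Y0) Y (fun p => p) minus_convex A).
Qed.
Lemma point_plus_additive : is_additive point_plus.
Proof.
move=> X X' f g.
exact: (@sky_additive _ (poset_plus Y0) Y (fun p => p) plus_convex A).
Qed.

Definition to_glue (X : functor PP A) (a : option Y) :
    hom (sky_ob (X (plus None)) a) (glue_ob (fun y => X (plus (Some y))) a) :=
  match a with
  | None => bigpair s (fun y => arrow X (plus None) (plus (Some y)))
  | Some _ => hzero
  end.

Definition from_glue (Z : functor PM A) (a : option Y) :
    hom (glue_ob (fun y => Z (minus (Some y))) a) (sky_ob (Z (minus None)) a) :=
  match a with
  | None => bigcopair s (fun y => arrow Z (minus (Some y)) (minus None))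
  | Some _ => hzero
  end.

Lemma to_glue_natural (X : functor PP A) (a b : option Y) :
  (minus a <= minus b)%O ->
  to_glue X b ∘ sky_arrow (X (plus None)) a b ≈
  glue_minus_arrow X a b ∘ to_glue X a.
Proof.
by case: a b => [y|] [y'|] //= _;
  rewrite ?compose0l ?compose0r ?compose_idl ?compose_idr.
Qed.

Lemma from_glue_natural (Z : functor PM A) (a b : option Y) :
  (plus a <= plus b)%O ->
  from_glue Z b ∘ glue_plus_arrow Z a b ≈
  sky_arrow (Z (minus None)) a b ∘ from_glue Z a.
Proof.
by case: a b => [y|] [y'|] //= _;
  rewrite ?compose0l ?compose0r ?compose_idl ?compose_idr.
Qed.

Program Definition to_glue_nat : nat_trans point_minus glue_minus :=
  {| component := fun X => @NatTrans PM A (point_minus X) (glue_minus X)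
       (to_glue X) (@to_glue_natural X) |}.
Next Obligation.
move=> X X' f; apply: pointwise_heq => p /=.
case: (p : option Y) => [y|] /=; first by rewrite ?compose0l ?compose0r.
rewrite bigmap_bigpair bigpair_comp; apply: bigpair_eq => y _.
by rewrite arrow_nat.
Qed.

Program Definition from_glue_nat : nat_trans glue_plus point_plus :=
  {| component := fun Z => @NatTrans PP A (glue_plus Z) (point_plus Z)
       (from_glue Z) (@from_glue_natural Z) |}.
Next Obligation.
move=> X X' f; apply: pointwise_heq => p /=.
case: (p : option Y) => [y|] /=; first by rewrite ?compose0l ?compose0r.
rewrite bigcopair_bigmap comp_bigcopair; apply: bigcopair_eq => y _.
by rewrite arrow_nat.
Qed.

End Points.
Section QuasiIsos.
Local Open Scope ring_scope.

Lemma point_minus_quasi_iso (X X' : complex_category AP) (f : hom X X') :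
  quasi_iso f ->
  quasi_iso (map_chain point_minus_additive f : @hom (complex_category AM) _ _).
Proof.
move=> /eval_quasi_iso qf; apply/eval_quasi_iso => p.
case: (p : option Y) => [y|].
  by apply: zero_quasi_iso => n; apply: zob_terminal.
apply/quasi_isoP => n.
exact (proj1 (quasi_isoP _) (qf (plus None)) n).
Qed.

Lemma point_plus_quasi_iso (Z Z' : complex_category AM) (f : hom Z Z') :
  quasi_iso f ->
  quasi_iso (map_chain point_plus_additive f : @hom (complex_category AP) _ _).
Proof.
move=> /eval_quasi_iso qf; apply/eval_quasi_iso => p.
case: (p : option Y) => [y|].
  by apply: zero_quasi_iso => n; apply: zob_terminal.
apply/quasi_isoP => n.
exact (proj1 (quasi_isoP _) (qf (minus None)) n).
Qed.

Lemma glue_minus_quasi_iso (X X' : complex_category AP) (f : hom X X') :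
  quasi_iso f ->
  quasi_iso (map_chain glue_minus_additive f : @hom (complex_category AM) _ _).
Proof.
move=> /eval_quasi_iso qf; apply/eval_quasi_iso => p; apply/quasi_isoP => n.
case: (p : option Y) => [y|].
  exact (proj1 (quasi_isoP _) (qf (plus (Some y))) n).
exact (proj1 (quasi_isoP _) (bigbip_quasi_iso s
  (f := fun y => map_chain (eval_additive (A := A) (plus (Some y) : PP)) f)
  (fun y => qf (plus (Some y)))) n).
Qed.

Lemma glue_plus_quasi_iso (Z Z' : complex_category AM) (f : hom Z Z') :
  quasi_iso f ->
  quasi_iso (map_chain glue_plus_additive f : @hom (complex_category AP) _ _).
Proof.
move=> /eval_quasi_iso qf; apply/eval_quasi_iso => p; apply/quasi_isoP => n.
case: (p : option Y) => [y|].
  exact (proj1 (quasi_isoP _) (qf (minus (Some y))) n).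
exact (proj1 (quasi_isoP _) (bigbip_quasi_iso s
  (f := fun y => map_chain (eval_additive (A := A) (minus (Some y) : PM)) f)
  (fun y => qf (minus (Some y)))) n).
Qed.

End QuasiIsos.

Lemma arrow_glue_minus (X : functor PP A) (a b : option Y) :
  (minus a <= minus b)%O ->
  arrow (glue_minus_diagram X) (minus a) (minus b) ≈ glue_minus_arrow X a b.
Proof. by move=> ab; rewrite (arrowE _ (ab : @hom PM a b)). Qed.

Lemma arrow_glue_minus_some (X : functor PP A) (y y' : Y) :
  arrow (glue_minus_diagram X) (minus (Some y)) (minus (Some y')) ≈
  arrow X (plus (Some y)) (plus (Some y')).
Proof.
case yy': (y <= y')%O; first exact: arrow_glue_minus.
by rewrite !arrow0.
Qed.

Lemma arrow_glue_plus (Z : functor PM A) (a b : option Y) :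
  (plus a <= plus b)%O ->
  arrow (glue_plus_diagram Z) (plus a) (plus b) ≈ glue_plus_arrow Z a b.
Proof. by move=> ab; rewrite (arrowE _ (ab : @hom PP a b)). Qed.

Lemma arrow_glue_plus_some (Z : functor PM A) (y y' : Y) :
  arrow (glue_plus_diagram Z) (plus (Some y)) (plus (Some y')) ≈
  arrow Z (minus (Some y)) (minus (Some y')).
Proof.
case yy': (y <= y')%O; first exact: arrow_glue_plus.
by rewrite !arrow0.
Qed.

(** Distinct elements of [Y0] are incomparable, so the matrix of structure maps
    between them is the identity. *)
Lemma from_glue_minus (X : functor PP A) :
  bigcopair s (fun y => arrow (glue_minus_diagram X) (minus (Some y)) (minus None))
  ≈ idm (bigbip s (fun y => X (plus (Some y)))).
Proof.
rewrite (@bigcopair_eq _ _ _ _ _ _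
  (fun y => bigpair s (fun y' => arrow X (plus (Some y)) (plus (Some y'))))).
  apply: (bigcopair_bigpair_delta
    (e := fun y y' => arrow X (plus (Some y)) (plus (Some y')))).
  - exact: enum_uniq.
  - by move=> y _; apply: arrow_id.
  - move=> y y'; rewrite !mem_enum => yin yin' yy'; apply: arrow0.
    by rewrite -[LHS]/(y <= y')%O (antichain hY0 yin yin') (negbTE yy').
move=> y; rewrite mem_enum => yin.
by rewrite arrow_glue_minus //; apply: minus_le_point_in.
Qed.

Lemma to_glue_plus (Z : functor PM A) :
  bigpair s (fun y => arrow (glue_plus_diagram Z) (plus None) (plus (Some y)))
  ≈ idm (bigbip s (fun y => Z (minus (Some y)))).
Proof.
rewrite (@bigpair_eq _ _ _ _ _ _
  (fun y' => bigcopair s (fun y => arrow Z (minus (Some y)) (minus (Some y'))))).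
  apply: (bigpair_bigcopair_delta
    (e := fun y y' => arrow Z (minus (Some y)) (minus (Some y')))).
  - exact: enum_uniq.
  - by move=> y _; apply: arrow_id.
  - move=> y y'; rewrite !mem_enum => yin yin' yy'; apply: arrow0.
    by rewrite -[LHS]/(y <= y')%O (antichain hY0 yin yin') (negbTE yy').
move=> y; rewrite mem_enum => yin.
by rewrite arrow_glue_plus //; apply: plus_point_le_in.
Qed.

(** * The round trip starting from [poset_plus] *)

Section RoundTripPlus.

(** [glue_plus (glue_minus X)] is [X] with its value at the added point replaced by the sum over
    [Y0]; [eta_at] compares the two. *)
Definition eta_at (X : functor PP A) (a : option Y) :
    hom (X (plus a)) (glue_ob (fun y => glue_minus_diagram X (minus (Some y))) a) :=
  match a with
  | Some y => idm (X (plus (Some y)))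
  | None => bigpair s (fun y => arrow X (plus None) (plus (Some y)))
  end.

(** The added point is minimal in [poset_plus], so the skyscraper there is a quotient of [X]. This
    dictates that the comparison map goes out of the shift. *)
Definition eps_at (X : functor PP A) (a : option Y) :
    hom (X (plus a)) (sky_ob (X (plus None)) a) :=
  match a with
  | Some _ => hzero
  | None => idm (X (plus None))
  end.

Lemma eta_at_natural (X : functor PP A) (a b : option Y)
    (ab : @hom PP (plus a) (plus b)) :
  eta_at X b ∘ fmap X ab ≈
  glue_plus_arrow (glue_minus_diagram X) a b ∘ eta_at X a.
Proof.
case: a b ab => [y|] [y'|] ab //=.
- by rewrite compose_idl compose_idr arrow_glue_minus_some -arrowE.
(* Exactly one member of [Y0] lies below [y']; its term of the sum survives and equals the structure
   map from the added point. *)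
- have [y0 y0in y0y'] := plus_point_le ab.
  rewrite (@bigcopair_bigpair1 _ _ _ _ _ _ _ _ y0) ?enum_uniq ?mem_enum //.
    rewrite arrow_glue_minus_some compose_idl -arrowE; symmetry.
    apply: arrow_compl => //.
    by rewrite (plus_point_le_in y0in); symmetry.
  move=> j; rewrite mem_enum => jin jy0; rewrite arrow_glue_minus_some.
  rewrite arrow0 ?compose0l //; apply/negbTE; apply: contraNN jy0 => jy'.
  by apply/eqP; apply: (upper_disjoint hY0 jin y0in jy' y0y').
- by rewrite compose_idl -arrowE arrow_id compose_idr.
Qed.

Lemma eps_at_natural (X : functor PP A) (a b : option Y)
    (ab : @hom PP (plus a) (plus b)) :
  eps_at X b ∘ fmap X ab ≈ sky_arrow (X (plus None)) a b ∘ eps_at X a.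
Proof.
case: a b ab => [y|] [y'|] ab //=; rewrite ?compose0l //.
by rewrite -arrowE arrow_id.
Qed.

Definition glue_eta (X : AP) : hom X (glue_plus (glue_minus X)) :=
  @NatTrans PP A X (glue_plus_diagram (glue_minus_diagram X))
    (eta_at X) (fun p q => @eta_at_natural X p q).

Definition glue_eps (X : AP) : hom X (point_plus (point_minus X)) :=
  @NatTrans PP A X (point_plus (point_minus X))
    (eps_at X) (fun p q => @eps_at_natural X p q).

Lemma glue_eta_nat (X X' : AP) (f : hom X X') :
  glue_eta X' ∘ f ≈ fmap glue_plus (fmap glue_minus f) ∘ glue_eta X.
Proof.
apply: pointwise_heq => p /=; case: (p : option Y) => [y|] /=.
  by rewrite compose_idl compose_idr.
rewrite bigmap_bigpair bigpair_comp; apply: bigpair_eq => y _.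
by rewrite arrow_nat.
Qed.

Lemma glue_eps_nat (X X' : AP) (f : hom X X') :
  glue_eps X' ∘ f ≈ fmap point_plus (fmap point_minus f) ∘ glue_eps X.
Proof.
apply: pointwise_heq => p /=; case: (p : option Y) => [y|] /=.
  by rewrite !compose0l.
by rewrite compose_idl compose_idr.
Qed.

Lemma glue_eta_eps (X : AP) :
  from_glue_nat (glue_minus X) ∘ glue_eta X ≈
  fmap point_plus (to_glue_nat X) ∘ glue_eps X.
Proof.
apply: pointwise_heq => p /=; case: (p : option Y) => [y|] /=.
  by rewrite !compose0l.
by rewrite from_glue_minus compose_idl compose_idr.
Qed.

Definition glue_unit := dcone_unit point_minus_additive glue_minus_additive
  glue_plus_additive point_plus_additive glue_eta_nat glue_eps_nat glue_eta_eps.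

Lemma glue_unit_quasi_iso (X : complex_category AP) : quasi_iso (glue_unit X).
Proof.
apply/eval_quasi_iso => p; case: (p : option Y) => [y|].
  (* At a point of [Y] only [glue_plus (glue_minus X)] survives, with the value of [X], and the
     homotopy is zero. *)
  apply: (@dcone_unit_quasi_iso AP AM _ _ point_minus_additive
    glue_minus_additive _ _ glue_plus_additive point_plus_additive
    to_glue_nat from_glue_nat _ _ glue_eta_nat glue_eps_nat glue_eta_eps
    A _ (eval_additive (A := A) (plus (Some y) : PP))
    (fun X : AP => idm ((X : functor PP A) (plus (Some y))))
    (fun X => hzero) (fun X => hzero)).
  - by move=> Z W f /=; rewrite compose_idl compose_idr.
  - by move=> Z W f /=; rewrite compose0l compose0r.
  - by move=> Z W f /=; rewrite compose0l compose0r.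
  - by move=> Z; apply: zob_terminal.
  - by move=> Z /=; rewrite compose_idl compose0l hadd0r.
  - by move=> Z /=; rewrite compose_idl compose0l hadd0r.
  - by move=> Z /=; rewrite compose0l compose0r.
  - by move=> Z /=; rewrite compose0l.
  - by move=> Z; rewrite [idm _]zob_terminal [_ ∘ _]zob_terminal.
  - by move=> Z; rewrite [idm _]zob_terminal [_ ∘ _]zob_terminal.
(* At the added point the terms over [glue_minus X] are both the sum over [Y0], and the identity as
   [lam] cancels them; [point_plus (point_minus X)] gives the value of [X]. *)
apply: (@dcone_unit_quasi_iso AP AM _ _ point_minus_additive
  glue_minus_additive _ _ glue_plus_additive point_plus_additive
  to_glue_nat from_glue_nat _ _ glue_eta_nat glue_eps_nat glue_eta_eps
  A _ (eval_additive (A := A) (plus None : PP))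
  (fun X => hzero)
  (fun X : AP => idm ((X : functor PP A) (plus None)))
  (fun X : AP => idm (bigbip s (fun y => (X : functor PP A) (plus (Some y)))))).
- by move=> Z W f /=; rewrite compose0l compose0r.
- by move=> Z W f /=; rewrite compose_idl compose_idr.
- by move=> Z W f /=; rewrite compose_idl compose_idr.
- by move=> Z; apply: bigbip0 => y; apply: zob_terminal.
- by move=> Z /=; rewrite compose_idl compose0l hadd0.
- by move=> Z /=; rewrite compose0r hadd0 compose_idl from_glue_minus.
- by move=> Z /=; rewrite compose_idl compose_idr.
- by move=> Z /=; rewrite compose0r.
- by move=> Z /=; rewrite compose_idl.
- by move=> Z /=; rewrite from_glue_minus compose_idl.
Qed.

End RoundTripPlus.

(** * The round trip starting from [poset_minus] *)

Section RoundTripMinus.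

(** The added point is maximal in [poset_minus], so the skyscraper there is a subdiagram of [Z], and
    the comparison map goes into the shift. *)
Definition kappa_at (Z : functor PM A) (a : option Y) :
    hom (sky_ob (Z (minus None)) a) (Z (minus a)) :=
  match a with
  | Some _ => hzero
  | None => idm (Z (minus None))
  end.

Definition mu_at (Z : functor PM A) (a : option Y) :
    hom (glue_ob (fun y => glue_plus_diagram Z (plus (Some y))) a) (Z (minus a)) :=
  match a with
  | Some y => idm (Z (minus (Some y)))
  | None => bigcopair s (fun y => arrow Z (minus (Some y)) (minus None))
  end.

Lemma kappa_at_natural (Z : functor PM A) (a b : option Y)
    (ab : @hom PM (minus a) (minus b)) :
  kappa_at Z b ∘ sky_arrow (Z (minus None)) a b ≈ fmap Z ab ∘ kappa_at Z a.
Proof.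
case: a b ab => [y|] [y'|] ab //=; rewrite ?compose0r //.
by rewrite -arrowE arrow_id.
Qed.

Lemma mu_at_natural (Z : functor PM A) (a b : option Y)
    (ab : @hom PM (minus a) (minus b)) :
  mu_at Z b ∘ glue_minus_arrow (glue_plus_diagram Z) a b ≈ fmap Z ab ∘ mu_at Z a.
Proof.
case: a b ab => [y|] [y'|] ab //=.
- by rewrite compose_idl compose_idr arrow_glue_plus_some -arrowE.
(* The one member of [Y0] above [y] contributes the only nonzero term. *)
- have [y0 y0in yy0] := minus_le_point ab.
  rewrite (@bigcopair_bigpair1 _ _ _ _ _ _ _ _ y0) ?enum_uniq ?mem_enum //.
    rewrite arrow_glue_plus_some compose_idr -arrowE.
    apply: arrow_compr => //.
    by rewrite (minus_le_point_in y0in); symmetry.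
  move=> j; rewrite mem_enum => jin jy0; rewrite arrow_glue_plus_some.
  rewrite [arrow Z (minus (Some y)) _]arrow0 ?compose0r //.
  apply/negbTE; apply: contraNN jy0 => yj.
  by apply/eqP; apply: (lower_disjoint hY0 jin y0in yj yy0).
- by rewrite compose_idr -arrowE arrow_id compose_idl.
Qed.

Definition glue_kappa (Z : AM) : hom (point_minus (point_plus Z)) Z :=
  @NatTrans PM A (point_minus (point_plus Z)) Z
    (kappa_at Z) (fun p q => @kappa_at_natural Z p q).

Definition glue_mu (Z : AM) : hom (glue_minus (glue_plus Z)) Z :=
  @NatTrans PM A (glue_minus_diagram (glue_plus_diagram Z)) Z
    (mu_at Z) (fun p q => @mu_at_natural Z p q).

Lemma glue_kappa_nat (Z Z' : AM) (f : hom Z Z') :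
  glue_kappa Z' ∘ fmap point_minus (fmap point_plus f) ≈ f ∘ glue_kappa Z.
Proof.
apply: pointwise_heq => p /=; case: (p : option Y) => [y|] /=.
  by rewrite !compose0r.
by rewrite compose_idl compose_idr.
Qed.

Lemma glue_mu_nat (Z Z' : AM) (f : hom Z Z') :
  glue_mu Z' ∘ fmap glue_minus (fmap glue_plus f) ≈ f ∘ glue_mu Z.
Proof.
apply: pointwise_heq => p /=; case: (p : option Y) => [y|] /=.
  by rewrite compose_idl compose_idr.
rewrite bigcopair_bigmap comp_bigcopair; apply: bigcopair_eq => y _.
by rewrite arrow_nat.
Qed.

Lemma glue_kappa_mu (Z : AM) :
  glue_kappa Z ∘ fmap point_minus (from_glue_nat Z) ≈
  glue_mu Z ∘ to_glue_nat (glue_plus Z).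
Proof.
apply: pointwise_heq => p /=; case: (p : option Y) => [y|] /=.
  by rewrite !compose0r.
by rewrite to_glue_plus compose_idl compose_idr.
Qed.

Definition glue_counit := dcone_counit glue_plus_additive point_plus_additive
  point_minus_additive glue_minus_additive glue_kappa_nat glue_mu_nat glue_kappa_mu.

Lemma glue_counit_quasi_iso (Z : complex_category AM) : quasi_iso (glue_counit Z).
Proof.
apply/eval_quasi_iso => p; case: (p : option Y) => [y|].
  (* At a point of [Y] the surviving term is [glue_minus (glue_plus Z)], with the value of [Z]. *)
  apply: (@dcone_counit_quasi_iso AM AP _ _ glue_plus_additive
    point_plus_additive _ _ point_minus_additive glue_minus_additive
    from_glue_nat to_glue_nat _ _ glue_kappa_nat glue_mu_nat glue_kappa_mu
    A _ (eval_additive (A := A) (minus (Some y) : PM))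
    (fun Z => hzero) (fun Z : AM => idm ((Z : functor PM A) (minus (Some y))))
    (fun Z => hzero)).
  - by move=> X W f /=; rewrite compose0l compose0r.
  - by move=> X W f /=; rewrite compose_idl compose_idr.
  - by move=> X W f /=; rewrite compose0l compose0r.
  - by move=> X; apply: zob_terminal.
  - by move=> X /=; rewrite compose_idl compose0l hadd0.
  - by move=> X; rewrite [idm _]zob_terminal [_ ∘ _]zob_terminal.
  - by move=> X; rewrite [idm _]zob_terminal [_ ∘ _]zob_terminal.
  - by move=> X /=; rewrite compose0l compose0r.
  - by move=> X /=; rewrite compose0r.
  - by move=> X /=; rewrite compose_idl compose0l hadd0r.
(* At the added point the two terms over [glue_plus Z] cancel, and [point_minus (point_plus Z)]
   gives the value of [Z]. *)
apply: (@dcone_counit_quasi_iso AM AP _ _ glue_plus_additive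
  point_plus_additive _ _ point_minus_additive glue_minus_additive
  from_glue_nat to_glue_nat _ _ glue_kappa_nat glue_mu_nat glue_kappa_mu
  A _ (eval_additive (A := A) (minus None : PM))
  (fun Z : AM => idm ((Z : functor PM A) (minus None)))
  (fun Z => hzero)
  (fun Z : AM => idm (bigbip s (fun y => (Z : functor PM A) (minus (Some y)))))).
- by move=> X W f /=; rewrite compose_idl compose_idr.
- by move=> X W f /=; rewrite compose0l compose0r.
- by move=> X W f /=; rewrite compose_idl compose_idr.
- by move=> X; apply: bigbip0 => y; apply: zob_terminal.
- by move=> X /=; rewrite compose_idl compose0r hadd0r.
- by move=> X /=; rewrite compose_idl to_glue_plus.
- by move=> X /=; rewrite compose_idl.
- by move=> X /=; rewrite compose_idl compose_idr.
- by move=> X /=; rewrite compose0l.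
- by move=> X /=; rewrite compose0l hadd0 compose_idr to_glue_plus.
Qed.

End RoundTripMinus.

(** The comparison maps go out of the shift for one composite and into it for the other. Both become
    isomorphisms of functors after localization, and the desuspensions then invert the shifts. *)
Lemma reflection_equivalence :
  is_equivalence (loc_functor (cone_functor_quasi_iso to_glue_nat
    point_minus_quasi_iso glue_minus_quasi_iso)).
Proof.
pose G := loc_functor (cone_functor_quasi_iso from_glue_nat
  glue_plus_quasi_iso point_plus_quasi_iso).
apply: (@equivalence_up_to_autoequivalence _ _ _ G
  (derived_shift AP) (loc_functor (@quasi_iso_desusp AP))
  (derived_shift AM) (loc_functor (@quasi_iso_desusp AM))).
- exact: (loc_functor_comp_iso _ _ _ glue_unit_quasi_iso).
- exact: (loc_functor_iso_comp _ _ _ glue_counit_quasi_iso).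
- apply: (loc_functor_iso_id _ _ (s := desusp_shift AP)) => X.
  by apply: quasi_iso_iso; apply: desusp_shift_iso.
- apply: (loc_functor_iso_id _ _ (s := shift_desusp AM)) => X.
  by apply: quasi_iso_iso; apply: shift_desusp_iso.
Qed.

End Gluing.

Theorem corollary1p7 (d : Order.disp_t) (Y : finPOrderType d) (Y0 : {set Y})
    (hY0 : forall y y' : Y, y \in Y0 -> y' \in Y0 -> y != y' ->
      [set z : Y | (y <= z)%O] :&: [set z : Y | (y' <= z)%O] = set0 /\
      [set z : Y | (z <= y)%O] :&: [set z : Y | (z <= y')%O] = set0) :
  universally_derived_equivalent (poset_plus Y0) (poset_minus Y0).
Proof.
move=> A; exists (loc_functor (cone_functor_quasi_iso (to_glue_nat hY0 A)
  (point_minus_quasi_iso (A := A)) (glue_minus_quasi_iso hY0 (A := A)))).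
split; first exact: reflection_equivalence.
exact: cone_functor_exact.
Qed.
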